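(* Let $X$ and $\widetilde X$ be two moderate solutions with the same initial condition $\overline X\in L^2(\Omega;H^{-1})$, defined on $[0,T]$ and $[0,\widetilde T]$ respectively, with $T\le\widetilde T$. Then $X=\widetilde X$ on $[0,T]$ almost surely.
   Context: Fix $\lambda>1$, $k_n:=\lambda^n$ for $n\ge0$, a constant $\sigma\ge0$, a filtered probability space $(\Omega,\mathcal F,\mathcal F_t,P)$ and independent Brownian motions $(W_n)_{n\ge0}$ on it. For $s\in\mathbb R$, $H^s:=\{x\in\mathbb R^{\mathbb N}:\|x\|_{H^s}:=(\sum_{n\ge1}k_n^{2s}x_n^2)^{1/2}<\infty\}$; $H^0=l^2$. The linear stochastic dyadic model with forcing $\sigma$ is the It\^o system $$dX_1=\sigma\,dW_0-k_1X_2\,dW_1-\tfrac12k_1^2X_1\,dt,$$ $$dX_n=k_{n-1}X_{n-1}\,dW_{n-1}-k_nX_{n+1}\,dW_n-\tfrac12(k_{n-1}^2+k_n^2)X_n\,dt,\quad n\ge2,$$ with $X(0)=\overline X$, where $\overline X$ is an $\mathcal F_0$-measurable random variable taking values in some $H^s$. A process $X=(X_n(t))_{n\ge1,t\in[0,T]}$ is a componentwise solution (on $[0,T]$) with initial condition $\overline X$ if it has adapted, continuous components and satisfies this system. A componentwise solution is a proper solution if $X\in L^2([0,T]\times\Omega;l^2)$ and $X_n\in L^4([0,T]\times\Omega)$ for all $n\ge1$. A componentwise solution $X$ is a moderate solution with initial condition $\overline X$ if $\overline X\in L^2(\Omega;H^{-1})$, $X\in L^2([0,T]\times\Omega;H^{-1})$,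 and there is a sequence $(X^{(N)})_{N\ge1}$ of proper solutions converging to $X$ in $L^2([0,T]\times\Omega;H^{-1})$ whose initial conditions $\overline X^{(N)}$ converge to $\overline X$ in $L^2(\Omega;H^{-1})$. *)

(* Defs.v *)
From HB Require Import structures.
From mathcomp Require Import all_boot all_order all_algebra.
From mathcomp Require Import all_classical all_reals all_analysis.
Set Implicit Arguments.
Unset Strict Implicit.
Unset Printing Implicit Defensive.
Import Order.TTheory GRing.Theory Num.Theory.
Import numFieldNormedType.Exports.
Local Open Scope classical_set_scope.
Local Open Scope ring_scope.

Section filtered_space.
Context {R : realType} {d : measure_display} {Omega : measurableType d}.
Variable P : probability Omega R.

(* Time is a real number, but only F t with 0 <= t is meaningful. *)
Definition filtration (F : R -> set (set Omega)) : Prop :=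
  [/\ forall t, 0 <= t -> sigma_algebra setT (F t),
      forall t, 0 <= t -> F t `<=` measurable &
      forall s t, 0 <= s -> s <= t -> F s `<=` F t].

Definition wrt_measurable (G : set (set Omega)) (Y : Omega -> R) : Prop :=
  forall B : set R, measurable B -> G (Y @^-1` B).

(* The second parameter of [normal_prob] is the standard deviation. *)
Definition brownian_motion (F : R -> set (set Omega)) (W : R -> Omega -> R)
    : Prop :=
  [/\ forall t, 0 <= t -> wrt_measurable (F t) (W t),
      {ae P, forall w, W 0 w = 0},
      {ae P, forall w, {within `[0, +oo[, continuous (fun t => W t w)}},
      forall s t, 0 <= s -> s < t -> forall B : set R, measurable B ->
        P ((fun w => W t w - W s w) @^-1` B)
        = normal_prob 0 (Num.sqrt (t - s)) B &
      forall s t, 0 <= s -> s < t ->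
        forall (A : set Omega) (B : set R), F s A -> measurable B ->
        P (A `&` (fun w => W t w - W s w) @^-1` B)
        = (P A * P ((fun w => W t w - W s w)%R @^-1` B))%E].

Definition process_sigma_algebra (W : R -> Omega -> R) : set (set Omega) :=
  <<s [set A | exists t : R, exists B : set R,
         [/\ 0 <= t, measurable B & A = W t @^-1` B]] >>.

Definition independent_processes (W : nat -> R -> Omega -> R) : Prop :=
  forall (N : nat) (A : nat -> set Omega),
    (forall n, (n < N)%N -> process_sigma_algebra (W n) (A n)) ->
    P (\bigcap_(n in [set n | (n < N)%N]) A n) = (\prod_(n < N) P (A n))%E.

(* The process \sum_(i < m) xi_i 1_(t_i, t_(i+1)] with xi_i bounded and
   F_(t_i)-measurable. *)
Record simple_process (F : R -> set (set Omega)) := SimpleProcess {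
  sp_size : nat ;
  sp_time : nat -> R ;
  sp_val : nat -> Omega -> R ;
  sp_time_ge0 : 0 <= sp_time 0%N ;
  sp_time_nondecreasing : forall i, sp_time i <= sp_time i.+1 ;
  sp_val_measurable : forall i, wrt_measurable (F (sp_time i)) (sp_val i) ;
  sp_val_bounded : exists C : R, forall i w, `|sp_val i w| <= C }.

Definition sp_fun F (H : simple_process F) (t : R) (w : Omega) : R :=
  \sum_(i < sp_size H)
    sp_val H i w * \1_(`]sp_time H i, sp_time H i.+1]) t.

Definition sp_integral F (H : simple_process F) (W : R -> Omega -> R)
    (t : R) (w : Omega) : R :=
  \sum_(i < sp_size H) sp_val H i w *
    (W (Num.min (sp_time H i.+1) t) w - W (Num.min (sp_time H i) t) w).

Definition cvg0_in_probability (Y : nat -> Omega -> \bar R) : Prop :=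
  forall e : R, 0 < e ->
    (fun m => P [set w | (e%:E <= `|Y m w|)%E]) @ \oo --> 0%E.

(* J is a version on [0, T] of the Ito integral process \int_0^t H_s dW_s, for
   an integrand with \int_0^T H_s^2 ds < +oo almost surely: the extension, by
   continuity in probability, of the integral of simple processes.  J t is
   thus only determined up to a null set for each t. *)
Definition ito_integral (F : R -> set (set Omega)) (T : R)
    (W H J : R -> Omega -> R) : Prop :=
  (forall t, 0 <= t <= T -> measurable_fun setT (J t)) /\
  exists S : nat -> simple_process F,
    cvg0_in_probability (fun m w =>
      (\int[lebesgue_measure]_(s in `[0%R, T])
        ((sp_fun (S m) s w - H s w) ^+ 2)%:E)%E) /\
    forall t, 0 <= t <= T ->
      cvg0_in_probability (fun m w => (sp_integral (S m) W t w - J t w)%:E).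

End filtered_space.

(* Sequences are indexed by n >= 1: the entry of index 0 of x : nat -> R, and
   the component X 0 of a process X : nat -> R -> Omega -> R, are ignored. *)
Section dyadic_model.
Context {R : realType} {d : measure_display} {Omega : measurableType d}.
Variable P : probability Omega R.
Variables (F : R -> set (set Omega)) (W : nat -> R -> Omega -> R).
Variables (lambda sigma : R).

Definition wavenumber (n : nat) : R := lambda ^+ n.
Local Notation k := wavenumber.

(* The square of the norm of H^s; it is +oo outside H^s. *)
Definition Hnorm2 (s : R) (x : nat -> R) : \bar R :=
  (\sum_(1 <= n <oo) ((k n `^ (2 * s)) * x n ^+ 2)%:E)%E.

Definition L2_Omega_sqnorm (s : R) (Y : nat -> Omega -> R) : \bar R :=
  (\int[P]_w Hnorm2 s (fun n => Y n w))%E.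

Definition in_L2_Omega (s : R) (Y : nat -> Omega -> R) : Prop :=
  (forall n, (1 <= n)%N -> measurable_fun setT (Y n)) /\
  (L2_Omega_sqnorm s Y < +oo)%E.

Definition L2_sqnorm (T s : R) (X : nat -> R -> Omega -> R) : \bar R :=
  (\int[lebesgue_measure \x P]_(z in `[0%R, T] `*` [set: Omega])
     Hnorm2 s (fun n => X n z.1 z.2))%E.

Definition in_L2 (T s : R) (X : nat -> R -> Omega -> R) : Prop :=
  (forall n, (1 <= n)%N ->
     measurable_fun (`[0, T] `*` [set: Omega])
       (fun z : R * Omega => X n z.1 z.2)) /\
  (L2_sqnorm T s X < +oo)%E.

Definition in_L4 (T : R) (Y : R -> Omega -> R) : Prop :=
  measurable_fun (`[0, T] `*` [set: Omega]) (fun z : R * Omega => Y z.1 z.2) /\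
  (\int[lebesgue_measure \x P]_(z in `[0%R, T] `*` [set: Omega])
     (`|Y z.1 z.2| ^+ 4)%:E < +oo)%E.

Definition initial_datum (X0 : nat -> Omega -> R) : Prop :=
  (forall n, (1 <= n)%N -> wrt_measurable (F 0) (X0 n)) /\
  exists s : R, {ae P, forall w, (Hnorm2 s (fun n => X0 n w) < +oo)%E}.

(* The system in integrated form; U n and V n are the Ito integrals of X_n and
   X_(n+1) against W_n. *)
Definition solves_system (T : R) (X : nat -> R -> Omega -> R) : Prop :=
  exists U V : nat -> R -> Omega -> R,
    [/\ forall n, (1 <= n)%N -> ito_integral P F T (W n) (X n) (U n),
        forall n, (1 <= n)%N -> ito_integral P F T (W n) (X n.+1) (V n),
        forall t, 0 <= t <= T -> {ae P, forall w,
          X 1%N t w = X 1%N 0 w + sigma * W 0%N t w - k 1 * V 1%N t w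
            - 2^-1 * k 1 ^+ 2
              * \int[lebesgue_measure]_(s in `[0, t]) X 1%N s w} &
        forall n t, (2 <= n)%N -> 0 <= t <= T -> {ae P, forall w,
          X n t w = X n 0 w + k n.-1 * U n.-1 t w - k n * V n t w
            - 2^-1 * (k n.-1 ^+ 2 + k n ^+ 2)
              * \int[lebesgue_measure]_(s in `[0, t]) X n s w}].

Definition componentwise_solution (T : R) (X0 : nat -> Omega -> R)
    (X : nat -> R -> Omega -> R) : Prop :=
  [/\ initial_datum X0,
      forall n t, (1 <= n)%N -> 0 <= t <= T -> wrt_measurable (F t) (X n t),
      forall n w, (1 <= n)%N -> {within `[0, T], continuous (fun t => X n t w)},
      forall n, (1 <= n)%N -> {ae P, forall w, X n 0 w = X0 n w} &
      solves_system T X].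

Definition proper_solution (T : R) (X0 : nat -> Omega -> R)
    (X : nat -> R -> Omega -> R) : Prop :=
  [/\ componentwise_solution T X0 X,
      in_L2 T 0 X &
      forall n, (1 <= n)%N -> in_L4 T (X n)].

Definition moderate_solution (T : R) (X0 : nat -> Omega -> R)
    (X : nat -> R -> Omega -> R) : Prop :=
  [/\ componentwise_solution T X0 X,
      in_L2_Omega (-1) X0,
      in_L2 T (-1) X &
      exists (XN : nat -> nat -> R -> Omega -> R)
             (X0N : nat -> nat -> Omega -> R),
        [/\ forall N, proper_solution T (X0N N) (XN N),
            (fun N => L2_sqnorm T (-1) (fun n t w => XN N n t w - X n t w))
              @ \oo --> 0%E,
            forall N, in_L2_Omega (-1) (X0N N) &
            (fun N => L2_Omega_sqnorm (-1) (fun n w => X0N N n w - X0 n w))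
              @ \oo --> 0%E]].

End dyadic_model.

(* Main.v *)
Require Import Defs.
From HB Require Import structures.
From mathcomp Require Import all_boot all_order all_algebra.
From mathcomp Require Import all_classical all_reals all_analysis.
From mathcomp Require Import measurable_realfun normal_distribution.
From mathcomp Require Import ring lra.
Import Order.TTheory GRing.Theory Num.Theory.
Import numFieldNormedType.Exports.
Local Open Scope classical_set_scope.
Local Open Scope ring_scope.
Set Implicit Arguments.
Unset Strict Implicit.
Unset Printing Implicit Defensive.

(** The theorem is an energy estimate in H^-1 for the linear system, applied to
    the difference Z of two proper solutions. The forcing cancels, and each
    component satisfies

      Z_n(t) = Z_n(0) + M_n(t) - c_n int_0^t Z_n ds,
      M_n = k_(n-1) int Z_(n-1) dW_(n-1) - k_n int Z_(n+1) dW_n,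
      2 c_n = k_(n-1)^2 + k_n^2,

    where k_0 is read as 0. Put a_n(t) = E int_0^t Z_n^2 ds. The martingale M_n is
    orthogonal to the past and driven by two independent motions, so the energy
    identity ([energy_identity]) and the isometry ([ito_limit_isometry]) give
    ([mode_energy])

      E Z_n(t)^2 <= E Z_n(0)^2 + k_(n-1)^2 (a_(n-1) - a_n) + k_n^2 (a_(n+1) - a_n).

    Division by k_n^2 turns the two exchange terms into
    lambda^-2 (a_(n-1) - a_n) and a_(n+1) - a_n, which both telescope; the sum over
    n <= N is at most a_(N+1)(t). A proper solution is square integrable with
    values in l^2, so a_(N+1) is small for suitable N, and the mean square of the
    H^-1 norm of Z(t) is at most that of Z(0) ([mode_bound]). The proper solutions
    that approximate two moderate solutions with the same initial condition
    therefore merge, mode by mode, in L^2 over time and chance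
    ([moderate_sqdist0]); continuity of the paths then gives equality at all times.

    Three ingredients of the stochastic calculus are built on the way. First, the
    Ito integral is given by convergence in probability; for adapted square-integrable
    integrands with continuous paths it is shown to be a limit in mean square
    ([ito_integral_limit]), by density of simple processes, Lenglart's inequality
    and Fatou's lemma. Second, the motions are independent of each other as
    processes, and each is independent of the past, but their joint law given the
    past is not prescribed; that products of increments of two motions are still
    orthogonal to the past is [increment_cross_orthogonal]. Third, the expected
    value of the square of a component is computed without an Ito formula, from
    the orthogonality of M_n and from the fact that the square of a primitive is
    twice the integral of the primitive times its derivative. *)

(** * Square-integrable functions *)

Section square_integrable.
Context {d : measure_display} {T : measurableType d} {R : realType}.
Variables (mu : {measure set T -> \bar R}) (D : set T).
Hypothesis mD : measurable D.
Implicit Types f g : T -> R.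

Definition sqnorm (f : T -> R) : \bar R := (\int[mu]_(x in D) (f x ^+ 2)%:E)%E.

Definition square_integrable (f : T -> R) : Prop :=
  measurable_fun D f /\ (sqnorm f < +oo)%E.

Lemma sqnorm_ge0 f : (0 <= sqnorm f)%E.
Proof. by apply: integral_ge0 => x _; rewrite lee_fin sqr_ge0. Qed.

Lemma eq_sqnorm f g : {in D, f =1 g} -> sqnorm f = sqnorm g.
Proof. by move=> fg; apply: eq_integral => x xD; rewrite fg. Qed.

Lemma measurable_sqr f : measurable_fun D f ->
  measurable_fun D (fun x => (f x ^+ 2)%:E).
Proof. by move=> mf; apply/measurable_EFinP; exact: measurable_funX. Qed.

Lemma le_sqnorm f g : measurable_fun D f -> measurable_fun D g ->
  (forall x, D x -> `|f x| <= `|g x|) -> (sqnorm f <= sqnorm g)%E.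
Proof.
move=> mf mg fg; apply: ge0_le_integral => //.
- by move=> x _; rewrite lee_fin sqr_ge0.
- exact: measurable_sqr.
- exact: measurable_sqr.
- move=> x Dx; rewrite lee_fin -(real_normK (num_real (f x))).
  by rewrite -(real_normK (num_real (g x))) lerXn2r ?nnegrE ?fg.
Qed.

Lemma sqnormZ a f : measurable_fun D f ->
  sqnorm (fun x => a * f x) = ((a ^+ 2)%:E * sqnorm f)%E.
Proof.
move=> mf; rewrite -ge0_integralZl_EFin ?sqr_ge0//.
- by apply: eq_integral => x _; rewrite exprMn EFinM.
- by move=> x _; rewrite lee_fin sqr_ge0.
- exact: measurable_sqr.
Qed.

Lemma sqnormN f : sqnorm (fun x => - f x) = sqnorm f.
Proof. by apply: eq_integral => x _; rewrite sqrrN. Qed.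

(** Young's inequality for the cross term: the constant in front of [sqnorm f]
    can be taken as close to 1 as wished. *)
Lemma sqnormD_young f g (eta : R) : measurable_fun D f -> measurable_fun D g ->
  0 < eta ->
  (sqnorm (fun x => f x + g x)%R <=
   (1 + eta)%:E * sqnorm f + (1 + eta^-1)%:E * sqnorm g)%E.
Proof.
move=> mf mg e0.
have h1 : 0 <= 1 + eta by rewrite addr_ge0 // ltW.
have h2 : 0 <= 1 + eta^-1 by rewrite addr_ge0 // invr_ge0 ltW.
rewrite -!ge0_integralZl_EFin //; last 4 first.
- by move=> x _; rewrite lee_fin sqr_ge0.
- exact: measurable_sqr.
- by move=> x _; rewrite lee_fin sqr_ge0.
- exact: measurable_sqr.
rewrite -ge0_integralD //; last 4 first.
- by move=> x _; rewrite mule_ge0 ?lee_fin ?sqr_ge0.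
- by apply: measurable_funeM; exact: measurable_sqr.
- by move=> x _; rewrite mule_ge0 ?lee_fin ?sqr_ge0.
- by apply: measurable_funeM; exact: measurable_sqr.
apply: ge0_le_integral => //.
- by move=> x _; rewrite lee_fin sqr_ge0.
- by apply: measurable_sqr; exact: measurable_funD.
- by apply: emeasurable_funD; apply: measurable_funeM; exact: measurable_sqr.
- move=> x _; rewrite -!EFinM -EFinD lee_fin -subr_ge0.
  have -> : (1 + eta) * f x ^+ 2 + (1 + eta^-1) * g x ^+ 2 - (f x + g x) ^+ 2
    = eta^-1 * (eta * f x - g x) ^+ 2 by field; rewrite gt_eqF.
  by rewrite mulr_ge0 ?sqr_ge0// invr_ge0 ltW.
Qed.

Lemma sqnormD_le f g : measurable_fun D f -> measurable_fun D g ->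
  (sqnorm (fun x => f x + g x)%R <= 2%:E * sqnorm f + 2%:E * sqnorm g)%E.
Proof.
move=> mf mg; have := sqnormD_young mf mg ltr01.
by rewrite invr1 -[1 + 1]/(2%:R).
Qed.

Lemma sqnormB_le f g : measurable_fun D f -> measurable_fun D g ->
  (sqnorm (fun x => f x - g x)%R <= 2%:E * sqnorm f + 2%:E * sqnorm g)%E.
Proof.
move=> mf mg; rewrite -(sqnormN g).
by apply: (@sqnormD_le f (fun x => - g x)) => //; exact: measurableT_comp.
Qed.

Lemma sqintD f g : square_integrable f -> square_integrable g ->
  square_integrable (fun x => f x + g x).
Proof.
move=> [mf f2] [mg g2]; split; first exact: measurable_funD.
apply: le_lt_trans (sqnormD_le mf mg) _.
by apply: lte_add_pinfty; apply: lte_mul_pinfty => //; rewrite lee_fin.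
Qed.

Lemma sqintZ a f : square_integrable f -> square_integrable (fun x => a * f x).
Proof.
move=> [mf f2]; split; first exact: measurable_funM.
by rewrite sqnormZ// lte_mul_pinfty// lee_fin sqr_ge0.
Qed.

Lemma sqintN f : square_integrable f -> square_integrable (fun x => - f x).
Proof. by move=> [mf f2]; split; [exact: measurableT_comp|rewrite sqnormN]. Qed.

Lemma sqintB f g : square_integrable f -> square_integrable g ->
  square_integrable (fun x => f x - g x).
Proof. by move=> h1 h2; apply: sqintD => //; exact: sqintN. Qed.

Lemma sqint_le f g : measurable_fun D f -> square_integrable g ->
  (forall x, D x -> `|f x| <= `|g x|) -> square_integrable f.
Proof.
by move=> mf [mg g2] fg; split=> //; exact: le_lt_trans (le_sqnorm mf mg fg) g2.
Qed.

Lemma sqint_sqr f : square_integrable f ->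
  mu.-integrable D (EFin \o (fun x => f x ^+ 2)).
Proof.
move=> [mf f2]; apply/integrableP; split; first exact: measurable_sqr.
rewrite (eq_integral (fun x => (f x ^+ 2)%:E))// => x _.
by rewrite gee0_abs// lee_fin sqr_ge0.
Qed.

Lemma sqint_mul f g : square_integrable f -> square_integrable g ->
  mu.-integrable D (EFin \o (fun x => f x * g x)).
Proof.
move=> sf sg; have [mf _] := sf; have [mg _] := sg.
apply: (@le_integrable _ _ _ _ _ mD _
  (fun x => (f x ^+ 2)%:E + (g x ^+ 2)%:E)%E).
- by apply/measurable_EFinP; exact: measurable_funM.
- move=> x _; rewrite -EFinD !abse_EFin lee_fin.
  rewrite (ger0_norm (addr_ge0 (sqr_ge0 _) (sqr_ge0 _))) normrM.
  rewrite -(real_normK (num_real (f x))) -(real_normK (num_real (g x))).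
  rewrite -subr_ge0; set a := `|f x|; set b := `|g x|.
  have a0 : 0 <= a := normr_ge0 _.
  have b0 : 0 <= b := normr_ge0 _.
  by nra.
- by apply: integrableD => //; exact: sqint_sqr.
Qed.

Lemma sqnorm_fin f : square_integrable f ->
  sqnorm f = (\int[mu]_(x in D) (f x ^+ 2))%:E.
Proof. by move=> sf; rewrite fineK// integrable_fin_num//; exact: sqint_sqr. Qed.

Lemma sqint_sum (I : Type) (r : seq I) (f : I -> T -> R) :
  (forall i, square_integrable (f i)) ->
  square_integrable (fun x => \sum_(i <- r) f i x).
Proof.
move=> sf; elim: r => [|i r ih].
  have -> : (fun x => \sum_(i <- [::]) f i x) = cst 0.
    by apply/funext => x; rewrite big_nil.
  split; first exact: measurable_cst.
  rewrite /sqnorm (eq_integral (fun=> 0%E)) ?integral0//.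
  by move=> x _; rewrite expr0n.
have -> : (fun x => \sum_(j <- i :: r) f j x) =
    (fun x => f i x + \sum_(j <- r) f j x).
  by apply/funext => x; rewrite big_cons.
exact: sqintD.
Qed.

Lemma Rintegral_mul_young f g (eta : R) : square_integrable f ->
  square_integrable g -> 0 < eta ->
  `|\int[mu]_(x in D) (f x * g x)| <=
  eta * \int[mu]_(x in D) (f x ^+ 2) + eta^-1 * \int[mu]_(x in D) (g x ^+ 2).
Proof.
move=> sf sg e0; have ifg := sqint_mul sf sg.
apply: le_trans (le_normr_Rintegral mD ifg) _.
have i1 := sqint_sqr sf; have i2 := sqint_sqr sg.
rewrite -!RintegralZl//.
have j1 : mu.-integrable D (EFin \o (fun x => eta * f x ^+ 2)).
  exact: (integrableZl mD eta i1).
have j2 : mu.-integrable D (EFin \o (fun x => eta^-1 * g x ^+ 2)).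
  exact: (integrableZl mD eta^-1 i2).
rewrite -RintegralD//.
apply: le_Rintegral => //; first exact: (integrable_norm ifg).
- exact: (integrableD mD j1 j2).
move=> x _; rewrite -subr_ge0 normrM.
rewrite -(real_normK (num_real (f x))) -(real_normK (num_real (g x))).
set a := `|f x|; set b := `|g x|.
have -> : eta * a ^+ 2 + eta^-1 * b ^+ 2 - a * b =
  (eta * a - b) ^+ 2 * eta^-1 + a * b by field; rewrite gt_eqF.
by apply: addr_ge0; apply: mulr_ge0;
  rewrite ?sqr_ge0 ?invr_ge0 ?normr_ge0// ltW.
Qed.

End square_integrable.

Section finite_square_integrable.
Context {d : measure_display} {T : measurableType d} {R : realType}.
Variables (mu : {measure set T -> \bar R}) (D : set T).
Hypotheses (mD : measurable D) (muD : (mu D < +oo)%E).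
Implicit Types f : T -> R.

Lemma sqint_bounded f C : measurable_fun D f ->
  (forall x, D x -> `|f x| <= C) -> square_integrable mu D f.
Proof.
move=> mf fC; apply: (@sqint_le _ _ _ _ _ mD _ (cst C)) => //.
- split; first exact: measurable_cst.
  rewrite /sqnorm /= integral_cst//= lte_mul_pinfty// ?lee_fin ?sqr_ge0//.
- by move=> x Dx /=; apply: le_trans (fC x Dx) _; exact: ler_norm.
Qed.

Lemma sqint_integrable f : square_integrable mu D f ->
  mu.-integrable D (EFin \o f).
Proof.
move=> sf; have s1 : square_integrable mu D (cst 1).
  by apply: (@sqint_bounded _ 1) => //= x _; rewrite normr1.
have := sqint_mul mD sf s1.
by under eq_fun do rewrite mulr1.
Qed.

End finite_square_integrable.

(** * Moments of the normal law *)

Section normal_moments.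
Context {R : realType}.
Local Notation mu := (@lebesgue_measure R).
Implicit Types s : R.

Lemma integral_derivative (F f : R -> R) (a b : R) : a < b -> continuous f ->
  (forall x, is_derive x (1 : R) F (f x)) ->
  (\int[mu]_(x in `[a, b]) (f x)%:E = (F b - F a)%:E)%E.
Proof.
move=> ab cf dF.
have cF : continuous F.
  move=> x; apply: differentiable_continuous.
  by apply/derivable1_diffP; have [] := dF x.
rewrite (@continuous_FTC2 R f F a b)//.
- exact: continuous_subspaceT.
- split.
  + by move=> x _; have [] := dF x.
  + exact/cvg_at_right_filter/cF.
  + exact/cvg_at_left_filter/cF.
- by move=> x _; rewrite derive1E; have [] := dF x.
Qed.

Lemma ge0_integral_normal_prob s (f : R -> \bar R) :
  measurable_fun setT f -> (forall x, 0 <= f x)%E ->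
  (\int[normal_prob 0%R s]_x f x = \int[mu]_x (f x * (normal_pdf 0 s x)%:E))%E.
Proof.
move=> mf f0.
have dom := normal_prob_dominates 0 s.
rewrite -(Radon_Nikodym_SigmaFinite.change_of_variables dom)//.
apply: ge0_ae_eq_integral => //.
- apply: emeasurable_funM => //; apply: (measurable_int mu).
  exact: Radon_Nikodym_SigmaFinite.f_integrable.
- apply: emeasurable_funM => //; apply/measurable_EFinP.
  exact: measurable_normal_pdf.
- by move=> x _; rewrite mule_ge0// Radon_Nikodym_SigmaFinite.f_ge0.
- by move=> x _; rewrite mule_ge0// lee_fin normal_pdf_ge0.
- apply: ae_eqe_mul2l; apply: integral_ae_eq => //.
  + exact: Radon_Nikodym_SigmaFinite.f_integrable.
  + by apply/measurable_EFinP; exact: measurable_normal_pdf.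
  + by move=> E _ mE; rewrite -Radon_Nikodym_SigmaFinite.f_integral.
Qed.

Lemma normal_pdfN s x : s != 0 -> normal_pdf 0 s (- x) = normal_pdf 0 s x.
Proof.
by move=> s0; rewrite normal_pdfE// /normal_fun !subr0 sqrrN.
Qed.

Lemma ge0_integral_lebesgueN (f : R -> \bar R) :
  measurable_fun setT f -> (forall x, 0 <= f x)%E ->
  (\int[mu]_x f (- x)%R = \int[mu]_x f x)%E.
Proof.
move=> mf f0.
have := @ge0_integral_pushforward _ _ _ _ _
  (-%R : measurableTypeR R -> measurableTypeR R)
  (@oppr_measurable R setT) mu setT f measurableT mf.
rewrite preimage_setT => <-; last by [].
by apply: eq_measure_integral => A mA _; exact: lebesgue_measureN.
Qed.

(** The primitive behind the second moment: it is odd and negative for x > 0, so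
    the integral of (x^2 - s^2) times the density over [-a, a] is negative. *)
Lemma is_derive_normal_fun s (x : R) : s != 0 ->
  is_derive x (1 : R) (fun x => - s ^+ 2 * x * normal_pdf 0 s x)
    ((x ^+ 2 - s ^+ 2) * normal_pdf 0 s x).
Proof.
move=> s0.
have d1 : is_derive x (1 : R) (normal_fun 0 s)
    (normal_fun 0 s x * (- x / s ^+ 2)).
  have -> : normal_fun 0 s = expR \o ((- (s ^+ 2 *+ 2)^-1) \*: (id * id)%R).
    apply/funext => y; rewrite /normal_fun /= subr0; congr expR.
    by rewrite fctE /GRing.scale /= !mulNr mulrC expr2.
  apply: is_derive1_comp.
  have := @is_deriveZ R R _ (id * id)%R (- (s ^+ 2 *+ 2)^-1) x 1 _
    (is_deriveM (is_derive_id x 1) (is_derive_id x 1)).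
  move/is_derive_eq; apply.
  rewrite /GRing.scale/= -mulr_natr.
  by field.
rewrite normal_pdfE//.
pose c := - s ^+ 2 * normal_peak s.
have -> : (fun x => - s ^+ 2 * x * (normal_peak s * normal_fun 0 s x)) =
    c \*: (id * normal_fun 0 s)%R.
  apply/funext => y; rewrite /c fctE.
    rewrite -[RHS]/(- s ^+ 2 * normal_peak s * (y * normal_fun 0 s y)); ring.
have := @is_deriveZ R R _ (id * normal_fun 0 s) c x 1 _
  (is_deriveM (is_derive_id x 1) d1).
move/is_derive_eq; apply.
rewrite /c /GRing.scale /=; field.
exact: s0.
Qed.

Lemma normal_sqmoment_le s : 0 < s ->
  (\int[normal_prob 0%R s]_x ((x : R) ^+ 2)%:E <= (s ^+ 2)%:E)%E.
Proof.
move=> s0; have sn0 : s != 0 by rewrite gt_eqF.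
have m2 : measurable_fun setT (fun x : R => (x ^+ 2)%:E).
  by apply/measurable_EFinP; exact: measurable_funX.
rewrite ge0_integral_normal_prob//; last by move=> x; rewrite lee_fin sqr_ge0.
pose I n := `[- n.+1%:R, n.+1%:R ]%classic : set (measurableTypeR R).
have mI n : measurable (I n) := measurable_itv _.
have mg n : measurable_fun (I n)
    (fun x : R => (x ^+ 2)%:E * (normal_pdf 0 s x)%:E)%E.
  apply: measurable_funTS; apply: emeasurable_funM => //.
  by apply/measurable_EFinP; exact: measurable_normal_pdf.
have mp n : measurable_fun (I n) (fun x : R => (normal_pdf 0 s x)%:E).
  by apply: measurable_funTS; apply/measurable_EFinP; exact: measurable_normal_pdf.
have IT : \bigcup_n I n = setT.
  apply/seteqP; split => // x _.
  exists (Num.trunc `|x|) => //=.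
  rewrite /I /= in_itv /= -ler_norml ltW//.
  by have /andP[] := trunc_itv (normr_ge0 x).
rewrite -IT.
have ndI : {homo I : n m / (n <= m)%N >-> (n <= m)%O}.
  move=> n m nm; rewrite subsetEset => x; rewrite /I /= !in_itv /= => /andP[h1 h2].
  have h3 : n.+1%:R <= m.+1%:R :> R by rewrite ler_nat.
  by rewrite (le_trans h2 h3) (le_trans _ h1)// lerN2.
have := @ge0_nondecreasing_set_cvg_integral _ (measurableTypeR R) R I
  (fun x : R => (x ^+ 2)%:E * (normal_pdf 0 s x)%:E)%E mu ndI mI mg.
move=> /(_ _)/cvg_lim <- //; last first.
  by move=> n x _; rewrite -EFinM lee_fin mulr_ge0 ?sqr_ge0 ?normal_pdf_ge0.
apply: lime_le.
  apply/cvg_ex; eexists; apply: ge0_nondecreasing_set_cvg_integral => //.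
  by move=> n x _; rewrite -EFinM lee_fin mulr_ge0 ?sqr_ge0 ?normal_pdf_ge0.
apply: nearW => n.
have cont : continuous (fun x : R => (x ^+ 2 - s ^+ 2) * normal_pdf 0 s x).
  move=> x; apply: cvgM; last exact: continuous_normal_pdf.
  by apply: cvgB; [exact: sqr_continuous|exact: cvg_cst].
have n0 : - n.+1%:R < n.+1%:R :> R by rewrite gtrN.
have E := integral_derivative n0 cont (fun x => is_derive_normal_fun x sn0).
have i1 : mu.-integrable (I n) (EFin \o (fun x => (x ^+ 2 - s ^+ 2) * normal_pdf 0 s x)).
  by apply: continuous_compact_integrable; [exact: segment_compact|exact: continuous_subspaceT].
have i2 : mu.-integrable (I n) (EFin \o (fun x => s ^+ 2 * normal_pdf 0 s x)).
  apply: continuous_compact_integrable; first exact: segment_compact.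
  apply: continuous_subspaceT => x; apply: cvgM; first exact: cvg_cst.
  exact: continuous_normal_pdf.
have -> : (\int[mu]_(x in I n) ((x ^+ 2)%:E * (normal_pdf 0 s x)%:E) =
    \int[mu]_(x in I n) (((x ^+ 2 - s ^+ 2) * normal_pdf 0 s x)%:E
      + (s ^+ 2 * normal_pdf 0 s x)%:E))%E.
  by apply: eq_integral => x _; rewrite -EFinM -EFinD; congr (_%:E); ring.
rewrite integralD_EFin//=.
rewrite [X in (X + _)%E]E.
have J : (\int[mu]_(x in I n) (s ^+ 2 * normal_pdf 0 s x)%:E <= (s ^+ 2)%:E)%E.
  have -> : (\int[mu]_(x in I n) (s ^+ 2 * normal_pdf 0 s x)%:E =
      (s ^+ 2)%:E * \int[mu]_(x in I n) (normal_pdf 0 s x)%:E)%E.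
    rewrite -ge0_integralZl_EFin ?sqr_ge0//.
    - by move=> x _; rewrite lee_fin normal_pdf_ge0.
  rewrite -[X in (_ <= X)%E]mule1 lee_pmul2l ?lte_fin ?exprn_gt0//.
  rewrite -(integral_normal_pdf 0 s); apply: ge0_subset_integral => //.
  - by apply/measurable_EFinP; exact: measurable_normal_pdf.
  - by move=> x _; rewrite lee_fin normal_pdf_ge0.
rewrite -[X in (_ <= X)%E]add0e; apply: leeD => //.
rewrite lee_fin normal_pdfN// -mulrBl mulrN opprK -mulr2n.
rewrite mulr_le0_ge0 ?normal_pdf_ge0//.
by rewrite pmulrn_lle0// mulr_le0_ge0// oppr_le0 sqr_ge0.
Qed.

Lemma normal_sqint s : 0 < s ->
  square_integrable (normal_prob (0 : R) s) setT id.
Proof.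
by move=> s0; split => //; exact: le_lt_trans (normal_sqmoment_le s0) (ltry _).
Qed.

(** By symmetry: the positive and the negative part have the same integral. *)
Lemma normal_mean0 s : 0 < s -> \int[normal_prob (0 : R) s]_x x = 0.
Proof.
move=> s0; have sn0 : s != 0 by rewrite gt_eqF.
rewrite /Rintegral integralE.
have mp : measurable_fun setT ((@EFin R) ^\+)%E.
  by apply: measurable_funepos.
have mn : measurable_fun setT ((@EFin R) ^\-)%E.
  by apply: measurable_funeneg.
have -> : (\int[normal_prob (0 : R) s]_x ((@EFin R) ^\- x) =
    \int[normal_prob (0 : R) s]_x ((@EFin R) ^\+ x))%E.
  rewrite !ge0_integral_normal_prob//.
  rewrite -(@ge0_integral_lebesgueN
    (fun x => (@EFin R) ^\+ x * (normal_pdf 0 s x)%:E)%E); last 2 first.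
  - apply: emeasurable_funM => //.
    by apply/measurable_EFinP; exact: measurable_normal_pdf.
  - by move=> x; rewrite mule_ge0// lee_fin normal_pdf_ge0.
  apply: eq_integral => x _; rewrite normal_pdfN//; congr (_ * _)%E.
  by rewrite funenegE funeposE EFinN.
rewrite subee// ge0_fin_numE; last by apply: integral_ge0.
have i1 := sqint_integrable measurableT
  (fin_num_fun_lty (fin_num_measure (normal_prob (0 : R) s))) (normal_sqint s0).
exact: (integral_funepos_lt_pinfty measurableT i1).
Qed.

End normal_moments.

(** * Independence *)

Section independence.
Local Open Scope ereal_scope.
Context {d : measure_display} {Omega : measurableType d} {R : realType}.
Variable P : probability Omega R.

Definition independent_rv (X Y : Omega -> R) : Prop :=
  forall A B : set R, measurable A -> measurable B ->
    P (X @^-1` A `&` Y @^-1` B) = P (X @^-1` A) * P (Y @^-1` B).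

(** Independence says that the joint law is the product of the two laws, so the
    formula is Tonelli's theorem. *)
Lemma ge0_integral_independent (X Y : Omega -> R) (f g : R -> \bar R) :
  measurable_fun setT X -> measurable_fun setT Y -> independent_rv X Y ->
  measurable_fun setT f -> measurable_fun setT g ->
  (forall x, 0 <= f x) -> (forall x, 0 <= g x) ->
  \int[P]_w (f (X w) * g (Y w)) = \int[P]_w f (X w) * \int[P]_w g (Y w).
Proof.
move=> mX mY XY mf mg f0 g0.
have mXY : measurable_fun setT (fun w => (X w, Y w)).
  exact/measurable_fun_pair.
pose X' : {mfun Omega >-> R} := mfun_Sub (mem_set mX).
pose Y' : {mfun Omega >-> R} := mfun_Sub (mem_set mY).
pose Z' : {mfun Omega >-> (R * R)%type} := mfun_Sub (mem_set mXY).
have lawE (S : set (R * R)) : measurable S ->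
    (distribution P X' \x distribution P Y') S = distribution P Z' S.
  apply: product_measure_unique => A B mA mB.
  by rewrite -[RHS]XY.
have mfg : measurable_fun setT (fun z : R * R => f z.1 * g z.2).
  by apply: emeasurable_funM; apply: measurableT_comp.
transitivity (\int[distribution P Z']_z (f z.1 * g z.2)).
  rewrite ge0_integral_distribution//.
  by move=> z; rewrite mule_ge0.
transitivity (\int[distribution P X' \x distribution P Y']_z (f z.1 * g z.2)).
  by apply: eq_measure_integral => S mS _; exact/esym/lawE.
rewrite (fubini_tonelli1 (fun z : R * R => f z.1 * g z.2))//; last first.
  by move=> z; rewrite mule_ge0.
have G0 : 0 <= \int[distribution P Y']_y g y by exact: integral_ge0.
rewrite /fubini_F /=.
under eq_integral do rewrite ge0_integralZl//.
rewrite ge0_integralZr//.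
by congr (_ * _); rewrite ge0_integral_distribution.
Qed.

Lemma independent_integrableM (X Y : Omega -> R) :
  P.-integrable setT (EFin \o X) -> P.-integrable setT (EFin \o Y) ->
  independent_rv X Y -> P.-integrable setT (fun w => (X w * Y w)%:E).
Proof.
move=> /integrableP[/measurable_EFinP mX iX] /integrableP[/measurable_EFinP mY iY].
move=> XY; apply/integrableP; split.
  by apply/measurable_EFinP; exact: measurable_funM.
have -> : \int[P]_w `|(X w * Y w)%:E| = \int[P]_w (`|(X w)%:E| * `|(Y w)%:E|).
  by apply: eq_integral => w _; rewrite EFinM abseM.
rewrite (@ge0_integral_independent X Y (abse \o EFin) (abse \o EFin))//.
- rewrite lte_mul_pinfty ?ge0_fin_numE ?integral_ge0//.
  + by move=> x _ /=.
  + by move=> x _ /=.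
- exact: measurableT_comp.
- exact: measurableT_comp.
- by move=> x /=.
- by move=> x /=.
Qed.
Lemma Rintegral_independent (X Y : Omega -> R) :
  P.-integrable setT (EFin \o X) -> P.-integrable setT (EFin \o Y) ->
  independent_rv X Y ->
  (\int[P]_w (X w * Y w) = \int[P]_w X w * \int[P]_w Y w)%R.
Proof.
move=> iX iY XY.
have iXY := independent_integrableM iX iY XY.
have /measurable_EFinP mX := measurable_int _ iX.
have /measurable_EFinP mY := measurable_int _ iY.
have mXY : measurable_fun setT (fun w => (X w, Y w)).
  exact/measurable_fun_pair.
pose X' : {mfun Omega >-> R} := mfun_Sub (mem_set mX).
pose Y' : {mfun Omega >-> R} := mfun_Sub (mem_set mY).
pose Z' : {mfun Omega >-> (R * R)%type} := mfun_Sub (mem_set mXY).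
have lawE (S : set (R * R)) : measurable S ->
    (distribution P X' \x distribution P Y') S = distribution P Z' S.
  apply: product_measure_unique => A B mA mB.
  by rewrite -[RHS]XY.
have mp : measurable_fun setT (fun z : R * R => (z.1 * z.2)%:E).
  by apply/measurable_EFinP; apply: measurable_funM.
have ip : (distribution P X' \x distribution P Y').-integrable setT
    (fun z : R * R => (z.1 * z.2)%:E).
  apply/integrableP; split => //.
  have /integrableP[_] := iXY; congr (_ < +oo).
  transitivity (\int[distribution P Z']_z `|(z.1 * z.2)%:E|).
    by rewrite ge0_integral_distribution//; exact: measurableT_comp.
  by apply: eq_measure_integral => S mS _; exact/esym/lawE.
suff E : \int[P]_w (X w * Y w)%:E = \int[P]_w (X w)%:E * \int[P]_w (Y w)%:E.
  by rewrite /Rintegral E fineM//; exact: integrable_fin_num.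
transitivity (\int[distribution P Z']_z (z.1 * z.2)%:E).
  by rewrite integral_distribution.
transitivity (\int[distribution P X' \x distribution P Y']_z (z.1 * z.2)%:E).
  by apply: eq_measure_integral => S mS _; exact/esym/lawE.
have idX : (distribution P X').-integrable setT (@EFin R).
  by have := @integrable_pushforward; apply.
have idY : (distribution P Y').-integrable setT (@EFin R).
  by have := @integrable_pushforward; apply.
rewrite -(integral12_prod_meas1 ip) /fubini_F /=.
under eq_integral do (under eq_integral do rewrite EFinM; rewrite integralZl//).
have [r hr] : exists r, \int[distribution P Y']_y y%:E = r%:E.
  by exists (fine (\int[distribution P Y']_y y%:E)); rewrite fineK// integrable_fin_num.
rewrite hr integralZr//.
by rewrite -hr; congr (_ * _); rewrite integral_distribution.
Qed.

End independence.

(** * Measurability along a filtration *)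

Section filtration_measurability.
Context {d : measure_display} {Omega : measurableType d} {R : realType}.
Implicit Types (G : set (set Omega)) (X Y : Omega -> R).

(** Replacing the structure of the domain by G turns the closure properties of
    measurable functions into those of G-measurable ones. *)
Lemma wrt_measurableE G X : sigma_algebra setT G ->
  wrt_measurable G X <->
  measurable_fun setT (X : g_sigma_algebraType G -> R).
Proof.
move=> sG; have E : <<s G >> = G by exact: sigma_algebra_id.
split => [h _ B mB|h B mB].
- by rewrite setTI /measurable/= E; exact: h.
- by have := h measurableT B mB; rewrite setTI /measurable/= E.
Qed.

Lemma wrt_measurable_sub G G' X : G `<=` G' ->
  wrt_measurable G X -> wrt_measurable G' X.
Proof. by move=> GG' h B mB; exact/GG'/h. Qed.

Lemma wrt_measurable_fun G X : G `<=` measurable ->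
  wrt_measurable G X -> measurable_fun setT X.
Proof. by move=> Gm h _ B mB; rewrite setTI; exact/Gm/h. Qed.

Section closure.
Variable G : set (set Omega).
Hypothesis sG : sigma_algebra setT G.

Lemma wrt_measurable_cst (c : R) : wrt_measurable G (fun=> c).
Proof. by apply/wrt_measurableE. Qed.

Lemma wrt_measurableD X Y : wrt_measurable G X -> wrt_measurable G Y ->
  wrt_measurable G (fun w => X w + Y w).
Proof.
move=> /(wrt_measurableE _ sG) mX /(wrt_measurableE _ sG) mY.
by apply/(wrt_measurableE _ sG); exact: measurable_funD.
Qed.

Lemma wrt_measurableB X Y : wrt_measurable G X -> wrt_measurable G Y ->
  wrt_measurable G (fun w => X w - Y w).
Proof.
move=> /(wrt_measurableE _ sG) mX /(wrt_measurableE _ sG) mY.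
by apply/(wrt_measurableE _ sG); exact: measurable_funB.
Qed.

Lemma wrt_measurableM X Y : wrt_measurable G X -> wrt_measurable G Y ->
  wrt_measurable G (fun w => X w * Y w).
Proof.
move=> /(wrt_measurableE _ sG) mX /(wrt_measurableE _ sG) mY.
by apply/(wrt_measurableE _ sG); exact: measurable_funM.
Qed.

Lemma wrt_measurable_comp (f : R -> R) X : measurable_fun setT f ->
  wrt_measurable G X -> wrt_measurable G (fun w => f (X w)).
Proof.
move=> mf mX B mB; have := mX (f @^-1` B).
by apply; rewrite -[X in measurable X]setTI; exact: mf.
Qed.

Lemma wrt_measurable_sum (I : Type) (r : seq I) (X : I -> Omega -> R) :
  (forall i, wrt_measurable G (X i)) ->
  wrt_measurable G (fun w => \sum_(i <- r) X i w).
Proof.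
move=> mX; elim: r => [|i r ih].
  by under eq_fun do rewrite big_nil; exact: wrt_measurable_cst.
by under eq_fun do rewrite big_cons; exact: wrt_measurableD.
Qed.

End closure.
End filtration_measurability.

(** * Bilinearity of the inner product *)

Section inner_product.
Context {d : measure_display} {T : measurableType d} {R : realType}.
Variables (mu : {measure set T -> \bar R}) (D : set T).
Hypothesis mD : measurable D.
Implicit Types f g h : T -> R.
Local Notation L2 := (square_integrable mu D).

Lemma Rintegral_mulDl f g h : L2 f -> L2 g -> L2 h ->
  \int[mu]_(x in D) ((f x + g x) * h x) =
  \int[mu]_(x in D) (f x * h x) + \int[mu]_(x in D) (g x * h x).
Proof.
move=> sf sg sh; rewrite -RintegralD//.
- by apply: eq_Rintegral => x _; rewrite mulrDl.
- exact: sqint_mul.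
- exact: sqint_mul.
Qed.

Lemma Rintegral_mulZl a f h : L2 f -> L2 h ->
  \int[mu]_(x in D) ((a * f x) * h x) = a * \int[mu]_(x in D) (f x * h x).
Proof.
move=> sf sh; rewrite -RintegralZl//; last exact: sqint_mul.
by apply: eq_Rintegral => x _; rewrite mulrA.
Qed.

Lemma Rintegral_mulC f g :
  \int[mu]_(x in D) (f x * g x) = \int[mu]_(x in D) (g x * f x).
Proof. by apply: eq_Rintegral => x _; rewrite mulrC. Qed.

Lemma Rintegral_mulDr f g h : L2 f -> L2 g -> L2 h ->
  \int[mu]_(x in D) (h x * (f x + g x)) =
  \int[mu]_(x in D) (h x * f x) + \int[mu]_(x in D) (h x * g x).
Proof.
by move=> sf sg sh; rewrite Rintegral_mulC Rintegral_mulDl// 2!(Rintegral_mulC h).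
Qed.

Lemma Rintegral_mulZr a f h : L2 f -> L2 h ->
  \int[mu]_(x in D) (h x * (a * f x)) = a * \int[mu]_(x in D) (h x * f x).
Proof.
by move=> sf sh; rewrite Rintegral_mulC Rintegral_mulZl// (Rintegral_mulC h).
Qed.

Lemma Rintegral_sqrD f g : L2 f -> L2 g ->
  \int[mu]_(x in D) ((f x + g x) ^+ 2) =
  \int[mu]_(x in D) (f x ^+ 2) + 2 * \int[mu]_(x in D) (f x * g x)
  + \int[mu]_(x in D) (g x ^+ 2).
Proof.
move=> sf sg.
have E h : \int[mu]_(x in D) (h x ^+ 2) = \int[mu]_(x in D) (h x * h x).
  by apply: eq_Rintegral => x _; rewrite expr2.
rewrite !E Rintegral_mulDl//; last exact: sqintD.
rewrite !Rintegral_mulDr// (Rintegral_mulC g f); ring.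
Qed.

Lemma Rintegral_sqr_ge0 f : 0 <= \int[mu]_(x in D) (f x ^+ 2).
Proof. by apply: Rintegral_ge0 => x _; exact: sqr_ge0. Qed.

End inner_product.

(** * Brownian increments *)

Section brownian_increments.
Context {R : realType} {d : measure_display} {Omega : measurableType d}.
Variables (P : probability Omega R) (F : R -> set (set Omega)).
Hypothesis hF : filtration F.
Local Notation L2 := (square_integrable P setT).

Let P_fin : (P setT < +oo)%E.
Proof. by rewrite probability_setT ltry. Qed.

Lemma filtration_sigma t : 0 <= t -> sigma_algebra setT (F t).
Proof. by case: hF => h _ _; exact: h. Qed.

Lemma filtration_measurable t (X : Omega -> R) : 0 <= t ->
  wrt_measurable (F t) X -> measurable_fun setT X.
Proof. by case: hF => _ h _ t0; apply: wrt_measurable_fun; exact: h. Qed.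

Lemma filtration_le s t (X : Omega -> R) : 0 <= s -> s <= t ->
  wrt_measurable (F s) X -> wrt_measurable (F t) X.
Proof. by case: hF => _ _ h s0 st; apply: wrt_measurable_sub; exact: h. Qed.

Section one_motion.
Variable W : R -> Omega -> R.
Hypothesis hW : brownian_motion P F W.

Definition increment s t w := W t w - W s w.

Lemma increment_id s : increment s s = cst 0.
Proof. by apply/funext => w; rewrite /increment subrr. Qed.

Lemma increment_wrt s t : 0 <= s -> s <= t ->
  wrt_measurable (F t) (increment s t).
Proof.
case: hW => ad _ _ _ _ s0 st; have t0 := le_trans s0 st.
apply: (wrt_measurableB (filtration_sigma t0)); first exact: ad.
exact: (filtration_le s0 st (ad _ s0)).
Qed.

Lemma measurable_increment s t : 0 <= s -> 0 <= t ->
  measurable_fun setT (increment s t).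
Proof.
case: hW => ad _ _ _ _ s0 t0; apply: measurable_funB.
- exact: (filtration_measurable t0 (ad _ t0)).
- exact: (filtration_measurable s0 (ad _ s0)).
Qed.

Lemma ge0_integral_increment s t (f : R -> \bar R) : 0 <= s -> s < t ->
  measurable_fun setT f -> (forall x, 0 <= f x)%E ->
  (\int[P]_w f (increment s t w) =
   \int[normal_prob 0%R (Num.sqrt (t - s))]_x f x)%E.
Proof.
move=> s0 st mf f0; have t0 := le_trans s0 (ltW st).
have mI : measurable_fun setT (increment s t : Omega -> measurableTypeR R).
  exact: (measurable_increment s0 t0).
pose X' := @mfun_Sub _ _ _ (measurableTypeR R) _ (mem_set mI).
rewrite -[LHS](@ge0_integral_distribution _ _ _ _ _ P X' f)//.
apply: eq_measure_integral => A mA _.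
by case: hW => _ _ _ law _; exact: law.
Qed.

Lemma increment_sqnorm s t : 0 <= s -> s <= t ->
  (sqnorm P setT (increment s t) <= (t - s)%:E)%E.
Proof.
move=> s0; rewrite le_eqVlt => /predU1P[<-|st].
  rewrite increment_id subrr /sqnorm (eq_integral (fun=> 0%E)) ?integral0//.
  by move=> x _; rewrite /= expr0n.
rewrite /sqnorm (@ge0_integral_increment s t (fun x => (x ^+ 2)%:E))//.
- have h : 0 < Num.sqrt (t - s) by rewrite sqrtr_gt0 subr_gt0.
  have := normal_sqmoment_le h; rewrite sqr_sqrtr// subr_ge0; exact: ltW.
- by apply/measurable_EFinP; exact: measurable_funX.
- by move=> x; rewrite lee_fin sqr_ge0.
Qed.

Lemma increment_sqint s t : 0 <= s -> s <= t -> L2 (increment s t).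
Proof.
move=> s0 st; split; first exact: (measurable_increment s0 (le_trans s0 st)).
exact: le_lt_trans (increment_sqnorm s0 st) (ltry _).
Qed.

Lemma increment_mean0 s t : 0 <= s -> s <= t ->
  \int[P]_w increment s t w = 0.
Proof.
move=> s0; rewrite le_eqVlt => /predU1P[<-|st].
  by rewrite increment_id /Rintegral integral0.
have t0 := le_trans s0 (ltW st).
have h : 0 < Num.sqrt (t - s) by rewrite sqrtr_gt0 subr_gt0.
have i1 := sqint_integrable measurableT P_fin (increment_sqint s0 (ltW st)).
rewrite -(normal_mean0 h) /Rintegral; congr fine.
have mI : measurable_fun setT (increment s t : Omega -> measurableTypeR R).
  exact: (measurable_increment s0 t0).
pose X' := @mfun_Sub _ _ _ (measurableTypeR R) _ (mem_set mI).
rewrite -[LHS](@integral_distribution _ _ _ _ _ P X' (@EFin R))//.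
apply: eq_measure_integral => A mA _.
by case: hW => _ _ _ law _; exact: law.
Qed.

Lemma increment_independent s t X : 0 <= s -> s < t ->
  wrt_measurable (F s) X -> independent_rv P X (increment s t).
Proof.
move=> s0 st mX A B mA mB; case: hW => _ _ _ _ ind.
by rewrite [LHS]ind//; exact: mX.
Qed.

Lemma increment_orthogonal s t X : 0 <= s -> s <= t ->
  wrt_measurable (F s) X -> L2 X -> \int[P]_w (X w * increment s t w) = 0.
Proof.
move=> s0; rewrite le_eqVlt => /predU1P[<-|st] mX sX.
  rewrite increment_id; under eq_Rintegral do rewrite mulr0.
  by rewrite /Rintegral integral0.
rewrite Rintegral_independent.
- by rewrite increment_mean0 ?mulr0// ltW.
- exact: sqint_integrable.
- by apply: sqint_integrable => //; apply: increment_sqint => //; exact: ltW.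
- exact: increment_independent.
Qed.

Lemma sqnorm_mul_increment s t X : 0 <= s -> s <= t ->
  wrt_measurable (F s) X -> L2 X ->
  (sqnorm P setT (fun w => X w * increment s t w)%R <=
   (t - s)%:E * sqnorm P setT X)%E.
Proof.
move=> s0; rewrite le_eqVlt => /predU1P[<-|st] mX sX.
  rewrite increment_id subrr mul0e /sqnorm (eq_integral (fun=> 0%E)) ?integral0//.
  by move=> x _; rewrite /= mulr0 expr0n.
have m2 : measurable_fun setT (fun x : R => (x ^+ 2)%:E).
  by apply/measurable_EFinP; exact: measurable_funX.
rewrite /sqnorm; under eq_integral do rewrite exprMn EFinM.
have [mX' _] := sX.
rewrite (@ge0_integral_independent _ _ _ P X (increment s t)
  (fun x => (x ^+ 2)%:E) (fun x => (x ^+ 2)%:E))//.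
- rewrite muleC; apply: lee_wpmul2r; first exact: sqnorm_ge0.
  exact: increment_sqnorm (ltW st).
- exact: (measurable_increment s0 (le_trans s0 (ltW st))).
- exact: increment_independent.
- by move=> x; rewrite lee_fin sqr_ge0.
- by move=> x; rewrite lee_fin sqr_ge0.
Qed.

Lemma sqint_mul_increment s t X : 0 <= s -> s <= t ->
  wrt_measurable (F s) X -> L2 X -> L2 (fun w => X w * increment s t w).
Proof.
move=> s0 st mX sX; have [mX' fX] := sX; split.
  apply: measurable_funM => //.
  exact: (measurable_increment s0 (le_trans s0 st)).
apply: le_lt_trans (sqnorm_mul_increment s0 st mX sX) _.
by apply: lte_mul_pinfty => //; rewrite lee_fin subr_ge0.
Qed.

Lemma process_sigma_algebraP : sigma_algebra setT (process_sigma_algebra W).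
Proof. exact: smallest_sigma_algebra. Qed.

Lemma increment_process s t : 0 <= s -> 0 <= t ->
  wrt_measurable (process_sigma_algebra W) (increment s t).
Proof.
have mW r : 0 <= r -> wrt_measurable (process_sigma_algebra W) (W r).
  by move=> r0 B mB; apply: sub_sigma_algebra; exists r, B.
by move=> s0 t0; apply: (wrt_measurableB process_sigma_algebraP); exact: mW.
Qed.

End one_motion.
End brownian_increments.

Section independent_increments.
Context {R : realType} {d : measure_display} {Omega : measurableType d}.
Variables (P : probability Omega R) (F : R -> set (set Omega)).
Hypothesis hF : filtration F.
Local Notation L2 := (square_integrable P setT).
Variables W W' : R -> Omega -> R.
Hypotheses (hW : brownian_motion P F W) (hW' : brownian_motion P F W').
Hypothesis WW' : forall A B, process_sigma_algebra W A ->
  process_sigma_algebra W' B -> P (A `&` B) = (P A * P B)%E.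

Let P_fin : (P setT < +oo)%E.
Proof. by rewrite probability_setT ltry. Qed.

Lemma independent_of_processes X Y :
  wrt_measurable (process_sigma_algebra W) X ->
  wrt_measurable (process_sigma_algebra W') Y -> independent_rv P X Y.
Proof. by move=> mX mY A B mA mB; apply: WW'; [exact: mX|exact: mY]. Qed.

Lemma increment_mul_sqnorm s t : 0 <= s -> s <= t ->
  (sqnorm P setT (fun w => increment W s t w * increment W' s t w)%R <=
   ((t - s) ^+ 2)%:E)%E.
Proof.
move=> s0 st; have t0 := le_trans s0 st.
have m2 : measurable_fun setT (fun x : R => (x ^+ 2)%:E).
  by apply/measurable_EFinP; exact: measurable_funX.
rewrite /sqnorm; under eq_integral do rewrite exprMn EFinM.
rewrite (@ge0_integral_independent _ _ _ P _ _
  (fun x => (x ^+ 2)%:E) (fun x => (x ^+ 2)%:E))//.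
- rewrite expr2 EFinM; apply: lee_pmul; try exact: sqnorm_ge0.
  + exact: (increment_sqnorm hF hW s0 st).
  + exact: (increment_sqnorm hF hW' s0 st).
- exact: (measurable_increment hF hW s0 t0).
- exact: (measurable_increment hF hW' s0 t0).
- by apply: independent_of_processes; exact: increment_process.
- by move=> x; rewrite lee_fin sqr_ge0.
- by move=> x; rewrite lee_fin sqr_ge0.
Qed.

Lemma increment_mul_sqint s t : 0 <= s -> s <= t ->
  L2 (fun w => increment W s t w * increment W' s t w).
Proof.
move=> s0 st; have t0 := le_trans s0 st; split.
  apply: measurable_funM; first exact: (measurable_increment hF hW s0 t0).
  exact: (measurable_increment hF hW' s0 t0).
exact: le_lt_trans (increment_mul_sqnorm s0 st) (ltry _).
Qed.

(** The processes are independent as a whole, so the expectation factors into one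
    expectation for each motion, and that of [W] vanishes. *)
Lemma increment_mul_orthogonal s t s' t' :
  0 <= s -> s <= t -> t <= s' -> s' <= t' ->
  \int[P]_w ((increment W s t w * increment W' s t w) *
             (increment W s' t' w * increment W' s' t' w)) = 0.
Proof.
move=> s0 st ts' st'; have t0 := le_trans s0 st.
have s'0 := le_trans t0 ts'; have t'0 := le_trans s'0 st'.
have i1 := sqint_mul measurableT (increment_sqint hF hW s0 st)
  (increment_sqint hF hW s'0 st').
have i2 := sqint_mul measurableT (increment_sqint hF hW' s0 st)
  (increment_sqint hF hW' s'0 st').
transitivity (\int[P]_w ((increment W s t w * increment W s' t' w) *
             (increment W' s t w * increment W' s' t' w))).
  by apply: eq_Rintegral => w _; ring.
rewrite Rintegral_independent//.
- rewrite (increment_orthogonal hF hW s'0 st') ?mul0r//.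
  + exact: (filtration_le hF t0 ts' (increment_wrt hF hW s0 st)).
  + exact: (increment_sqint hF hW s0 st).
- apply: independent_of_processes.
  + apply: (wrt_measurableM (process_sigma_algebraP W));
    exact: increment_process.
  + apply: (wrt_measurableM (process_sigma_algebraP W'));
    exact: increment_process.
Qed.

Section partition.
Variables s h : R.
Hypotheses (s0 : 0 <= s) (h0 : 0 <= h).
Let p (n : nat) := s + n%:R * h.
Let bracket n w :=
  \sum_(i < n) increment W (p i) (p i.+1) w * increment W' (p i) (p i.+1) w.

Let p_ge0 n : 0 <= p n.
Proof. by rewrite addr_ge0// mulr_ge0. Qed.

Let p_le m n : (m <= n)%N -> p m <= p n.
Proof. by move=> mn; rewrite lerD2l ler_wpM2r// ler_nat. Qed.

Let pS n : p n.+1 - p n = h.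
Proof. by rewrite /p -natr1; ring. Qed.

Let bracketS n : bracket n.+1 = (fun w => bracket n w +
  increment W (p n) (p n.+1) w * increment W' (p n) (p n.+1) w).
Proof. by apply/funext => w; rewrite /bracket big_ord_recr. Qed.

Let bracket_sqint n : L2 (bracket n).
Proof.
by apply: sqint_sum => // i; apply: increment_mul_sqint => //; exact: p_le.
Qed.

Let bracket_orthogonal n m : (n <= m)%N ->
  \int[P]_w (bracket n w *
    (increment W (p m) (p m.+1) w * increment W' (p m) (p m.+1) w)) = 0.
Proof.
elim: n => [_|n ih nm].
  rewrite /Rintegral (eq_integral (fun=> 0%E)) ?integral0// => w _.
  by rewrite /bracket big_ord0 mul0r.
rewrite bracketS Rintegral_mulDl//.
- rewrite ih ?add0r; last exact: ltnW.
  by apply: increment_mul_orthogonal => //; exact: p_le.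
- by apply: increment_mul_sqint => //; exact: p_le.
- by apply: increment_mul_sqint => //; exact: p_le.
Qed.

Let bracket_sqnorm n : \int[P]_w (bracket n w ^+ 2) <= n%:R * h ^+ 2.
Proof.
elim: n => [|n ih].
  rewrite /Rintegral (eq_integral (fun=> 0%E)) ?integral0 ?mul0r// => w _.
  by rewrite /bracket big_ord0 expr0n.
have sI : L2 (fun w =>
    increment W (p n) (p n.+1) w * increment W' (p n) (p n.+1) w).
  by apply: increment_mul_sqint => //; exact: p_le.
rewrite bracketS Rintegral_sqrD// bracket_orthogonal// mulr0 addr0.
rewrite -natr1 mulrDl mul1r lerD// -lee_fin -sqnorm_fin//.
by rewrite -(pS n); apply: increment_mul_sqnorm => //; exact: p_le.
Qed.

Let bracket_integral n (xi : Omega -> R) : wrt_measurable (F s) xi ->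
  (exists C, forall w, `|xi w| <= C) ->
  \int[P]_w (xi w * (increment W s (p n) w * increment W' s (p n) w)) =
  \int[P]_w (xi w * bracket n w).
Proof.
move=> mxi [C xiC].
have mxi' := filtration_measurable hF s0 mxi.
have sxi : L2 xi by apply: (@sqint_bounded _ _ _ P setT _ _ xi C).
have p0 : p 0 = s by rewrite /p mul0r addr0.
have sp m : s <= p m by rewrite -p0; exact: p_le.
have ppS m : p m <= p m.+1 by exact: p_le.
elim: n => [|n ih].
  apply: eq_Rintegral => w _; rewrite p0 !increment_id /bracket big_ord0.
  by rewrite /= !mulr0.
set a := increment W s (p n); set b := increment W' s (p n).
set e := increment W (p n) (p n.+1); set e' := increment W' (p n) (p n.+1).
have sx V : brownian_motion P F V -> L2 (fun w => xi w * increment V s (p n) w).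
  by move=> hV; apply: (sqint_mul_increment hF hV).
have mx V : brownian_motion P F V ->
    wrt_measurable (F (p n)) (fun w => xi w * increment V s (p n) w).
  move=> hV; apply: (wrt_measurableM (filtration_sigma hF (p_ge0 n))).
    exact: (filtration_le hF s0 (sp n) mxi).
  exact: (increment_wrt hF hV s0 (sp n)).
have sI : L2 (fun w => a w * b w) by exact: increment_mul_sqint.
have sJ : L2 (fun w => e w * e' w) by exact: increment_mul_sqint.
have se : L2 e by exact: (increment_sqint hF hW).
have se' : L2 e' by exact: (increment_sqint hF hW').
have i1 := sqint_mul measurableT sxi sI.
have i2 := sqint_mul measurableT (sx _ hW) se'.
have i3 := sqint_mul measurableT (sx _ hW') se.
have i4 := sqint_mul measurableT sxi sJ.
(* the two mixed products are a past factor times a future increment *)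
transitivity (\int[P]_w ((xi w * (a w * b w) + xi w * (e w * e' w)) +
    ((xi w * a w) * e' w + (xi w * b w) * e w))).
  apply: eq_Rintegral => w _; rewrite /a /b /e /e' /increment; ring.
rewrite !RintegralD//; last 2 first.
- exact: (integrableD measurableT i1 i4).
- exact: (integrableD measurableT i2 i3).
rewrite (increment_orthogonal hF hW' (p_ge0 n) (ppS n) (mx _ hW) (sx _ hW)).
rewrite (increment_orthogonal hF hW (p_ge0 n) (ppS n) (mx _ hW') (sx _ hW')).
by rewrite ih bracketS Rintegral_mulDr// !addr0.
Qed.

Lemma increment_mul_small n (xi : Omega -> R) (eta : R) :
  wrt_measurable (F s) xi -> (exists C, forall w, `|xi w| <= C) -> 0 < eta ->
  `|\int[P]_w (xi w *
     (increment W s (s + n%:R * h) w * increment W' s (s + n%:R * h) w))| <=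
  eta * \int[P]_w (xi w ^+ 2) + eta^-1 * (n%:R * h ^+ 2).
Proof.
move=> mxi bxi e0; have [C xiC] := bxi.
have sxi : L2 xi.
  apply: (@sqint_bounded _ _ _ P setT _ _ xi C) => //.
  exact: (filtration_measurable hF s0 mxi).
rewrite bracket_integral//.
apply: le_trans (Rintegral_mul_young measurableT sxi (bracket_sqint n) e0) _.
by rewrite lerD2l ler_wpM2l// invr_ge0 ltW.
Qed.

End partition.

(** The joint law of the two motions given [F s] is unknown, so the orthogonality
    cannot be read off a product of expectations. The product of
    the increments is compared with their discrete covariation along a partition
    of [s, t] into n intervals: the difference is a sum of terms orthogonal to
    [xi], and by independence of the two processes the second moment of the
    discrete covariation is at most (t - s)^2 / n. *)
Lemma increment_cross_orthogonal s t (xi : Omega -> R) : 0 <= s -> s <= t ->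
  wrt_measurable (F s) xi -> (exists C, forall w, `|xi w| <= C) ->
  \int[P]_w (xi w * (increment W s t w * increment W' s t w)) = 0.
Proof.
move=> s0 st mxi bxi; apply/eqP; rewrite -normr_eq0 eq_le normr_ge0 andbT.
set I := \int[P]_w _; set A := \int[P]_w (xi w ^+ 2).
have A0 : 0 <= A by exact: Rintegral_sqr_ge0.
apply/ler_addgt0Pl => e e0; rewrite addr0.
(* eta A <= e / 2 by this choice; then n makes the other term at most e / 2 *)
pose eta := e / 2 / (A + 1).
have A1 : 0 < A + 1 by rewrite ltr_wpDl.
have eta0 : 0 < eta by rewrite !divr_gt0.
pose c := eta^-1 * (t - s) ^+ 2.
have c0 : 0 <= c by rewrite mulr_ge0 ?invr_ge0 ?sqr_ge0// ltW.
have [n hn] : exists n : nat, 2 * c / e < n.+1%:R.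
  exists (Num.trunc (2 * c / e)).
  by have /andP[] := trunc_itv (divr_ge0 (mulr_ge0 (ler0n R 2) c0) (ltW e0)).
have n0 : (n.+1%:R : R) != 0 by rewrite pnatr_eq0.
have h0 : 0 <= (t - s) / n.+1%:R by rewrite divr_ge0// subr_ge0.
have := @increment_mul_small s _ s0 h0 n.+1 xi eta mxi bxi eta0.
have -> : s + n.+1%:R * ((t - s) / n.+1%:R) = t by field.
move/le_trans; apply; rewrite -/A.
have -> : e = e / 2 + e / 2 by field.
apply: lerD.
  rewrite /eta mulrAC ler_pdivrMr// ler_pM2l ?divr_gt0//.
  by rewrite lerDl.
have -> : eta^-1 * (n.+1%:R * ((t - s) / n.+1%:R) ^+ 2) = c / n.+1%:R.
  by rewrite /c; field; rewrite nat1r n0 gt_eqF.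
rewrite ler_pdivrMr ?ltr0n//.
rewrite ltr_pdivrMr// in hn.
have := ltW hn; lra.
Qed.

End independent_increments.

(** * Algebra of simple processes *)

Section telescoping.
Context {R : realType}.
Implicit Types (f : R -> R) (g : seq R).

Lemma telescope_below f (z x : R) g (b : R) : path <=%R x g -> b \in x :: g ->
  \sum_(j < size g) (nth z (x :: g) j < b)%R%:R *
    (f (nth z (x :: g) j.+1) - f (nth z (x :: g) j)) = f b - f x.
Proof.
elim: g x => [x _|y g ih x /= /andP[xy yg]].
  by rewrite inE => /eqP->; rewrite big_ord0 subrr.
have xmin : all (>= x) (y :: g).
  by have := @order_path_min _ <=%R x (y :: g) le_trans; apply; rewrite /= xy.
have [->|bx] := eqVneq b x => [_|].
  rewrite subrr big1// => j _.
  suff -> : (nth z (x :: y :: g) j < x) = false by rewrite mul0r.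
  apply/negbTE; rewrite -leNgt; case: j => -[|j] //= jg.
  exact: (allP xmin _ (mem_nth z (ltnW jg : (j < size (y :: g))%N))).
rewrite inE (negbTE bx) /= => bg.
have xb : x < b.
  by rewrite lt_neqAle eq_sym bx; exact: (allP xmin _ bg).
by rewrite big_ord_recl /= xb mul1r (ih y)//; ring.
Qed.

(** A step between two points of a sorted grid is the sum of the steps of the
    grid between them: this is how a simple process is rewritten on a finer
    grid. *)
Lemma telescope_between f (z x : R) g (a b : R) : path <=%R x g ->
  a \in x :: g -> b \in x :: g -> a <= b ->
  \sum_(j < size g) (a <= nth z (x :: g) j < b)%R%:R *
    (f (nth z (x :: g) j.+1) - f (nth z (x :: g) j)) = f b - f a.
Proof.
move=> xg ag bg ab.
have -> : f b - f a = (f b - f x) - (f a - f x) by ring.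
rewrite -(telescope_below f z xg ag) -(telescope_below f z xg bg) -sumrB.
apply: eq_bigr => j _; rewrite -mulrBl; congr (_ * _).
set t := nth _ _ _; case: (leP a t) => [at'|ta] /=; first by rewrite subr0.
by rewrite (lt_le_trans ta ab) subrr.
Qed.

End telescoping.

Section simple_process_algebra.
Context {R : realType} {d : measure_display} {Omega : measurableType d}.
Variable F : R -> set (set Omega).
Hypothesis hF : filtration F.
Implicit Types S D : simple_process F.

(** Both the path of a simple process and its integral are sums of this shape,
    for f the step at t and for f the stopped Brownian path. *)
Definition simple_sum S (f : R -> R) (w : Omega) : R :=
  \sum_(i < sp_size S) sp_val S i w * (f (sp_time S i.+1) - f (sp_time S i)).

Lemma sp_time_le S i j : (i <= j)%N -> sp_time S i <= sp_time S j.
Proof.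
elim: j => [|j ih]; first by rewrite leqn0 => /eqP->.
rewrite leq_eqVlt => /predU1P[->//|]; rewrite ltnS => /ih h.
exact: le_trans h (sp_time_nondecreasing S j).
Qed.

Lemma sp_time_nneg S i : 0 <= sp_time S i.
Proof. exact: le_trans (sp_time_ge0 S) (sp_time_le S (leq0n i)). Qed.

Lemma sp_val_mfun S i : measurable_fun setT (sp_val S i).
Proof.
exact: (filtration_measurable hF (sp_time_nneg S i) (sp_val_measurable S i)).
Qed.

Lemma sp_integralE S (W : R -> Omega -> R) t w :
  sp_integral S W t w = simple_sum S (fun x => W (Num.min x t) w) w.
Proof. by []. Qed.

Lemma indic_ocE (a b t : R) : a <= b ->
  \1_(`]a, b]) t = (t <= b)%R%:R - (t <= a)%R%:R :> R.
Proof.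
move=> ab; rewrite indicE; have [ta|ta] := leP t a.
  rewrite (le_trans ta ab) subrr memNset//= in_itv/= => /andP[+ _].
  by rewrite ltNge ta.
rewrite subr0; have [tb|tb] := leP t b.
  by rewrite mem_set//= in_itv/= ta tb.
by rewrite memNset//= in_itv/= => /andP[_]; rewrite leNgt tb.
Qed.

Lemma sp_funE S t w : sp_fun S t w = simple_sum S (fun x => (t <= x)%R%:R) w.
Proof.
by apply: eq_bigr => i _; rewrite indic_ocE//; exact: sp_time_nondecreasing.
Qed.

Section refinement.
Variables (S : simple_process F) (x : R) (g : seq R).
Hypotheses (x0 : 0 <= x) (xg : path <=%R x g).
Hypothesis Sg : forall i, (i <= sp_size S)%N -> sp_time S i \in x :: g.

(* past the end of the grid its last point is repeated *)
Let time j := nth (last x g) (x :: g) j.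
Let val j w :=
  \sum_(i < sp_size S) sp_val S i w * (sp_time S i <= time j < sp_time S i.+1)%R%:R.

Let time_nondecreasing j : time j <= time j.+1.
Proof.
have [jg|gj] := ltnP j (size g).
  by have /pathP := xg; apply.
rewrite /time [X in _ <= X]nth_default//.
move: gj; rewrite leq_eqVlt => /predU1P[<-|gj].
  by rewrite -[X in nth _ _ X]/(size (x :: g)).-1 nth_last.
by rewrite nth_default.
Qed.

Let time_ge0 j : 0 <= time j.
Proof.
elim: j => [|j ih]; first exact: x0.
exact: le_trans ih (time_nondecreasing j).
Qed.

Let val_measurable j : wrt_measurable (F (time j)) (val j).
Proof.
apply: (wrt_measurable_sum (filtration_sigma hF (time_ge0 j))) => i.
case: (leP (sp_time S i) (time j)) => [h|h] /=; last first.
  by under eq_fun do rewrite mulr0;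
     exact: wrt_measurable_cst (filtration_sigma hF (time_ge0 j)) _.
apply: (wrt_measurableM (filtration_sigma hF (time_ge0 j))).
  exact: (filtration_le hF (sp_time_nneg S i) h (sp_val_measurable S i)).
exact: wrt_measurable_cst (filtration_sigma hF (time_ge0 j)) _.
Qed.

Let val_bounded : exists C : R, forall j w, `|val j w| <= C.
Proof.
have [C hC] := sp_val_bounded S; exists (\sum_(i < sp_size S) C) => j w.
apply: le_trans (ler_norm_sum _ _ _) _; apply: ler_sum => i _.
rewrite normrM; case: (_ <= _ < _)%R => /=; first by rewrite normr1 mulr1 hC.
by rewrite normr0 mulr0; exact: le_trans (normr_ge0 _) (hC i w).
Qed.

Definition sp_refine : simple_process F :=
  {| sp_size := size g; sp_time := time; sp_val := val;
     sp_time_ge0 := time_ge0 0%N; sp_time_nondecreasing := time_nondecreasing;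
     sp_val_measurable := val_measurable; sp_val_bounded := val_bounded |}.

Lemma simple_sum_refine f w : simple_sum sp_refine f w = simple_sum S f w.
Proof.
rewrite /simple_sum /= /val.
under eq_bigr do rewrite mulr_suml.
rewrite exchange_big /=; apply: eq_bigr => i _.
rewrite -(telescope_between f (last x g) xg (Sg (ltnW (ltn_ord i)))
  (Sg (ltn_ord i)) (sp_time_nondecreasing S i)) mulr_sumr.
by apply: eq_bigr => j _; rewrite mulrA.
Qed.

End refinement.

Definition same_grid S S' :=
  sp_size S = sp_size S' /\ forall i, sp_time S i = sp_time S' i.

Lemma common_grid S S' : exists D D', [/\ same_grid D D',
  forall f w, simple_sum D f w = simple_sum S f w &
  forall f w, simple_sum D' f w = simple_sum S' f w].
Proof.
pose times (T : simple_process F) := map (sp_time T) (iota 0 (sp_size T).+1).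
have times_mem T i : (i <= sp_size T)%N -> sp_time T i \in times T.
  by move=> iT; apply/map_f; rewrite mem_iota.
pose G := sort <=%R (times S ++ times S').
have sG : sorted <=%R G by apply: sort_sorted; exact: le_total.
have GS i : (i <= sp_size S)%N -> sp_time S i \in G.
  by move=> iS; rewrite mem_sort mem_cat times_mem.
have GS' i : (i <= sp_size S')%N -> sp_time S' i \in G.
  by move=> iS; rewrite mem_sort mem_cat times_mem// orbT.
have G0 r : r \in G -> 0 <= r.
  rewrite mem_sort mem_cat => /orP[] /mapP[i _ ->]; exact: sp_time_nneg.
case: G => [|x g] in sG GS GS' G0; first by have := GS 0%N (leq0n _).
have x0 : 0 <= x by apply: G0; rewrite mem_head.
exists (sp_refine S x0 sG), (sp_refine S' x0 sG); split => // f w;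
  exact: simple_sum_refine.
Qed.

(** Two simple processes can be combined step by step once they share their
    times. *)
Lemma sp_linear_combination (a b : R) S S' : exists D,
  (forall f w, simple_sum D f w = a * simple_sum S f w + b * simple_sum S' f w).
Proof.
have [E [E' [[sz tm] SE SE']]] := common_grid S S'.
pose val i w := a * sp_val E i w + b * sp_val E' i w.
have mval i : wrt_measurable (F (sp_time E i)) (val i).
  have sg := filtration_sigma hF (sp_time_nneg E i).
  apply: (wrt_measurableD sg); apply: (wrt_measurableM sg).
  - exact: wrt_measurable_cst.
  - exact: sp_val_measurable.
  - exact: wrt_measurable_cst.
  - by rewrite tm; exact: sp_val_measurable.
have bval : exists C, forall i w, `|val i w| <= C.
  have [C hC] := sp_val_bounded E; have [C' hC'] := sp_val_bounded E'.
  exists (`|a| * C + `|b| * C') => i w.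
  apply: le_trans (ler_normD _ _) _; rewrite !normrM.
  by apply: lerD; apply: ler_wpM2l.
exists {| sp_size := sp_size E; sp_time := sp_time E; sp_val := val;
  sp_time_ge0 := sp_time_ge0 E; sp_time_nondecreasing := sp_time_nondecreasing E;
  sp_val_measurable := mval; sp_val_bounded := bval |} => f w.
rewrite -SE -SE' /simple_sum /= -sz !mulr_sumr -big_split /=.
by apply: eq_bigr => i _; rewrite -!tm /val; ring.
Qed.

End simple_process_algebra.

(** * Energy of simple integrals *)

Section discrete_integral.
Context {R : realType} {d : measure_display} {Omega : measurableType d}.
Variables (P : probability Omega R) (F : R -> set (set Omega)).
Hypothesis hF : filtration F.
Local Notation L2 := (square_integrable P setT).
Implicit Types (S D : simple_process F) (V : R -> Omega -> R).

Let P_fin : (P setT < +oo)%E.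
Proof. by rewrite probability_setT ltry. Qed.

Lemma sp_val_sqint S i : L2 (sp_val S i).
Proof.
have [C hC] := sp_val_bounded S.
apply: (@sqint_bounded _ _ _ P setT _ _ _ C) => //.
exact: (sp_val_mfun hF).
Qed.

Definition sp_energy S w : R :=
  \sum_(i < sp_size S) sp_val S i w ^+ 2 * (sp_time S i.+1 - sp_time S i).

Lemma sp_energy_ge0 S w : 0 <= sp_energy S w.
Proof.
apply: sumr_ge0 => i _; rewrite mulr_ge0 ?sqr_ge0// subr_ge0.
exact: sp_time_nondecreasing.
Qed.

Lemma measurable_sp_energy S : measurable_fun setT (sp_energy S).
Proof.
apply: measurable_sum => i; apply: measurable_funM => //.
by apply: measurable_funX; exact: (sp_val_mfun hF).
Qed.

Lemma Rintegral_sp_energy S : \int[P]_w sp_energy S w =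
  \sum_(i < sp_size S)
    (sp_time S i.+1 - sp_time S i) * \int[P]_w (sp_val S i w ^+ 2).
Proof.
have h i : P.-integrable setT (fun w =>
    (sp_val S i w ^+ 2 * (sp_time S i.+1 - sp_time S i))%:E).
  by under eq_fun do rewrite EFinM; apply: integrableZr => //;
    exact: (sqint_sqr (sp_val_sqint S i)).
rewrite /Rintegral /sp_energy; under eq_integral do rewrite -sumEFin.
rewrite (integral_sum measurableT (fun i : 'I_(sp_size S) => h i)).
set r := RHS; suff -> : (\sum_(i < sp_size S) \int[P]_w
    (sp_val S i w ^+ 2 * (sp_time S i.+1 - sp_time S i))%:E = r%:E)%E by [].
rewrite -sumEFin; apply: eq_bigr => i _.
have -> : (\int[P]_w (sp_val S i w ^+ 2 * (sp_time S i.+1 - sp_time S i))%:E =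
    \int[P]_w ((sp_val S i w ^+ 2)%:E * (sp_time S i.+1 - sp_time S i)%:E))%E.
  by apply: eq_integral => w _; rewrite EFinM.
rewrite integralZr//; last exact: (sqint_sqr (sp_val_sqint S i)).
by rewrite muleC EFinM; congr (_ * _)%E; exact: (sqnorm_fin measurableT (sp_val_sqint S i)).
Qed.

Section isometry.
Variables W W' : R -> Omega -> R.
Hypotheses (hW : brownian_motion P F W) (hW' : brownian_motion P F W').
Hypothesis WW' : forall A B, process_sigma_algebra W A ->
  process_sigma_algebra W' B -> P (A `&` B) = (P A * P B)%E.
Variables (a b : R) (D D' : simple_process F).
Hypothesis DD' : same_grid D D'.

Let x i w := a * sp_val D i w.
Let y i w := b * sp_val D' i w.
Let t i := sp_time D i.
Let incr i w := x i w * increment W (t i) (t i.+1) w +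
  y i w * increment W' (t i) (t i.+1) w.
Let M n w := \sum_(i < n) incr i w.

Let t0 i : 0 <= t i. Proof. exact: sp_time_nneg. Qed.
Let tS i : t i <= t i.+1. Proof. exact: sp_time_nondecreasing. Qed.
Let sg i := filtration_sigma hF (t0 i).

Let mx i : wrt_measurable (F (t i)) (x i).
Proof.
apply: (wrt_measurableM (sg i)); first exact: wrt_measurable_cst.
exact: sp_val_measurable.
Qed.

Let my i : wrt_measurable (F (t i)) (y i).
Proof.
apply: (wrt_measurableM (sg i)); first exact: wrt_measurable_cst.
by case: DD' => _ tE; rewrite /t tE; exact: sp_val_measurable.
Qed.

Let sx i : L2 (x i). Proof. by apply: sqintZ => //; exact: sp_val_sqint. Qed.
Let sy i : L2 (y i). Proof. by apply: sqintZ => //; exact: sp_val_sqint. Qed.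

Let bxy i : exists C, forall w, `|x i w * y i w| <= C.
Proof.
have [C hC] := sp_val_bounded D; have [C' hC'] := sp_val_bounded D'.
exists ((`|a| * C) * (`|b| * C')) => w; rewrite !normrM.
by apply: ler_pM; rewrite ?mulr_ge0//; apply: ler_wpM2l.
Qed.

Let sxW i : L2 (fun w => x i w * increment W (t i) (t i.+1) w).
Proof. exact: (sqint_mul_increment hF hW). Qed.

Let syW i : L2 (fun w => y i w * increment W' (t i) (t i.+1) w).
Proof. exact: (sqint_mul_increment hF hW'). Qed.

Let sincr i : L2 (incr i). Proof. exact: sqintD. Qed.

Let sM n : L2 (M n). Proof. exact: sqint_sum. Qed.

Let mM n : wrt_measurable (F (t n)) (M n).
Proof.
elim: n => [|n ih].
  have -> : M 0 = cst 0 by apply/funext => w; rewrite /M big_ord0.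
  exact: (wrt_measurable_cst (sg 0)).
have -> : M n.+1 = (fun w => M n w + incr n w).
  by apply/funext => w; rewrite /M big_ord_recr.
apply: (wrt_measurableD (sg n.+1)).
  exact: (filtration_le hF (t0 n) (tS n) ih).
apply: (wrt_measurableD (sg n.+1)); apply: (wrt_measurableM (sg n.+1)).
- exact: (filtration_le hF (t0 n) (tS n) (mx n)).
- exact: (increment_wrt hF hW).
- exact: (filtration_le hF (t0 n) (tS n) (my n)).
- exact: (increment_wrt hF hW').
Qed.

Let orth (V : R -> Omega -> R) n (X Y : Omega -> R) :
  brownian_motion P F V -> wrt_measurable (F (t n)) X ->
  wrt_measurable (F (t n)) Y -> L2 X -> (exists C, forall w, `|Y w| <= C) ->
  \int[P]_w (X w * (Y w * increment V (t n) (t n.+1) w)) = 0.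
Proof.
move=> hV mX mY sX [C hC].
transitivity (\int[P]_w ((X w * Y w) * increment V (t n) (t n.+1) w)).
  by apply: eq_Rintegral => w _; rewrite mulrA.
apply: (increment_orthogonal hF hV (t0 n) (tS n)).
  exact: (wrt_measurableM (sg n)).
apply: (@sqint_le _ _ _ _ _ measurableT _ (fun w => C * X w)).
- apply: measurable_funM; first by case: sX.
  exact: (filtration_measurable hF (t0 n) mY).
- exact: sqintZ.
- move=> w _; rewrite !normrM mulrC; apply: ler_wpM2r => //.
  exact: le_trans (hC w) (ler_norm C).
Qed.

Let bx i : exists C, forall w, `|x i w| <= C.
Proof.
have [C hC] := sp_val_bounded D; exists (`|a| * C) => w.
by rewrite normrM ler_wpM2l.
Qed.

Let by_ i : exists C, forall w, `|y i w| <= C.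
Proof.
have [C hC] := sp_val_bounded D'; exists (`|b| * C) => w.
by rewrite normrM ler_wpM2l.
Qed.

Let incr_sqnorm i : \int[P]_w (incr i w ^+ 2) <=
  (t i.+1 - t i) * (\int[P]_w (x i w ^+ 2) + \int[P]_w (y i w ^+ 2)).
Proof.
rewrite Rintegral_sqrD//.
have -> : \int[P]_w (x i w * increment W (t i) (t i.+1) w *
    (y i w * increment W' (t i) (t i.+1) w)) = 0.
  rewrite -(increment_cross_orthogonal hF hW hW' WW' (t0 i) (tS i)
    (wrt_measurableM (sg i) (mx i) (my i)) (bxy i)).
  by apply: eq_Rintegral => w _; ring.
rewrite mulr0 addr0 mulrDr; apply: lerD; rewrite -lee_fin -sqnorm_fin//.
- rewrite EFinM -sqnorm_fin//.
  exact: (sqnorm_mul_increment hF hW (t0 i) (tS i) (mx i) (sx i)).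
- rewrite EFinM -sqnorm_fin//.
  exact: (sqnorm_mul_increment hF hW' (t0 i) (tS i) (my i) (sy i)).
Qed.

Let M_sqnorm n : \int[P]_w (M n w ^+ 2) <= \sum_(i < n)
  (t i.+1 - t i) * (\int[P]_w (x i w ^+ 2) + \int[P]_w (y i w ^+ 2)).
Proof.
elim: n => [|n ih].
  rewrite big_ord0 /Rintegral (eq_integral (fun=> 0%E)) ?integral0// => w _.
  by rewrite /M big_ord0 expr0n.
rewrite big_ord_recr /=.
have -> : M n.+1 = (fun w => M n w + incr n w).
  by apply/funext => w; rewrite /M big_ord_recr.
rewrite Rintegral_sqrD// Rintegral_mulDr//.
rewrite !orth// !addr0 mulr0 addr0.
exact: lerD.
Qed.

(** Orthogonality of martingale increments; for one motion it gives the bound by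
    the energy in the Ito isometry, and the cross terms of the two motions
    vanish although their joint law given the past is not known. *)
Lemma discrete_isometry :
  \int[P]_w ((a * simple_sum D (W^~ w) w + b * simple_sum D' (W'^~ w) w) ^+ 2)
  <= a ^+ 2 * \int[P]_w sp_energy D w + b ^+ 2 * \int[P]_w sp_energy D' w.
Proof.
case: DD' => sz tE.
have -> : \int[P]_w ((a * simple_sum D (W^~ w) w +
    b * simple_sum D' (W'^~ w) w) ^+ 2) =
    \int[P]_w (M (sp_size D) w ^+ 2).
  apply: eq_Rintegral => w _; congr (_ ^+ 2).
  rewrite /simple_sum -sz !mulr_sumr -big_split; apply: eq_bigr => i _ /=.
  by rewrite /incr /x /y /increment -!tE; ring.
apply: le_trans (M_sqnorm _) _.
rewrite !Rintegral_sp_energy -sz !mulr_sumr -big_split /=; apply: ler_sum => i _.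
rewrite le_eqVlt; apply/predU1P; left.
have E c X : L2 X -> \int[P]_w ((c * X w) ^+ 2) = c ^+ 2 * \int[P]_w (X w ^+ 2).
  move=> sX; rewrite -RintegralZl//; last exact: sqint_sqr.
  by apply: eq_Rintegral => w _; rewrite exprMn.
rewrite /x /y !E; try exact: sp_val_sqint.
by rewrite /t -!tE; ring.
Qed.

Lemma simple_sum_sqint : L2 (fun w => simple_sum D (W^~ w) w).
Proof.
apply: sqint_sum => // i; apply: (sqint_mul_increment hF hW) => //.
- exact: sp_val_measurable.
- exact: sp_val_sqint.
Qed.

End isometry.
End discrete_integral.

Section stopped_simple_process.
Context {R : realType} {d : measure_display} {Omega : measurableType d}.
Variable F : R -> set (set Omega).
Hypothesis hF : filtration F.
Local Notation mu := (@lebesgue_measure R).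
Implicit Types S D : simple_process F.

Section stop.
Variables (S : simple_process F) (t : R).
Hypothesis t0 : 0 <= t.

Let time i := Num.min (sp_time S i) t.
(* A step that starts after t is moved back to t, where its value need not be
   measurable; such a step has length 0 and is given the value 0. *)
Let val i w := sp_val S i w * (sp_time S i <= t)%R%:R.

Let time_ge0 i : 0 <= time i.
Proof. by rewrite le_min sp_time_nneg. Qed.

Let time_nondecreasing i : time i <= time i.+1.
Proof.
rewrite le_min !ge_min lexx orbT andbT.
by rewrite sp_time_nondecreasing.
Qed.

Let val_measurable i : wrt_measurable (F (time i)) (val i).
Proof.
have sg := filtration_sigma hF (time_ge0 i).
rewrite /val; have [h|h] := leP (sp_time S i) t.
  apply: (wrt_measurableM sg); last exact: (wrt_measurable_cst sg).
  by rewrite /time (min_l h); exact: sp_val_measurable.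
by under eq_fun do rewrite mulr0; exact: (wrt_measurable_cst sg 0).
Qed.

Let val_bounded : exists C : R, forall i w, `|val i w| <= C.
Proof.
have [C hC] := sp_val_bounded S; exists C => i w.
rewrite normrM; apply: le_trans (hC i w); rewrite ler_piMr//.
by rewrite normr_nat lern1 leq_b1.
Qed.

Definition sp_stop : simple_process F :=
  {| sp_size := sp_size S; sp_time := time; sp_val := val;
     sp_time_ge0 := time_ge0 0%N; sp_time_nondecreasing := time_nondecreasing;
     sp_val_measurable := val_measurable; sp_val_bounded := val_bounded |}.

Lemma simple_sum_stop f w :
  simple_sum sp_stop f w = simple_sum S (fun x => f (Num.min x t)) w.
Proof.
apply: eq_bigr => i _ /=; rewrite /val /time.
case: (boolP (sp_time S i <= t)) => [h|]; first by rewrite mulr1.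
rewrite -ltNge => h.
have h' := le_trans (ltW h) (sp_time_nondecreasing S i).
by rewrite (min_r (ltW h)) (min_r h') subrr !mulr0.
Qed.

End stop.

Lemma lebesgue_measure_oc_cc (a b t : R) : 0 <= a -> a <= b ->
  mu (`]a, b] `&` `[0, t]) = (Num.min b t - Num.min a t)%:E.
Proof.
move=> a0 ab.
have -> : `]a, b] `&` `[0, t] = `]a, (Num.min b t)]%classic.
  apply/seteqP; split => x /=; rewrite !in_itv/= le_min.
    by move=> [/andP[-> ->] /andP[_ ->]].
  move=> /andP[ax /andP[xb xt]]; rewrite ax xb xt.
  by rewrite (le_trans a0 (ltW ax)).
rewrite lebesgue_measure_itv /= lte_fin lt_min.
have [ta|at_] := leP t a.
  by rewrite andbF (min_r (le_trans ta ab)) subrr.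
rewrite andbT; have [aeb|ab'] := ltP a b; first by rewrite EFinB.
have ba : b = a by apply/eqP; rewrite eq_le ab ab'.
by rewrite ba (min_l (ltW at_)) subrr.
Qed.

Lemma sp_fun_sqr S s w : sp_fun S s w ^+ 2 =
  \sum_(i < sp_size S) sp_val S i w ^+ 2 *
    \1_(`]sp_time S i, sp_time S i.+1]) s.
Proof.
rewrite /sp_fun.
pose I i : set R := `]sp_time S i, sp_time S i.+1]%classic.
have disj i j : I i s -> I j s -> i = j.
  rewrite /I /= !in_itv /= => /andP[i1 i2] /andP[j1 j2].
  apply/eqP; rewrite eqn_leq; apply/andP; split; rewrite leqNgt; apply/negP => h.
    by have := lt_le_trans i1 (le_trans j2 (sp_time_le S h)); rewrite ltxx.
  by have := lt_le_trans j1 (le_trans i2 (sp_time_le S h)); rewrite ltxx.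
have [[i Ii]|noI] := pselect (exists i : 'I_(sp_size S), I i s).
  have out (j : 'I_(sp_size S)) : j != i -> \1_(I j) s = 0 :> R.
    move=> ji; rewrite indicE memNset// => Ij.
    by move/eqP: ji; apply; apply: val_inj; exact: disj Ij Ii.
  rewrite (bigD1 i)//= big1 ?addr0; last by move=> j /out ->; rewrite mulr0.
  rewrite [RHS](bigD1 i)//= big1 ?addr0; last by move=> j /out ->; rewrite mulr0.
  by rewrite -/(I i) indicE mem_set// !mulr1.
have out (j : 'I_(sp_size S)) : \1_(I j) s = 0 :> R.
  by rewrite indicE memNset// => Ij; apply: noI; exists j.
by rewrite !big1 ?expr0n// => j _; rewrite -/(I j) out mulr0.
Qed.

Lemma integral_sp_fun_sqr S (t : R) (t0 : 0 <= t) w :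
  (\int[mu]_(s in `[0%R, t]) (sp_fun S s w ^+ 2)%:E =
   (sp_energy (sp_stop S t0) w)%:E)%E.
Proof.
under eq_integral do rewrite sp_fun_sqr -sumEFin.
rewrite ge0_integral_sum//; last 2 first.
- move=> i; apply/measurable_EFinP; apply: measurable_funM => //.
- move=> i x _; rewrite lee_fin mulr_ge0 ?sqr_ge0//.
rewrite /sp_energy -sumEFin; apply: eq_bigr => i _ /=.
under eq_integral do rewrite EFinM.
rewrite ge0_integralZl_EFin ?sqr_ge0//; last exact/measurable_EFinP.
rewrite integral_indic//.
have a0 := sp_time_nneg S i; have ab := sp_time_nondecreasing S i.
rewrite [X in (_ * X)%E](lebesgue_measure_oc_cc t a0 ab) -EFinM; congr (_%:E).
case: (boolP (sp_time S i <= t)) => [h|]; first by rewrite mulr1.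
rewrite -ltNge => h.
by rewrite (min_r (ltW h)) (min_r (le_trans (ltW h) ab)) subrr !mulr0.
Qed.

End stopped_simple_process.

(** * Second moments and convergence in probability *)

Section second_moment_in_probability.
Local Open Scope ereal_scope.
Context {d : measure_display} {T : measurableType d} {R : realType}.

Lemma chebyshev_sqnorm (mu : {measure set T -> \bar R}) (f : T -> R) (e : R) :
  measurable_fun setT f -> (0 < e)%R ->
  (e ^+ 2)%:E * mu [set x | (e <= `|f x|)%R] <= sqnorm mu setT f.
Proof.
move=> mf e0; set A := [set x | _].
have mA : measurable A.
  rewrite -[A]setTI; apply: (measurable_fun_le (f := cst e)) => //.
  exact: measurableT_comp.
rewrite -(setIT A) -integral_indic// -ge0_integralZl_EFin ?sqr_ge0//; last exact/measurable_EFinP.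
apply: ge0_le_integral => //.
- by move=> x _; rewrite -EFinM lee_fin mulr_ge0 ?sqr_ge0.
- by apply: measurable_funeM; exact/measurable_EFinP.
- exact: measurable_sqr.
- move=> x _; rewrite -EFinM lee_fin indicE.
  have [/set_mem xA|_] := boolP (x \in A); last by rewrite mulr0 sqr_ge0.
  rewrite mulr1 -(real_normK (num_real (f x))).
  by apply: lerXn2r; rewrite ?nnegrE ?(ltW e0).
Qed.

Variable P : probability T R.

(** Where [Y] and [Z] are [e]-close the second moment of [Z] is controlled by that
    of [Y]; on the remaining event, of small probability, by the truncation. *)
Let truncated_sqnorm_le (Y Z : T -> R) (C K e : R) :
  measurable_fun setT Y -> measurable_fun setT Z -> (0 < e)%R -> (0 <= K)%R ->
  sqnorm P setT Y <= C%:E ->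
  P [set w | (e <= `|Y w - Z w|)%R] <= e%:E ->
  sqnorm P setT (fun w => Num.min `|Z w| K)%R <=
    ((1 + e) * C + (e ^+ 2 + e) + K ^+ 2 * e)%:E.
Proof.
move=> mY mZ e0 K0 YC PA; set A := [set w | _] in PA.
have mA : measurable A.
  rewrite -[A]setTI; apply: (measurable_fun_le (f := cst e)) => //.
  by apply: measurableT_comp => //; exact: measurable_funB.
have e1 : (0 <= 1 + e)%R by rewrite addr_ge0// ltW.
have e2 : (0 <= e ^+ 2 + e)%R by rewrite addr_ge0 ?sqr_ge0// ltW.
have mYe : measurable_fun setT (fun w => (1 + e)%:E * (Y w ^+ 2)%:E).
  by apply: measurable_funeM; exact: measurable_sqr.
have mAe : measurable_fun setT (fun w => (K ^+ 2)%:E * (\1_A w)%:E).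
  by apply: measurable_funeM; exact/measurable_EFinP.
apply: (@le_trans _ _ (\int[P]_w ((1 + e)%:E * (Y w ^+ 2)%:E
    + (e ^+ 2 + e)%:E + (K ^+ 2)%:E * (\1_A w)%:E))).
  apply: ge0_le_integral => //.
  - by move=> w _; rewrite lee_fin sqr_ge0.
  - apply: measurable_sqr; apply: measurable_minr => //.
    exact: measurableT_comp.
  - by apply: emeasurable_funD => //; apply: emeasurable_funD.
  move=> w _; rewrite -!EFinM -!EFinD lee_fin indicE.
  have zK : (0 <= Num.min `|Z w| K)%R by rewrite le_min normr_ge0.
  have [wA|/negP wA] := boolP (w \in A).
    rewrite mulr1; apply: (@le_trans _ _ (K ^+ 2)%R).
      by rewrite lerXn2r// ge_min lexx orbT.
    by rewrite lerDr addr_ge0// mulr_ge0// sqr_ge0.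
  rewrite mulr0 addr0.
  have YZ : (`|Z w| <= `|Y w| + e)%R.
    have : (`|Y w - Z w| < e)%R.
      by rewrite ltNge; apply/negP => h; apply: wA; rewrite inE.
    move=> /ltW h; apply: le_trans (lerD (lexx _) h).
    by rewrite -[X in (`|X| <= _)%R](subrK (Y w)) addrC distrC; exact: ler_normD.
  apply: (@le_trans _ _ ((`|Y w| + e) ^+ 2)%R).
    apply: lerXn2r; rewrite ?nnegrE ?addr_ge0 ?(ltW e0)//.
    by rewrite ge_min YZ.
  rewrite -(real_normK (num_real (Y w))) -subr_ge0.
  have -> : ((1 + e) * `|Y w| ^+ 2 + (e ^+ 2 + e) - (`|Y w| + e) ^+ 2 =
    e * (`|Y w| - 1) ^+ 2)%R by ring.
  by rewrite mulr_ge0 ?sqr_ge0// ltW.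
have n1 w : setT w -> 0 <= (1 + e)%:E * (Y w ^+ 2)%:E.
  by move=> _; rewrite -EFinM lee_fin mulr_ge0 ?sqr_ge0.
have n2 (w : T) : setT w -> 0 <= (e ^+ 2 + e)%:E by rewrite lee_fin.
have n3 w : setT w -> 0 <= (K ^+ 2)%:E * (\1_A w)%:E.
  by move=> _; rewrite -EFinM lee_fin mulr_ge0 ?sqr_ge0.
have n12 w : setT w -> 0 <= (1 + e)%:E * (Y w ^+ 2)%:E + (e ^+ 2 + e)%:E.
  by move=> Tw; rewrite adde_ge0 ?n1 ?n2.
have m12 : measurable_fun setT
    (fun w => (1 + e)%:E * (Y w ^+ 2)%:E + (e ^+ 2 + e)%:E).
  exact: emeasurable_funD.
rewrite (ge0_integralD _ measurableT n12 m12 n3 mAe).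
rewrite (ge0_integralD _ measurableT n1 mYe n2 (measurable_cst _)).
have -> : \int[P]_w ((1 + e)%:E * (Y w ^+ 2)%:E) = (1 + e)%:E * sqnorm P setT Y.
  rewrite ge0_integralZl_EFin//; last exact: measurable_sqr.
  by move=> w _; rewrite lee_fin sqr_ge0.
have -> : \int[P]_w ((K ^+ 2)%:E * (\1_A w)%:E) = (K ^+ 2)%:E * P A.
  rewrite ge0_integralZl_EFin ?sqr_ge0//; last exact/measurable_EFinP.
  by rewrite integral_indic// setIT.
rewrite integral_cst// [X in _ + _ * X + _](@probability_setT _ _ _ P) mule1.
by rewrite !EFinD !EFinM; apply: leeD; [apply: leeD => //|];
  apply: lee_wpmul2l => //; rewrite lee_fin ?sqr_ge0.
Qed.

(** Fatou's lemma for second moments under convergence in probability: the bound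
    holds for the truncations of [Z], then for [Z] by monotone convergence. *)
Lemma sqnorm_le_of_cvg_probability (Y : nat -> T -> R) (Z : T -> R) (C : R) :
  (forall l, measurable_fun setT (Y l)) -> measurable_fun setT Z ->
  (forall l, sqnorm P setT (Y l) <= C%:E) ->
  (forall e : R, (0 < e)%R ->
     exists l, P [set w | (e <= `|Y l w - Z w|)%R] <= e%:E) ->
  sqnorm P setT Z <= C%:E.
Proof.
move=> mY mZ YC YZ.
have C0 : (0 <= C)%R.
  by rewrite -lee_fin; apply: le_trans (YC 0%N); exact: sqnorm_ge0.
have K_le (K : nat) : sqnorm P setT (fun w => Num.min `|Z w| K%:R)%R <= C%:E.
  apply/lee_addgt0Pr => e e0.
  pose c : R := (C + 2 + K%:R ^+ 2)%R.
  have c0 : (0 < c)%R by rewrite ltr_pwDl ?sqr_ge0// ltr_wpDl.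
  pose h : R := Num.min 1%R (e / c)%R.
  have h0 : (0 < h)%R by rewrite lt_min ltr01 divr_gt0.
  have h1 : (h <= 1)%R by rewrite ge_min lexx.
  have hc : (c * h <= e)%R.
    by rewrite mulrC -ler_pdivlMr// ge_min lexx orbT.
  have [l hl] := YZ h h0.
  apply: le_trans (truncated_sqnorm_le (mY l) mZ h0 (ler0n _ K) (YC l) hl) _.
  rewrite -EFinD lee_fin.
  have h2 : (h ^+ 2 <= h)%R by rewrite expr2 ler_piMr// ltW.
  apply: (@le_trans _ _ (C + c * h)%R); last by rewrite lerD2l.
  rewrite /c; nra.
pose g (n : nat) w : \bar R := ((Num.min `|Z w| n%:R) ^+ 2)%R%:E.
have mg n : measurable_fun setT (g n).
  apply: measurable_sqr; apply: measurable_minr => //.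
  exact: measurableT_comp.
have nd w : setT w -> {homo g^~ w : n m / (n <= m)%N >-> n <= m}.
  move=> _ n m nm; rewrite lee_fin lerXn2r ?nnegrE ?le_min ?normr_ge0 ?ler0n//.
  by rewrite ge_min lexx /= ge_min ler_nat nm orbT.
have lim_g w : limn (g^~ w) = (Z w ^+ 2)%:E.
  apply: lim_near_cst => //; near=> n.
  rewrite /g min_l ?real_normK ?num_real//.
  near: n; exists (Num.trunc `|Z w|).+1 => // n /= nZ.
  have /andP[_ /ltW h] := trunc_itv (normr_ge0 (Z w)).
  by apply: le_trans h _; rewrite ler_nat.
have := @cvg_monotone_convergence _ _ _ P setT measurableT g mg.
move=> /(_ _ nd)/cvg_lim h.
rewrite /sqnorm; under eq_integral do rewrite -lim_g.
rewrite -h//; last by move=> n x _; rewrite lee_fin sqr_ge0.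
apply: lime_le; last by apply: nearW => n; exact: K_le.
apply/cvg_ex; eexists; apply: cvg_monotone_convergence => //.
by move=> n x _; rewrite lee_fin sqr_ge0.
Unshelve. all: by end_near.
Qed.

End second_moment_in_probability.

(** * Isometry and tail bound for simple integrals *)

Section truncated_simple_process.
Context {R : realType} {d : measure_display} {Omega : measurableType d}.
Variable F : R -> set (set Omega).
Hypothesis hF : filtration F.

Lemma sum_truncated_le (x : nat -> R) (delta : R) n : (forall i, 0 <= x i) ->
  0 <= delta ->
  \sum_(i < n) x i * (\sum_(j < i.+1) x j <= delta)%R%:R <= delta.
Proof.
move=> x0 d0; elim: n => [|n ih]; first by rewrite big_ord0.
have [h|h] := boolP (\sum_(j < n.+1) x j <= delta).
  apply: le_trans h; apply: ler_sum => i _.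
  by rewrite ler_piMr// lern1 leq_b1.
by rewrite big_ord_recr /= (negbTE h) mulr0 addr0.
Qed.

Variables (S : simple_process F) (delta : R).

Let x i w := sp_val S i w ^+ 2 * (sp_time S i.+1 - sp_time S i).
Let A i w := \sum_(j < i.+1) x j w.
Let val i w := sp_val S i w * (A i w <= delta)%R%:R.

Let x_ge0 i w : 0 <= x i w.
Proof.
by rewrite mulr_ge0 ?sqr_ge0// subr_ge0 sp_time_nondecreasing.
Qed.

Let val_measurable i : wrt_measurable (F (sp_time S i)) (val i).
Proof.
have sg := filtration_sigma hF (sp_time_nneg S i).
have mA : wrt_measurable (F (sp_time S i)) (A i).
  apply: (wrt_measurable_sum sg) => j.
  apply: (wrt_measurableM sg); last exact: (wrt_measurable_cst sg).
  apply: (@wrt_measurable_comp _ _ _ _ (fun r => r ^+ 2)).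
    exact: measurable_funX.
  apply: (filtration_le hF (sp_time_nneg S j) _ (sp_val_measurable S j)).
  exact: (sp_time_le S (ltn_ord j : (j <= i)%N)).
apply: (wrt_measurableM sg); first exact: sp_val_measurable.
apply: (@wrt_measurable_comp _ _ _ _ (fun r => (r <= delta)%R%:R)) => //.
have -> : (fun r : R => (r <= delta)%R%:R) = \1_(`]-oo, delta]) :> (R -> R).
  by apply/funext => r; rewrite indicE mem_setE in_itv.
exact: measurable_indic.
Qed.

Let val_bounded : exists C : R, forall i w, `|val i w| <= C.
Proof.
have [C hC] := sp_val_bounded S; exists C => i w.
rewrite normrM; apply: le_trans (hC i w); rewrite ler_piMr//.
by rewrite normr_nat lern1 leq_b1.
Qed.

(** The process is switched off as soon as its accumulated energy, including
    the step about to be taken, exceeds [delta]. The decision is known at the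
    beginning of the step. *)
Definition sp_truncate : simple_process F :=
  {| sp_size := sp_size S; sp_time := sp_time S; sp_val := val;
     sp_time_ge0 := sp_time_ge0 S;
     sp_time_nondecreasing := sp_time_nondecreasing S;
     sp_val_measurable := val_measurable; sp_val_bounded := val_bounded |}.

Lemma sp_energy_truncate w : 0 <= delta -> sp_energy sp_truncate w <= delta.
Proof.
move=> d0; apply: le_trans (sum_truncated_le (sp_size S) (x_ge0 ^~ w) d0).
rewrite le_eqVlt; apply/predU1P; left; apply: eq_bigr => i _ /=.
rewrite /val /x /A exprMn; case: (_ <= delta)%R => /=.
  by rewrite expr1n !mulr1.
by rewrite expr0n !mulr0 mul0r.
Qed.

Lemma simple_sum_truncate f w : sp_energy S w <= delta ->
  simple_sum sp_truncate f w = simple_sum S f w.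
Proof.
move=> h; apply: eq_bigr => i _ /=; rewrite /val.
suff -> : A i w <= delta by rewrite mulr1.
apply: le_trans h; rewrite /A /sp_energy -[in X in _ <= X](subnKC (ltn_ord i)).
rewrite big_split_ord /= lerDl; apply: sumr_ge0 => j _; exact: x_ge0.
Qed.

End truncated_simple_process.

Section ito_isometry.
Context {R : realType} {d : measure_display} {Omega : measurableType d}.
Variables (P : probability Omega R) (F : R -> set (set Omega)).
Hypothesis hF : filtration F.
Variable W : nat -> R -> Omega -> R.
Hypothesis hW : forall n, brownian_motion P F (W n).
Hypothesis hWind : independent_processes P W.
Local Notation L2 := (square_integrable P setT).
Local Notation mu := (@lebesgue_measure R).
Implicit Types S : simple_process F.

(** The other processes contribute the sure event. *)
Lemma independent_pair n m A B : n != m -> process_sigma_algebra (W n) A ->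
  process_sigma_algebra (W m) B -> P (A `&` B) = (P A * P B)%E.
Proof.
move=> nm hA hB.
have psT k : process_sigma_algebra (W k) setT.
  have [h0 hC _] := process_sigma_algebraP (W k).
  by rewrite -(setD0 setT); exact: hC.
pose N := (maxn n m).+1.
pose E k := if k == n then A else if k == m then B else setT.
have nN : (n < N)%N by rewrite ltnS leq_maxl.
have mN : (m < N)%N by rewrite ltnS leq_maxr.
have hE k : (k < N)%N -> process_sigma_algebra (W k) (E k).
  by rewrite /E; have [->//|kn] := eqVneq k n; have [->//|km] := eqVneq k m.
have := hWind hE.
have -> : \bigcap_(k in [set k | (k < N)%N]) E k = A `&` B.
  apply/seteqP; split => w /= h.
    have := h n nN; have := h m mN; rewrite /E eqxx eq_sym (negbTE nm) eqxx.
    by move=> ? ?.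
  move=> k _; rewrite /E; case: eqP => _; first by case: h.
  by case: eqP => _ //; case: h.
move=> ->; rewrite (bigD1 (Ordinal nN))//= (bigD1 (Ordinal mN))/=; last first.
  by rewrite -val_eqE /= eq_sym.
rewrite big1 ?mule1; last first.
  move=> k /andP[kn km]; rewrite /E.
  by rewrite -!val_eqE /= in kn km; rewrite (negbTE kn) (negbTE km) probability_setT.
by rewrite /E !eqxx eq_sym (negbTE nm).
Qed.

Definition path_energy S (t : R) (w : Omega) : \bar R :=
  (\int[mu]_(s in `[0%R, t]) (sp_fun S s w ^+ 2)%:E)%E.

Lemma path_energyE S t (t0 : 0 <= t) w :
  path_energy S t w = (sp_energy (sp_stop hF S t0) w)%:E.
Proof. exact: integral_sp_fun_sqr. Qed.

Lemma integral_path_energy S t (t0 : 0 <= t) :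
  (\int[P]_w path_energy S t w)%E =
  (\int[P]_w sp_energy (sp_stop hF S t0) w)%:E.
Proof.
under eq_integral do rewrite path_energyE.
rewrite fineK// ge0_fin_numE; last first.
  by apply: integral_ge0 => w _; rewrite lee_fin sp_energy_ge0.
set D := sp_stop _ _ _.
have [C hC] := sp_val_bounded D.
apply: (@le_lt_trans _ _ (\int[P]_w
  (\sum_(i < sp_size D) C ^+ 2 * (sp_time D i.+1 - sp_time D i))%:E)%E).
  apply: ge0_le_integral => //.
  - by move=> w _; rewrite lee_fin sp_energy_ge0.
  - by apply/measurable_EFinP; exact: (measurable_sp_energy hF).
  - move=> w _; rewrite lee_fin; apply: ler_sum => i _.
    apply: ler_wpM2r; first by rewrite subr_ge0 sp_time_nondecreasing.
    rewrite -(real_normK (num_real (sp_val D i w))).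
    have hi := hC i w.
    by apply: lerXn2r; rewrite ?nnegrE// (le_trans _ hi).
by rewrite integral_cst// [X in (_ * X)%E](@probability_setT _ _ _ P) mule1 ltry.
Qed.

(** After a passage to a common grid and a stop at [t], both integrals are simple
    sums to which the discrete bound applies. *)
Lemma ito_isometry n m (a b : R) S S' (t : R) : n != m -> 0 <= t ->
  (sqnorm P setT (fun w => a * sp_integral S (W n) t w +
                           b * sp_integral S' (W m) t w)%R
   <= (a ^+ 2)%:E * \int[P]_w path_energy S t w +
      (b ^+ 2)%:E * \int[P]_w path_energy S' t w)%E.
Proof.
move=> nm t0.
have [D [D' [[sz tE] SD SD']]] := common_grid hF S S'.
have funE C C' : (forall f w, simple_sum C f w = simple_sum C' f w) ->
    (\int[P]_w path_energy C' t w = \int[P]_w path_energy C t w)%E.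
  move=> CC'; apply: eq_integral => w _; apply: eq_integral => s _.
  by rewrite !sp_funE CC'.
rewrite (funE _ _ SD) (funE _ _ SD') !(integral_path_energy _ t0).
have intE (C C' : simple_process F) V : (forall f w, simple_sum C f w = simple_sum C' f w) ->
    forall w, sp_integral C' V t w = simple_sum (sp_stop hF C t0) (V^~ w) w.
  by move=> CC' w; rewrite sp_integralE -CC' simple_sum_stop.
have stopDD' : same_grid (sp_stop hF D t0) (sp_stop hF D' t0).
  by split => //= i; rewrite tE.
have sI C k : L2 (fun w => simple_sum (sp_stop hF C t0) ((W k)^~ w) w).
  exact: (simple_sum_sqint hF (hW k)).
rewrite (@eq_sqnorm _ _ _ _ _ _ (fun w =>
    a * simple_sum (sp_stop hF D t0) ((W n)^~ w) w +
    b * simple_sum (sp_stop hF D' t0) ((W m)^~ w) w)); last first.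
  by move=> w _; rewrite (intE D S _ SD) (intE D' S' _ SD').
rewrite sqnorm_fin//; last by apply: sqintD => //; apply: sqintZ.
rewrite -!EFinM -EFinD lee_fin.
apply: (discrete_isometry hF (hW n) (hW m)) => //.
by move=> A B; exact: independent_pair.
Qed.

Lemma sp_integral_sqint n S t : 0 <= t -> L2 (sp_integral S (W n) t).
Proof.
move=> t0; have := simple_sum_sqint hF (hW n) (sp_stop hF S t0).
by congr (square_integrable _ _ _); apply/funext => w; rewrite simple_sum_stop.
Qed.

Lemma ito_isometry1 n S (t : R) : 0 <= t ->
  (sqnorm P setT (sp_integral S (W n) t) <= \int[P]_w path_energy S t w)%E.
Proof.
move=> t0; have nn : n != n.+1 by rewrite neq_ltn ltnSn.
have := ito_isometry 1 0 S S nn t0.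
rewrite expr1n expr0n mul1e mul0e adde0; congr (_ <= _)%E.
by apply: eq_sqnorm => w _; rewrite mul1r mul0r addr0.
Qed.

Lemma measurable_path_energy S t : 0 <= t -> measurable_fun setT (path_energy S t).
Proof.
move=> t0; rewrite (_ : path_energy S t = EFin \o sp_energy (sp_stop hF S t0)).
  by apply/measurable_EFinP; exact: measurable_sp_energy.
by apply/funext => w; rewrite (path_energyE _ t0).
Qed.

(** Lenglart's inequality: the integral coincides with that of the truncated
    process where the energy is at most [delta], and the second moment of the
    latter is at most [delta]. *)
Lemma sp_integral_tail n S (t e delta : R) : 0 <= t -> 0 < e -> 0 <= delta ->
  (P [set w | (e <= `|sp_integral S (W n) t w|)%R] <=
   P [set w | delta%:E < path_energy S t w] + (delta / e ^+ 2)%:E)%E.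
Proof.
move=> t0 e0 d0; set D := sp_stop hF S t0; set D' := sp_truncate hF D delta.
have sI (C : simple_process F) : L2 (fun w => simple_sum C ((W n)^~ w) w).
  exact: (simple_sum_sqint hF (hW n)).
have mA (C : simple_process F) : measurable [set w | e <= `|simple_sum C ((W n)^~ w) w|].
  rewrite -[X in measurable X]setTI; apply: (measurable_fun_le (f := cst e)) => //.
  by apply: measurableT_comp => //; have [] := sI C.
have mB : measurable [set w | (delta%:E < path_energy S t w)%E].
  rewrite -[X in measurable X]setTI.
  by apply: emeasurable_fun_o_infty => //; exact: measurable_path_energy.
have -> : [set w | e <= `|sp_integral S (W n) t w|] =
    [set w | e <= `|simple_sum D ((W n)^~ w) w|].
  by apply/seteqP; split => w /=; rewrite simple_sum_stop.
have sub : [set w | e <= `|simple_sum D ((W n)^~ w) w|] `<=`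
    [set w | (delta%:E < path_energy S t w)%E] `|`
    [set w | e <= `|simple_sum D' ((W n)^~ w) w|].
  move=> w /= ew; rewrite (path_energyE _ t0) lte_fin.
  by have [h|h] := ltP delta (sp_energy D w); [left|right; rewrite simple_sum_truncate].
apply: le_trans (le_measure P _ _ sub) _; rewrite ?inE//.
  exact: measurableU.
apply: le_trans (measureU2 _ _ _) _ => //.
apply: leeD => //.
have h1 := chebyshev_sqnorm P (proj1 (sI D')) e0.
have h2 : (sqnorm P setT (fun w => simple_sum D' ((W n)^~ w) w) <= delta%:E)%E.
  have nn : n != n.+1 by rewrite neq_ltn ltnSn.
  have DD' : same_grid D' D' by [].
  have := discrete_isometry hF (hW n) (hW n.+1)
    (fun A B => @independent_pair n n.+1 A B nn) 1 0 DD'.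
  rewrite expr1n expr0n mul1r mul0r addr0 => h.
  rewrite sqnorm_fin// lee_fin.
  have -> : \int[P]_w (simple_sum D' ((W n)^~ w) w ^+ 2) =
    \int[P]_w ((1 * simple_sum D' ((W n)^~ w) w +
      0 * simple_sum D' ((W n.+1)^~ w) w) ^+ 2).
    by apply: eq_Rintegral => w _; rewrite mul1r mul0r addr0.
  apply: le_trans h _; rewrite -lee_fin /Rintegral fineK; last first.
    rewrite ge0_fin_numE; last first.
      by apply: integral_ge0 => w _; rewrite lee_fin sp_energy_ge0.
    apply: (@le_lt_trans _ _ (\int[P]_w delta%:E)%E).
      apply: ge0_le_integral => //.
      - by move=> w _; rewrite lee_fin sp_energy_ge0.
      - by apply/measurable_EFinP; exact: (measurable_sp_energy hF).
      - by move=> w _; rewrite lee_fin sp_energy_truncate.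
    by rewrite integral_cst// [X in (_ * X)%E](@probability_setT _ _ _ P) mule1 ltry.
  rewrite -[X in (_ <= X)%E]mule1 -[X in (_ <= _ * X)%E](@probability_setT _ _ _ P).
  rewrite -integral_cst//; apply: ge0_le_integral => //.
  - by move=> w _; rewrite lee_fin sp_energy_ge0.
  - by apply/measurable_EFinP; exact: (measurable_sp_energy hF).
  - by move=> w _; rewrite lee_fin sp_energy_truncate.
have := le_trans h1 h2.
by rewrite muleC -lee_pdivlMr ?exprn_gt0// -EFinM.
Qed.

End ito_isometry.

(** * Integration over time and chance *)

Section convergence_to_zero.
Context {R : realType}.
Implicit Types u : nat -> \bar R.

Lemma cvge0_le u (e : R) : (0 < e)%R -> u @ \oo --> 0%E ->
  \forall n \near \oo, (u n <= e%:E)%E.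
Proof.
move=> e0 u0; have e0' : (0 < e%:E)%E by rewrite lte_fin.
by have [N _ h] := u0 _ (open_ereal_lt' e0'); exists N => // n /h /ltW.
Qed.

Lemma cvge0_ex u (e : R) : (0 < e)%R -> u @ \oo --> 0%E ->
  exists n, (u n <= e%:E)%E.
Proof. by move=> e0 /(cvge0_le e0) [N _ h]; exists N; exact: (h N (leqnn N)). Qed.

End convergence_to_zero.

Section strip.
Local Open Scope ereal_scope.
Context {R : realType} {d : measure_display} {Omega : measurableType d}.
Variable P : probability Omega R.
Local Notation mu := (@lebesgue_measure R).

Definition strip (t : R) : set (measurableTypeR R * Omega) :=
  `[0%R, t]%classic `*` setT.

Lemma measurable_strip t : measurable (strip t).
Proof. exact: measurableX. Qed.

Lemma strip_sub (s t : R) : (s <= t)%R -> strip s `<=` strip t.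
Proof.
move=> st z [/= z1 z2]; split=> //=; move: z1; rewrite !in_itv /=.
by move=> /andP[-> h]; exact: le_trans h st.
Qed.

Let restrict_strip t (f : measurableTypeR R * Omega -> \bar R) s w :
  (f \_ (strip t)) (s, w) = ((fun s => f (s, w)) \_ `[0%R, t]) s.
Proof.
rewrite !patchE /strip; have [h|h] := boolP (s \in `[0%R, t]%classic).
  by rewrite mem_set//=; split => //; exact: set_mem.
by rewrite memNset// => -[/= h' _]; move/negP: h; apply; exact: mem_set.
Qed.

Let restrict_strip2 t (f : measurableTypeR R * Omega -> \bar R) s :
  \int[P]_w (f \_ (strip t)) (s, w) =
  ((fun s => \int[P]_w f (s, w)) \_ `[0%R, t]) s.
Proof.
under eq_integral do rewrite restrict_strip patchE.
by rewrite patchE; case: ifP => // _; rewrite integral0.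
Qed.

Section nonnegative.
Variables (t : R) (f : measurableTypeR R * Omega -> \bar R).
Hypotheses (mf : measurable_fun (strip t) f) (f0 : forall z, 0 <= f z).

Let mft : measurable_fun setT (f \_ (strip t)).
Proof. by apply/(measurable_restrictT _ (measurable_strip t)). Qed.

Let ft0 z : 0 <= (f \_ (strip t)) z.
Proof. by rewrite patchE; case: ifP. Qed.

Lemma strip_tonelli_path : \int[mu \x P]_(z in strip t) f z =
  \int[P]_w \int[mu]_(s in `[0%R, t]) f (s, w).
Proof.
rewrite integral_mkcond fubini_tonelli2//; apply: eq_integral => w _.
by rewrite [RHS]integral_mkcond; apply: eq_integral => s _; rewrite restrict_strip.
Qed.

Lemma strip_tonelli_time : \int[mu \x P]_(z in strip t) f z =
  \int[mu]_(s in `[0%R, t]) \int[P]_w f (s, w).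
Proof.
rewrite integral_mkcond fubini_tonelli1// [RHS]integral_mkcond.
by apply: eq_integral => s _; rewrite /fubini_F restrict_strip2.
Qed.

Lemma measurable_strip_path :
  measurable_fun setT (fun w => \int[mu]_(s in `[0%R, t]) f (s, w)).
Proof.
have := measurable_fun_fubini_tonelli_G (m1 := mu) _ mft ft0.
congr (measurable_fun _ _); apply/funext => w; rewrite /fubini_G.
rewrite [RHS]integral_mkcond; apply: eq_integral => s _.
by rewrite restrict_strip.
Qed.

Lemma measurable_strip_time :
  measurable_fun (`[0%R, t]%classic : set (measurableTypeR R))
    (fun s => \int[P]_w f (s, w)).
Proof.
apply/(measurable_restrictT _ (measurable_itv _)).
have := measurable_fun_fubini_tonelli_F (m2 := P) _ mft ft0.
by congr (measurable_fun _ _); apply/funext => s; rewrite /fubini_F restrict_strip2.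
Qed.

End nonnegative.

Lemma measurable_strip_section1 t (f : measurableTypeR R * Omega -> \bar R) w :
  measurable_fun (strip t) f ->
  measurable_fun (`[0%R, t]%classic : set (measurableTypeR R)) (fun s => f (s, w)).
Proof.
move=> mf; apply/(measurable_restrictT _ (measurable_itv _)).
have /(measurable_restrictT _ (measurable_strip t)) mft := mf.
have := measurable_fun_pair1 w mft.
by congr (measurable_fun _ _); apply/funext => s; rewrite restrict_strip.
Qed.

Lemma measurable_strip_section2 t (f : measurableTypeR R * Omega -> \bar R) s :
  (0 <= s <= t)%R -> measurable_fun (strip t) f ->
  measurable_fun setT (fun w => f (s, w)).
Proof.
move=> st mf; have /(measurable_restrictT _ (measurable_strip t)) mft := mf.
have := measurable_fun_pair2 s mft.
congr (measurable_fun _ _); apply/funext => w; rewrite restrict_strip patchE.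
by rewrite mem_set//= in_itv.
Qed.

Section integrable.
Variables (t : R) (f : measurableTypeR R * Omega -> \bar R).
Hypothesis intf : (mu \x P).-integrable (strip t) f.

Let intft : (mu \x P).-integrable setT (f \_ (strip t)).
Proof. by apply/(integrable_mkcond _ (measurable_strip t)). Qed.

Lemma strip_fubini_path : \int[mu \x P]_(z in strip t) f z =
  \int[P]_w \int[mu]_(s in `[0%R, t]) f (s, w).
Proof.
rewrite integral_mkcond -(integral21_prod_meas1 intft); apply: eq_integral => w _.
rewrite /fubini_G [RHS]integral_mkcond; apply: eq_integral => s _.
by rewrite restrict_strip.
Qed.

Lemma strip_fubini_time : \int[mu \x P]_(z in strip t) f z =
  \int[mu]_(s in `[0%R, t]) \int[P]_w f (s, w).
Proof.
rewrite integral_mkcond -(integral12_prod_meas1 intft) [RHS]integral_mkcond.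
by apply: eq_integral => s _; rewrite /fubini_F restrict_strip2.
Qed.

Lemma integrable_strip_time :
  mu.-integrable `[0%R, t] (fun s => \int[P]_w f (s, w)).
Proof.
have mI : measurable (`[0%R, t]%classic : set (measurableTypeR R)).
  exact: measurable_itv.
apply/(integrable_mkcond _ mI).
have := integrable_fubini_F intft.
by congr (integrable _ _ _); apply/funext => s; rewrite /fubini_F restrict_strip2.
Qed.

End integrable.
End strip.

(** * Density of simple processes *)

Section density_of_simple_processes.
Context {R : realType} {d : measure_display} {Omega : measurableType d}.
Variables (P : probability Omega R) (F : R -> set (set Omega)).
Hypothesis hF : filtration F.
Variable T : R.
Hypothesis T0 : 0 < T.
Local Notation mu := (@lebesgue_measure R).
Implicit Types (S : simple_process F) (H : R -> Omega -> R).

Definition on_strip H (z : measurableTypeR R * Omega) : R := H z.1 z.2.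

Definition strip_sqnorm (t : R) H : \bar R :=
  sqnorm (mu \x P)%E (strip t) (on_strip H).

(** Continuity of the paths makes samples along a grid approximate the integrand;
    it holds for the components of a solution. *)
Definition regular_integrand H : Prop :=
  [/\ forall t, 0 <= t <= T -> wrt_measurable (F t) (H t),
      forall w, {within `[0, T], continuous (H^~ w)} &
      square_integrable (mu \x P)%E (strip T) (on_strip H)].

Lemma strip_finite : ((mu \x P)%E (strip T) < +oo)%E.
Proof.
rewrite product_measure1E//.
rewrite [X in (_ * X)%E](@probability_setT _ _ _ P) mule1.
by rewrite [X in (X < _)%E](lebesgue_measure_itv `[0, T]) /= lte_fin T0 -EFinB ltry.
Qed.

Lemma measurable_sp_fun S (D : set (measurableTypeR R * Omega)) :
  measurable_fun D (on_strip (sp_fun S)).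
Proof.
apply: measurable_funTS; apply: measurable_sum => i; apply: measurable_funM.
  exact: (measurableT_comp (sp_val_mfun hF S i) measurable_snd).
have mI : measurable_fun setT
    (\1_(`]sp_time S i, sp_time S i.+1]) : measurableTypeR R -> R).
  exact: measurable_indic.
exact: (measurableT_comp mI measurable_fst).
Qed.

Lemma sp_fun_in S i s w : (i < sp_size S)%N ->
  sp_time S i < s <= sp_time S i.+1 -> sp_fun S s w = sp_val S i w.
Proof.
move=> iS /andP[i1 i2]; rewrite /sp_fun (bigD1 (Ordinal iS))//= big1.
  by rewrite addr0 indicE mem_set ?mulr1//= in_itv/= i1 i2.
move=> j ji; rewrite indicE memNset ?mulr0//= in_itv/= => /andP[j1 j2].
move/eqP: ji; apply; apply: val_inj => /=.
apply/eqP; rewrite eqn_leq; apply/andP; split; rewrite leqNgt; apply/negP => h.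
  by have := lt_le_trans j1 (le_trans i2 (sp_time_le S h)); rewrite ltxx.
by have := lt_le_trans i1 (le_trans j2 (sp_time_le S h)); rewrite ltxx.
Qed.

Definition clip (K x : R) : R := Num.max (- K) (Num.min x K).

Lemma clip_bounded K x : 0 <= K -> `|clip K x| <= K.
Proof.
move=> K0; rewrite ler_norml /clip le_max lexx /= ge_max ge_min lexx orbT andbT.
by rewrite lerNl (le_trans _ K0)// oppr_le0.
Qed.

Lemma clip_lipschitz K x y : 0 <= K -> `|clip K x - clip K y| <= `|x - y|.
Proof.
move=> K0; rewrite ler_norml /clip.
have [? ?] : x - y <= `|x - y| /\ y - x <= `|x - y|.
  by rewrite ler_norm distrC ler_norm.
have [?|?] := leP x K; have [?|?] := leP y K; have [?|?] := leP (- K) K;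
have [?|?] := leP (- K) x; have [?|?] := leP (- K) y; apply/andP; split; lra.
Qed.

Lemma clip_id K x : `|x| <= K -> clip K x = x.
Proof. by rewrite ler_norml => /andP[h1 h2]; rewrite /clip min_l// max_r. Qed.

Lemma clip_le K x : 0 <= K -> `|clip K x - x| <= `|x|.
Proof.
move=> K0; rewrite ler_norml /clip.
have [? ?] : x <= `|x| /\ - x <= `|x| by rewrite ler_norm -normrN ler_norm.
have [?|?] := leP x K; have [?|?] := leP (- K) K; have [?|?] := leP (- K) x;
  apply/andP; split; lra.
Qed.

Lemma measurable_clip K : measurable_fun setT (clip K).
Proof. by apply: measurable_maxr => //; apply: measurable_minr. Qed.

Section discretization.
Variables (H : R -> Omega -> R) (K : R) (m : nat).
Hypothesis hH : forall t, 0 <= t <= T -> wrt_measurable (F t) (H t).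
Hypothesis K0 : 0 <= K.

(** The grid stays at [T] after its last point, since the times of a simple
    process form an infinite sequence. *)
Definition grid_point (i : nat) : R := (minn i m.+1)%:R * (T / m.+1%:R).

Let step0 : 0 <= T / m.+1%:R.
Proof. by rewrite divr_ge0// ltW. Qed.

Let time_nondecreasing i : grid_point i <= grid_point i.+1.
Proof.
rewrite /grid_point ler_wpM2r// ler_nat.
by rewrite leq_min geq_minr geq_min leqnSn.
Qed.

Lemma grid_point_itv i : 0 <= grid_point i <= T.
Proof.
rewrite mulr_ge0//= /grid_point mulrA ler_pdivrMr// mulrC ler_pM2l// ler_nat.
exact: geq_minr.
Qed.

Let val i w := clip K (H (grid_point i) w).

Let val_measurable i : wrt_measurable (F (grid_point i)) (val i).
Proof.
apply: (@wrt_measurable_comp _ _ _ _ (clip K)); first exact: measurable_clip.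
exact: hH (grid_point_itv i).
Qed.

Let val_bounded : exists C : R, forall i w, `|val i w| <= C.
Proof. by exists K => i w; exact: clip_bounded. Qed.

Let time_ge0 : 0 <= grid_point 0.
Proof. by have /andP[] := grid_point_itv 0. Qed.

Definition discretization : simple_process F :=
  {| sp_size := m.+1; sp_time := grid_point; sp_val := val;
     sp_time_ge0 := time_ge0; sp_time_nondecreasing := time_nondecreasing;
     sp_val_measurable := val_measurable; sp_val_bounded := val_bounded |}.

Lemma discretizationE s w : 0 < s <= T -> exists r,
  [/\ 0 <= r <= T, `|s - r| <= T / m.+1%:R &
      sp_fun discretization s w = clip K (H r w)].
Proof.
move=> /andP[s0 sT].
have gN : grid_point m.+1 = T.
  by rewrite /grid_point minnn mulrCA mulfV ?mulr1// pnatr_eq0.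
have ex : exists i, s <= grid_point i.+1 by exists m; rewrite gN.
case: (ex_minnP ex) => i si imin.
have im : (i <= m)%N by apply: imin; rewrite gN.
have is_ : grid_point i < s.
  case: i si imin im => [|i] si imin im; first by rewrite /grid_point min0n mul0r.
  by rewrite ltNge; apply/negP => h; have := imin i h; rewrite ltnn.
exists (grid_point i); split; first exact: grid_point_itv.
  rewrite ger0_norm; last by rewrite subr_ge0 ltW.
  rewrite lerBlDr; apply: le_trans si _.
  rewrite /grid_point (minn_idPl (_ : i.+1 <= m.+1)%N)//.
  by rewrite (minn_idPl (leqW im)) -natr1 mulrDl mul1r addrC.
by rewrite (@sp_fun_in discretization i) ?ltnS//= is_ si.
Qed.

End discretization.

Section approximation.
Variable H : R -> Omega -> R.
Hypothesis hH : regular_integrand H.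

Let mH : measurable_fun (strip T) (on_strip H).
Proof. by case: hH => _ _ []. Qed.

Let mclip K : measurable_fun (strip T) (on_strip (fun t w => clip K (H t w))).
Proof. exact: (measurableT_comp (measurable_clip K) mH). Qed.

Let clip_cvg : (fun n : nat => strip_sqnorm T (fun t w => clip n%:R (H t w) - H t w))
  @ \oo --> 0%E.
Proof.
have [_ _ sH] := hH.
rewrite -(@integral0 _ _ _ (mu \x P)%E (strip T)).
apply: (@dominated_cvg _ _ _ _ _ (measurable_strip T) _ (fun=> 0%E)
  (fun z => (on_strip H z ^+ 2)%:E)).
- by move=> n; apply: measurable_sqr; exact: (measurable_funB (mclip n%:R) mH).
- move=> z _; apply: cvg_near_cst.
  exists (Num.trunc `|on_strip H z|).+1 => // n /= hn.
  rewrite /on_strip clip_id ?subrr ?expr0n//.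
  have /andP[_ /ltW h] := trunc_itv (normr_ge0 (on_strip H z)).
  by apply: le_trans h _; rewrite ler_nat.
- by [].
- exact: (sqint_sqr sH).
- move=> n z _; rewrite gee0_abs ?lee_fin ?sqr_ge0//.
  rewrite -(real_normK (num_real (_ - _))) -(real_normK (num_real (on_strip H z))).
  by apply: lerXn2r; rewrite ?nnegrE//; exact: clip_le.
Qed.

Let hadapted : forall t, 0 <= t <= T -> wrt_measurable (F t) (H t).
Proof. by case: hH. Qed.

Let discretization_cvg K (K0 : 0 <= K) :
  (fun m : nat => strip_sqnorm T
     (fun t w => sp_fun (discretization m hadapted K0) t w - clip K (H t w)))
  @ \oo --> 0%E.
Proof.
have [_ cH _] := hH.
have mD m : measurable_fun (strip T) (on_strip
    (fun t w => sp_fun (discretization m hadapted K0) t w - clip K (H t w))).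
  exact: (measurable_funB
    (@measurable_sp_fun (discretization m hadapted K0) (strip T)) (mclip K)).
rewrite -(@integral0 _ _ _ (mu \x P)%E (strip T)).
pose f m z := (on_strip (fun t w =>
  sp_fun (discretization m hadapted K0) t w - clip K (H t w)) z ^+ 2)%:E.
suff [] : [/\ (mu \x P)%E.-integrable (strip T) (fun=> 0%E),
    (\int[(mu \x P)%E]_(z in strip T) `|f m z - 0|)%E @[m --> \oo] --> 0%E &
    (\int[(mu \x P)%E]_(z in strip T) f m z)%E @[m --> \oo] -->
      (\int[(mu \x P)%E]_(z in strip T) 0)%E] by [].
apply: (@dominated_convergence _ _ _ (mu \x P)%E _ (measurable_strip T) f
  (fun=> 0%E) (fun=> ((K + K) ^+ 2)%:E)).
- by move=> m; exact: measurable_sqr.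
- exact: measurable_cst.
- (* at time 0 the simple process vanishes *)
  exists ([set 0%R] `*` setT); split.
  + by apply: measurableX.
  + apply: eq_trans; first exact: product_measure1E.
    by rewrite [X in (X * _)%E](lebesgue_measure_set1 0) mul0e.
  move=> [s w] /= hsw; split => //; apply: contrapT => s0; apply: hsw.
  move=> [/= sT _]; rewrite /= in_itv/= in sT.
  have {}sT : 0 < s <= T.
    have /andP[h1 ->] := sT; rewrite andbT lt_neqAle h1 andbT eq_sym.
    by apply/eqP.
  pose g m := sp_fun (discretization m hadapted K0) s w - clip K (H s w).
  suff g0 : g @ \oo --> (0 : R).
    have := cvgM g0 g0; rewrite mulr0 => g20; apply: cvg_EFin; first exact: nearW.
    suff -> : fine \o (fun m => f m (s, w)) = (fun m => g m * g m) by exact: g20.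
    by apply/funext => m; rewrite /= /f -expr2.
  apply/cvgr0Pnorm_le => e e0.
  have /subspace_continuousP := cH w.
  move=> /(_ s); rewrite /= in_itv /= => /(_ _)/cvgrPdist_le/(_ e e0).
  have s1 : 0 <= s <= T by have /andP[h1 ->] := sT; rewrite ltW.
  move=> /(_ s1); rewrite near_withinE => -[/= del del0 hdel].
  exists (Num.trunc (T / del)).+1 => // m /= hm.
  have [r [rT sr]] := discretizationE m hadapted K0 w sT.
  rewrite /g => ->; apply: le_trans (clip_lipschitz _ _ K0) _.
  rewrite distrC; apply: hdel => //=.
  apply: le_lt_trans sr _; rewrite ltr_pdivrMr// mulrC -ltr_pdivrMr//.
  have /andP[_ h] := trunc_itv (divr_ge0 (ltW T0) (ltW del0)).
  by apply: lt_le_trans h _; rewrite ler_nat ltnW.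
- apply/integrableP; split; first exact: measurable_cst.
  rewrite integral_cst//; last exact: measurable_strip.
  by rewrite lte_mul_pinfty ?strip_finite// gee0_abs lee_fin sqr_ge0.
- apply: aeW => z m zT; rewrite gee0_abs ?lee_fin ?sqr_ge0//.
  rewrite -(real_normK (num_real (_ - _))).
  apply: lerXn2r; rewrite ?nnegrE ?addr_ge0//.
  apply: le_trans (ler_normB _ _) _; apply: lerD; last exact: clip_bounded.
  case: z zT => s w zT /=; have [->|s0] := eqVneq s 0.
    rewrite /sp_fun big1 ?normr0// => i _.
    rewrite indicE memNset ?mulr0//= in_itv/= => /andP[+ _].
    by rewrite ltNge (sp_time_nneg (discretization m hadapted K0)).
  case: zT => /= + _; rewrite in_itv /= => /andP[s1 s2].
  have sT : 0 < s <= T by rewrite s2 andbT lt_neqAle eq_sym s0.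
  by have [r [_ _ ->]] := discretizationE m hadapted K0 w sT; exact: clip_bounded.
Qed.

(** The clipped process is bounded with continuous paths, so its samples at the
    left end points of a fine grid converge to it by dominated convergence. *)
Lemma simple_processes_dense (e : R) : 0 < e ->
  exists S, (strip_sqnorm T (fun t w => (sp_fun S t w - H t w)%R) <= e%:E)%E.
Proof.
move=> e0; have e4 : 0 < e / 4 by rewrite divr_gt0.
have [n hn] := cvge0_ex e4 clip_cvg.
have [m hm] := cvge0_ex e4 (discretization_cvg (ler0n R n)).
set S := discretization _ _ _ in hm; exists S.
pose f z := on_strip (fun t w => sp_fun S t w - clip n%:R (H t w)) z.
pose g z := on_strip (fun t w => clip n%:R (H t w) - H t w) z.
have mf : measurable_fun (strip T) f.
  exact: (measurable_funB (@measurable_sp_fun S (strip T)) (mclip n%:R)).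
have mg : measurable_fun (strip T) g.
  exact: (measurable_funB (mclip n%:R) mH).
have -> : strip_sqnorm T (fun t w => sp_fun S t w - H t w) =
    sqnorm (mu \x P)%E (strip T) (fun z => f z + g z).
  by apply: eq_sqnorm => z _; rewrite /f /g /on_strip; ring.
apply: le_trans (sqnormD_le _ (measurable_strip T) mf mg) _.
have -> : e%:E = (2%:E * (e / 4)%:E + 2%:E * (e / 4)%:E)%E.
  by rewrite -!EFinM -EFinD; congr (_%:E); field.
by apply: leeD; apply: lee_wpmul2l.
Qed.

End approximation.

End density_of_simple_processes.

(** * The Ito integral in mean square *)

Section ito_limit.
Context {R : realType} {d : measure_display} {Omega : measurableType d}.
Variables (P : probability Omega R) (F : R -> set (set Omega)).
Hypothesis hF : filtration F.
Variable W : nat -> R -> Omega -> R.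
Hypothesis hW : forall n, brownian_motion P F (W n).
Hypothesis hWind : independent_processes P W.
Variable T : R.
Hypothesis T0 : 0 < T.
Local Notation L2 := (square_integrable P setT).
Local Notation mu := (@lebesgue_measure R).
Implicit Types (S G : simple_process F) (H J : R -> Omega -> R).

Let path_sqnorm H w : \bar R := (\int[mu]_(s in `[0%R, T]) (H s w ^+ 2)%:E)%E.

Let path_sqnorm_ge0 H w : (0 <= path_sqnorm H w)%E.
Proof. by apply: integral_ge0 => s _; rewrite lee_fin sqr_ge0. Qed.

Section measurable_process.
Variable H : R -> Omega -> R.
Hypothesis mH : measurable_fun (strip T) (on_strip H).

Let mH2 : measurable_fun (strip T) (fun z => (on_strip H z ^+ 2)%:E).
Proof. exact: measurable_sqr. Qed.

Lemma strip_sqnorm_path : strip_sqnorm P T H = (\int[P]_w path_sqnorm H w)%E.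
Proof. by rewrite [LHS]strip_tonelli_path// => z; rewrite lee_fin sqr_ge0. Qed.

Lemma measurable_path_sqnorm : measurable_fun setT (path_sqnorm H).
Proof. by apply: (measurable_strip_path mH2) => z; rewrite lee_fin sqr_ge0. Qed.

Lemma path_sqnorm_markov (c : R) : 0 < c ->
  (c%:E * P [set w | (c%:E <= path_sqnorm H w)%E] <= strip_sqnorm P T H)%E.
Proof.
move=> c0; rewrite strip_sqnorm_path.
have := @le_integral_abse _ _ _ P setT measurableT _ c measurable_path_sqnorm c0.
rewrite setTI => h; apply: le_trans (le_trans h _).
  apply: lee_wpmul2l; first by rewrite lee_fin ltW.
  by rewrite le_eqVlt; apply/predU1P; left; congr (P _); apply/seteqP; split => w /=;
    rewrite gee0_abs.
by rewrite le_eqVlt; apply/predU1P; left; apply: eq_integral => w _; rewrite gee0_abs.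
Qed.

Lemma measurable_path_section w :
  measurable_fun (`[0%R, T]%classic : set (measurableTypeR R)) (H^~ w).
Proof.
apply/measurable_EFinP.
apply: (@measurable_strip_section1 _ _ _ T (EFin \o on_strip H) w).
exact/measurable_EFinP.
Qed.

End measurable_process.

Lemma integral_path_energy_strip S :
  (\int[P]_w path_energy S T w)%E = strip_sqnorm P T (sp_fun S).
Proof. by rewrite strip_sqnorm_path//; exact: (measurable_sp_fun hF). Qed.

Lemma path_energy_le S t w : 0 <= t <= T ->
  (path_energy S t w <= path_energy S T w)%E.
Proof.
move=> /andP[t0 tT]; apply: ge0_subset_integral => //.
- apply/measurable_EFinP; apply: measurable_funX.
  apply: measurable_path_section; exact: (measurable_sp_fun hF).
- by move=> s _; rewrite lee_fin sqr_ge0.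
- by move=> s /=; rewrite !in_itv /= => /andP[-> /le_trans]; apply.
Qed.

Lemma ito_isometry_strip n S (t : R) : 0 <= t <= T ->
  (sqnorm P setT (sp_integral S (W n) t) <= strip_sqnorm P T (sp_fun S))%E.
Proof.
move=> t0T; have /andP[t0 tT] := t0T.
apply: le_trans (ito_isometry1 hF hW hWind n S t0) _.
rewrite -integral_path_energy_strip; apply: ge0_le_integral => //.
- by move=> w _; rewrite (path_energyE hF _ t0) lee_fin sp_energy_ge0.
- exact: (measurable_path_energy hF).
- by apply: (measurable_path_energy hF); exact: ltW.
- by move=> w _; exact: path_energy_le.
Qed.

(** The mean-square counterpart of [ito_integral]; one simple process serves all
    times up to [T]. *)
Definition ito_limit n H J : Prop :=
  (forall t, 0 <= t <= T -> measurable_fun setT (J t)) /\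
  forall e : R, 0 < e -> exists S,
    (strip_sqnorm P T (fun t w => sp_fun S t w - H t w)%R <= e%:E)%E /\
    forall t, 0 <= t <= T ->
      (sqnorm P setT (fun w => sp_integral S (W n) t w - J t w)%R <= e%:E)%E.

Section from_probability.
Variables (n : nat) (H J : R -> Omega -> R).
Hypothesis hH : regular_integrand P F T H.
Hypothesis hJ : ito_integral P F T (W n) H J.

Let mH : measurable_fun (strip T) (on_strip H).
Proof. by case: hH => _ _ []. Qed.

Let mB S : measurable_fun (strip T) (on_strip (fun t w => sp_fun S t w - H t w)).
Proof. exact: (measurable_funB (@measurable_sp_fun _ _ _ F hF S (strip T)) mH). Qed.

Let sp_difference S S' : exists D : simple_process F,
  (forall t w, sp_fun D t w = sp_fun S t w - sp_fun S' t w) /\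
  (forall V t w, sp_integral D V t w = sp_integral S V t w - sp_integral S' V t w).
Proof.
have [D hD] := sp_linear_combination hF 1 (-1) S S'; exists D; split.
  by move=> t w; rewrite !sp_funE hD; ring.
by move=> V t w; rewrite !sp_integralE hD; ring.
Qed.

Let measurable_tail (X : Omega -> R) (e : R) : measurable_fun setT X ->
  measurable [set w | e <= `|X w|].
Proof.
move=> mX; rewrite -[X in measurable X]setTI.
by apply: (measurable_fun_le (f := cst e)) => //; exact: measurableT_comp.
Qed.

Let path_sqnorm_sub S S' w :
  (path_sqnorm (fun t w => sp_fun S t w - sp_fun S' t w)%R w <=
   2%:E * path_sqnorm (fun t w => sp_fun S t w - H t w)%R w +
   2%:E * path_sqnorm (fun t w => sp_fun S' t w - H t w)%R w)%E.
Proof.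
have -> : path_sqnorm (fun t w => sp_fun S t w - sp_fun S' t w) w =
    sqnorm mu `[0, T]
      (fun s => (sp_fun S s w - H s w) - (sp_fun S' s w - H s w)).
  by apply: eq_integral => s _; congr (_%:E); ring.
apply: sqnormB_le => //.
- exact: (measurable_path_section (mB S)).
- exact: (measurable_path_section (mB S')).
Qed.

(** Lenglart's inequality applied to the difference with the simple processes
    that define the integral. *)
Let tail_close (e : R) : 0 < e -> exists2 rho : R, 0 < rho &
  forall G, (strip_sqnorm P T (fun t w => sp_fun G t w - H t w)%R <= rho%:E)%E ->
  forall t, 0 <= t <= T ->
    (P [set w | (e <= `|sp_integral G (W n) t w - J t w|)%R] <= e%:E)%E.
Proof.
move=> e0; have [mJ [S [SH SJ]]] := hJ.
(* Three events of probability e / 6 and the term delta / (e / 2)^2 = e / 3 of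
   Lenglart's inequality add up to less than e. *)
pose delta := e / 3 * (e / 2) ^+ 2.
have e2 : 0 < e / 2 by rewrite divr_gt0.
have d0 : 0 < delta by rewrite mulr_gt0 ?divr_gt0 ?exprn_gt0.
have d4 : 0 < delta / 4 by rewrite divr_gt0.
have e6 : 0 < e / 6 by rewrite divr_gt0.
exists (delta / 4 * (e / 6)); first by rewrite mulr_gt0.
move=> G GH t tT; have /andP[t0 _] := tT.
have [N1 _ h1] := cvge0_le e6 (SH _ d4).
have [N2 _ h2] := cvge0_le e6 (SJ t tT _ e2).
pose m := maxn N1 N2.
have {}h1 := h1 m (leq_maxl _ _); have {}h2 := h2 m (leq_maxr _ _).
have [D [Dfun Dint]] := sp_difference (S m) G.
pose A1 := [set w | e / 2 <= `|sp_integral (S m) (W n) t w - J t w|].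
pose A2 := [set w | e / 2 <= `|sp_integral D (W n) t w|].
pose B1 := [set w | ((delta / 4)%:E <=
  path_sqnorm (fun t w => sp_fun (S m) t w - H t w)%R w)%E].
pose B2 := [set w | ((delta / 4)%:E <=
  path_sqnorm (fun t w => sp_fun G t w - H t w)%R w)%E].
have msp S' : measurable_fun setT (sp_integral S' (W n) t).
  by have [] := sp_integral_sqint hF hW n S' t0.
have mJt : measurable_fun setT (J t) by exact: mJ.
have mA1 : measurable A1 by apply: measurable_tail; exact: measurable_funB.
have mA2 : measurable A2 by exact: measurable_tail.
have mge (f : Omega -> \bar R) (c : R) : measurable_fun setT f ->
    measurable [set w | (c%:E <= f w)%E].
  by move=> mf; rewrite -[X in measurable X]setTI; exact: emeasurable_fun_c_infty.
have mB1 : measurable B1.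
  by apply: mge; apply: measurable_path_sqnorm; exact: mB.
have mB2 : measurable B2.
  by apply: mge; apply: measurable_path_sqnorm; exact: mB.
have PA1 : (P A1 <= (e / 6)%:E)%E.
  apply: le_trans h2; rewrite le_eqVlt; apply/predU1P; left.
  by congr (P _); apply/seteqP; split => w /=; rewrite lee_fin.
have PB1 : (P B1 <= (e / 6)%:E)%E.
  apply: le_trans h1; rewrite le_eqVlt; apply/predU1P; left.
  by congr (P _); apply/seteqP; split => w; rewrite /B1 /path_sqnorm /= gee0_abs//;
    by apply: integral_ge0 => s _; rewrite lee_fin sqr_ge0.
have PB2 : (P B2 <= (e / 6)%:E)%E.
  have := le_trans (path_sqnorm_markov (mB G) d4) GH.
  by rewrite [X in (_ <= X)%E]EFinM lee_pmul2l.
have PA2 : (P A2 <= P (B1 `|` B2) + (e / 3)%:E)%E.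
  apply: le_trans (sp_integral_tail hF hW hWind n D t0 e2 (ltW d0)) _.
  apply: leeD; last by rewrite lee_fin /delta mulfK// expf_neq0// gt_eqF.
  apply: le_measure; rewrite ?inE.
  - rewrite -[X in measurable X]setTI; apply: emeasurable_fun_o_infty => //.
    exact: (measurable_path_energy hF).
  - exact: measurableU.
  move=> w /= hw; apply: contrapT => /not_orP[/negP b1 /negP b2].
  move: b1 b2; rewrite -!ltNge => b1 b2.
  have := lt_le_trans hw (path_energy_le D w tT); rewrite ltNge; case/negP.
  have -> : path_energy D T w =
      path_sqnorm (fun t w => sp_fun (S m) t w - sp_fun G t w) w.
    by apply: eq_integral => s _; rewrite Dfun.
  apply: le_trans (path_sqnorm_sub _ _ _) _.
  have -> : delta%:E = (2%:E * (delta / 4)%:E + 2%:E * (delta / 4)%:E)%E.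
    by rewrite -!EFinM -EFinD; congr (_%:E); field.
  by apply: leeD; apply: lee_wpmul2l => //; exact: ltW.
apply: (@le_trans _ _ (P (A1 `|` A2))).
  apply: le_measure; rewrite ?inE.
  - by apply: measurable_tail; exact: measurable_funB.
  - exact: measurableU.
  move=> w /= hw; apply: contrapT => /not_orP[/negP a1 /negP a2].
  move: a1 a2; rewrite -!ltNge Dint => a1 a2.
  have := ltrD a1 a2; rewrite -splitr ltNge; case/negP; apply: le_trans hw _.
  have -> : sp_integral G (W n) t w - J t w =
    (sp_integral (S m) (W n) t w - J t w) -
    (sp_integral (S m) (W n) t w - sp_integral G (W n) t w) by ring.
  exact: ler_normB.
apply: le_trans (measureU2 _ mA1 mA2) _.
apply: (@le_trans _ _ ((e / 6)%:E + (((e / 6)%:E + (e / 6)%:E) + (e / 3)%:E))%E).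
  apply: leeD => //; apply: le_trans PA2 _; apply: leeD => //.
  by apply: le_trans (measureU2 _ mB1 mB2) _; exact: leeD.
rewrite -!EFinD lee_fin; lra.
Qed.

(** Let simple processes approximate the integrand in mean square. Their integrals
    are close to each other in mean square by the isometry and converge in
    probability to [J] by the tail bound, so Fatou's lemma bounds their distance
    to [J] in mean square. *)
Lemma ito_integral_limit : ito_limit n H J.
Proof.
split; first by case: hJ.
move=> e e0; have e4 : 0 < e / 4 by rewrite divr_gt0.
have e4e : e / 4 <= e by lra.
have [G hG] := simple_processes_dense hF T0 hH e4.
exists G; split; first by apply: le_trans hG _; rewrite lee_fin.
move=> t tT; have /andP[t0 _] := tT.
pose rho l := Num.min (e / 4) l.+1%:R^-1.
have rho0 l : 0 < rho l by rewrite lt_min e4 invr_gt0 ltr0n.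
have [g hg] : {g : nat -> simple_process F | forall l,
    (strip_sqnorm P T (fun t w => sp_fun (g l) t w - H t w)%R <= (rho l)%:E)%E}.
  exists (fun l => sval (cid (simple_processes_dense hF T0 hH (rho0 l)))) => l.
  by case: cid.
have msp S' : measurable_fun setT (sp_integral S' (W n) t).
  by have [] := sp_integral_sqint hF hW n S' t0.
have mJt : measurable_fun setT (J t) by case: hJ => mJ _; exact: mJ.
apply: (@sqnorm_le_of_cvg_probability _ _ _ P
  (fun l w => sp_integral G (W n) t w - sp_integral (g l) (W n) t w)).
- by move=> l; exact: measurable_funB.
- exact: measurable_funB.
- move=> l; have [D [Dfun Dint]] := sp_difference G (g l).
  have -> : (fun w => sp_integral G (W n) t w - sp_integral (g l) (W n) t w) =
      sp_integral D (W n) t by apply/funext => w; rewrite Dint.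
  apply: le_trans (ito_isometry_strip n D tT) _.
  have -> : strip_sqnorm P T (sp_fun D) = sqnorm (mu \x P)%E (strip T) (fun z =>
      on_strip (fun t w => sp_fun G t w - H t w) z -
      on_strip (fun t w => sp_fun (g l) t w - H t w) z).
    by apply: eq_sqnorm => z _; rewrite /on_strip Dfun; ring.
  apply: le_trans (sqnormB_le _ (measurable_strip T) (mB G) (mB (g l))) _.
  have -> : e%:E = (2%:E * (e / 4)%:E + 2%:E * (e / 4)%:E)%E.
    by rewrite -!EFinM -EFinD; congr (_%:E); field.
  apply: leeD; apply: lee_wpmul2l => //; apply: le_trans (hg l) _.
  by rewrite lee_fin ge_min lexx.
- move=> c c0; have [r r0 hr] := tail_close c0.
  exists (Num.trunc r^-1); set l := Num.trunc _.
  have -> : [set w | c <= `|sp_integral G (W n) t w - sp_integral (g l) (W n) t w -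
      (sp_integral G (W n) t w - J t w)|] =
      [set w | c <= `|sp_integral (g l) (W n) t w - J t w|].
    by apply/seteqP; split => w /=; rewrite -[X in `|X|]opprB normrN;
      congr (_ <= `|_|); ring.
  apply: hr => //; apply: le_trans (hg l) _; rewrite lee_fin ge_min.
  apply/orP; right; rewrite invf_ple ?posrE ?ltr0n//.
  have ri : 0 <= r^-1 by rewrite invr_ge0 ltW.
  by have /andP[_ /ltW] := trunc_itv ri.
Qed.

End from_probability.
End ito_limit.

Section ito_limit_theory.
Context {R : realType} {d : measure_display} {Omega : measurableType d}.
Variables (P : probability Omega R) (F : R -> set (set Omega)).
Hypothesis hF : filtration F.
Variable W : nat -> R -> Omega -> R.
Hypothesis hW : forall n, brownian_motion P F (W n).
Hypothesis hWind : independent_processes P W.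
Variable T : R.
Hypothesis T0 : 0 < T.
Local Notation L2 := (square_integrable P setT).
Local Notation mu := (@lebesgue_measure R).
Local Notation ito_limit := (ito_limit P F W T).
Implicit Types (S : simple_process F) (H J : R -> Omega -> R).

(** For estimates that hold up to a parameter of Young's inequality. *)
Lemma le_of_linear_error (x C K : R) : 0 <= K ->
  (forall eta, 0 < eta <= 1 -> x <= C + eta * K) -> x <= C.
Proof.
move=> K0 h; apply/ler_addgt0Pr => e e0.
have K1 : 0 < K + 1 by rewrite ltr_wpDl.
pose eta := Num.min 1 (e / (K + 1)).
have eta0 : 0 < eta by rewrite lt_min ltr01 divr_gt0.
have eta1 : eta <= 1 by rewrite ge_min lexx.
have etaK : eta * (K + 1) <= e by rewrite -ler_pdivlMr// ge_min lexx orbT.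
have eta01 : 0 < eta <= 1 by rewrite eta0.
apply: le_trans (h eta eta01) _; rewrite lerD2l; apply: le_trans etaK.
by rewrite ler_wpM2l ?(ltW eta0)// lerDl.
Qed.

Let msp n S t : 0 <= t -> measurable_fun setT (sp_integral S (W n) t).
Proof. by move=> t0; have [] := sp_integral_sqint hF hW n S t0. Qed.

Lemma ito_limit_sqint n H J t : ito_limit n H J -> 0 <= t <= T -> L2 (J t).
Proof.
move=> [mJ hJ] tT; have /andP[t0 _] := tT.
have [S [_ hS]] := hJ 1 ltr01.
have sI := sp_integral_sqint hF hW n S t0.
have sD : L2 (fun w => sp_integral S (W n) t w - J t w).
  split; first by apply: measurable_funB; [exact: msp|exact: mJ].
  by apply: le_lt_trans (hS t tT) _; rewrite ltry.
have := sqintB measurableT sI sD.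
by congr (square_integrable _ _ _); apply/funext => w; ring.
Qed.

Lemma ito_limitB n H J H' J' :
  measurable_fun (strip T) (on_strip H) ->
  measurable_fun (strip T) (on_strip H') ->
  ito_limit n H J -> ito_limit n H' J' ->
  ito_limit n (fun t w => H t w - H' t w) (fun t w => J t w - J' t w).
Proof.
move=> mH mH' [mJ hJ] [mJ' hJ']; split.
  by move=> t tT; apply: measurable_funB; [exact: mJ|exact: mJ'].
move=> e e0; have e4 : 0 < e / 4 by rewrite divr_gt0.
have [S [SH SJ]] := hJ _ e4; have [S' [SH' SJ']] := hJ' _ e4.
have [D hD] := sp_linear_combination hF 1 (-1) S S'.
have E : e%:E = (2%:E * (e / 4)%:E + 2%:E * (e / 4)%:E)%E.
  by rewrite -!EFinM -EFinD; congr (_%:E); field.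
exists D; split => [|t tT].
  have -> : strip_sqnorm P T (fun t w => sp_fun D t w - (H t w - H' t w)) =
      sqnorm (mu \x P)%E (strip T) (fun z =>
        on_strip (fun t w => sp_fun S t w - H t w) z -
        on_strip (fun t w => sp_fun S' t w - H' t w) z).
    by apply: eq_sqnorm => z _; rewrite /on_strip !sp_funE hD; ring.
  have m1 := measurable_funB (@measurable_sp_fun _ _ _ F hF S (strip T)) mH.
  have m2 := measurable_funB (@measurable_sp_fun _ _ _ F hF S' (strip T)) mH'.
  apply: le_trans (sqnormB_le _ (measurable_strip T) m1 m2) _.
  by rewrite E; apply: leeD; apply: lee_wpmul2l.
have /andP[t0 _] := tT.
have -> : sqnorm P setT
    (fun w => sp_integral D (W n) t w - (J t w - J' t w)) =
    sqnorm P setT (fun w => (sp_integral S (W n) t w - J t w) -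
      (sp_integral S' (W n) t w - J' t w)).
  by apply: eq_sqnorm => w _; rewrite !sp_integralE hD; ring.
have m1 := measurable_funB (msp n S t0) (mJ t tT).
have m2 := measurable_funB (msp n S' t0) (mJ' t tT).
apply: le_trans (sqnormB_le _ measurableT m1 m2) _.
rewrite E; apply: leeD; apply: lee_wpmul2l => //; [exact: SJ|exact: SJ'].
Qed.

Section orthogonality.
Variables (r t : R) (Y : Omega -> R).
Hypotheses (r0 : 0 <= r) (rt : r <= t).
Hypotheses (mY : wrt_measurable (F r) Y) (sY : L2 Y).

Let t0 : 0 <= t := le_trans r0 rt.
Let c x := Num.max r (Num.min x t).

Let c_le x y : x <= y -> c x <= c y.
Proof.
move=> xy; rewrite /c ge_max !le_max lexx /= ge_min !le_min.
have [xt|tx] := leP x t; first by rewrite xy xt /= ?orbT// !orbT.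
by rewrite (le_trans (ltW tx) xy) lexx !orbT.
Qed.

Lemma sp_integral_orthogonal n S :
  \int[P]_w (Y w * (sp_integral S (W n) t w - sp_integral S (W n) r w)) = 0.
Proof.
(* between the times r and t, the step from a to b runs from c a to c b *)
pose D i w := sp_val S i w *
  increment (W n) (c (sp_time S i)) (c (sp_time S i.+1)) w.
have rc x : r <= c x by rewrite /c le_max lexx.
have c0 x : 0 <= c x by exact: le_trans r0 (rc x).
have E w : sp_integral S (W n) t w - sp_integral S (W n) r w =
    \sum_(i < sp_size S) D i w.
  rewrite /sp_integral -sumrB; apply: eq_bigr => i _; rewrite /D -mulrBr.
  congr (_ * _); rewrite /increment.
  have h x : W n (c x) w = W n (Num.min x t) w - W n (Num.min x r) w + W n r w.
    rewrite /c; have [xr|rx] := leP x r.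
      by rewrite (min_l (le_trans xr rt)) (max_l xr); ring.
    by rewrite max_r ?le_min ?(ltW rx)//; ring.
  by rewrite !h; ring.
have sD i : L2 (D i) /\ \int[P]_w (Y w * D i w) = 0.
  have [at_|ta] := leP (sp_time S i) t; last first.
    have ct : c (sp_time S i) = t by rewrite /c (min_r (ltW ta)) max_r.
    have ct' : c (sp_time S i.+1) = t.
      have h := le_trans (ltW ta) (sp_time_nondecreasing S i).
      by rewrite /c (min_r h) max_r.
    have D0 : D i = cst 0.
      by apply/funext => w; rewrite /D ct ct' increment_id /= mulr0.
    rewrite D0; split.
      split; first exact: measurable_cst.
      rewrite /sqnorm (eq_integral (fun=> 0%E)) ?integral0//.
      by move=> w _; rewrite /= expr0n.
    rewrite /Rintegral (eq_integral (fun=> 0%E)) ?integral0//.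
    by move=> w _; rewrite /= mulr0.
  have ac : sp_time S i <= c (sp_time S i).
    by rewrite /c (min_l at_) le_max lexx orbT.
  have cc := c_le (sp_time_nondecreasing S i).
  have mv := filtration_le hF (sp_time_nneg S i) ac (sp_val_measurable S i).
  have mYc := filtration_le hF r0 (rc (sp_time S i)) mY.
  have mYv := wrt_measurableM (filtration_sigma hF (c0 (sp_time S i))) mYc mv.
  split; first exact: (sqint_mul_increment hF (hW n) (c0 _) cc mv (sp_val_sqint P hF S i)).
  transitivity (\int[P]_w ((Y w * sp_val S i w) *
      increment (W n) (c (sp_time S i)) (c (sp_time S i.+1)) w)).
    by apply: eq_Rintegral => w _; rewrite mulrA.
  apply: (increment_orthogonal hF (hW n) (c0 _) cc mYv).
  have [C hC] := sp_val_bounded S.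
  apply: (@sqint_le _ _ _ _ _ measurableT _ (fun w => C * Y w)).
  - exact: (filtration_measurable hF (c0 (sp_time S i)) mYv).
  - exact: sqintZ.
  - move=> w _; rewrite !normrM mulrC; apply: ler_wpM2r => //.
    exact: le_trans (hC i w) (ler_norm C).
have sum0 k : \int[P]_w (Y w * \sum_(i < k) D i w) = 0.
  elim: k => [|k ih].
    rewrite /Rintegral (eq_integral (fun=> 0%E)) ?integral0//.
    by move=> w _; rewrite big_ord0 mulr0.
  transitivity (\int[P]_w (Y w * (\sum_(i < k) D i w + D k w))).
    by apply: eq_Rintegral => w _; rewrite big_ord_recr.
  rewrite Rintegral_mulDr//.
  - by rewrite ih add0r; case: (sD k).
  - by apply: sqint_sum => // i; case: (sD i).
  - by case: (sD k).
by rewrite -(sum0 (sp_size S)); apply: eq_Rintegral => w _; rewrite E.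
Qed.

(** The martingale property: integrals of simple processes have it, and it is
    stable under limits in mean square. *)
Lemma ito_limit_orthogonal n H J : t <= T -> ito_limit n H J ->
  \int[P]_w (Y w * (J t w - J r w)) = 0.
Proof.
move=> tT hJ; have [mJ _] := hJ.
have tI : 0 <= t <= T by rewrite t0.
have rI : 0 <= r <= T by rewrite r0 (le_trans rt tT).
have sJt := ito_limit_sqint hJ tI; have sJr := ito_limit_sqint hJ rI.
set A := \int[P]_w (Y w ^+ 2).
have A0 : 0 <= A by exact: Rintegral_sqr_ge0.
apply/eqP; rewrite -normr_eq0 eq_le normr_ge0 andbT.
apply: (@le_of_linear_error _ _ (A + 1)); first by rewrite addr_ge0.
move=> eta /andP[e0 e1]; rewrite add0r.
have eps0 : 0 < eta ^+ 2 / 4 by rewrite divr_gt0 ?exprn_gt0.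
have [S [_ hS]] := hJ.2 _ eps0.
pose X u w := sp_integral S (W n) u w - J u w.
have sI u : 0 <= u -> L2 (sp_integral S (W n) u) by exact: sp_integral_sqint.
have sXt : L2 (X t) by apply: sqintB => //; exact: sI.
have sXr : L2 (X r) by apply: sqintB => //; exact: sI.
have sX : L2 (fun w => X r w - X t w) by exact: sqintB.
have -> : \int[P]_w (Y w * (J t w - J r w)) =
    \int[P]_w (Y w * (X r w - X t w)).
  rewrite -[LHS]addr0 -(sp_integral_orthogonal n S).
  have sIB : L2 (fun w => sp_integral S (W n) t w - sp_integral S (W n) r w).
    by apply: sqintB => //; exact: sI.
  have sJB : L2 (fun w => J t w - J r w) by exact: sqintB.
  have sXB : L2 (fun w => -1 * (X t w - X r w)).
    by apply: sqintZ => //; exact: sqintB.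
  have := @Rintegral_mulDr _ _ _ P _ measurableT
    (fun w => X r w - X t w)
    (fun w => sp_integral S (W n) t w - sp_integral S (W n) r w) Y sX sIB sY.
  rewrite (sp_integral_orthogonal n S) !addr0 => <-.
  by apply: eq_Rintegral => w _; rewrite /X; congr (_ * _); ring.
apply: le_trans (Rintegral_mul_young measurableT sY sX e0) _.
rewrite mulrDr lerD2l mulr1 ler_pdivrMl// -expr2 -lee_fin -sqnorm_fin//.
apply: le_trans (sqnormB_le _ measurableT (proj1 sXr) (proj1 sXt)) _.
have -> : (eta ^+ 2)%:E = (2%:E * (eta ^+ 2 / 4)%:E + 2%:E * (eta ^+ 2 / 4)%:E)%E.
  by rewrite -!EFinM -EFinD; congr (_%:E); field.
by apply: leeD; apply: lee_wpmul2l => //; exact: hS.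
Qed.

End orthogonality.

(** The integrals of simple processes vanish at time 0. *)
Lemma ito_limit0 n H J Y : ito_limit n H J -> L2 Y ->
  \int[P]_w (Y w * J 0 w) = 0.
Proof.
move=> hJ sY; have I0 : 0 <= (0 : R) <= T by rewrite lexx ltW.
have sJ := ito_limit_sqint hJ I0.
set A := \int[P]_w (Y w ^+ 2).
have A0 : 0 <= A by exact: Rintegral_sqr_ge0.
apply/eqP; rewrite -normr_eq0 eq_le normr_ge0 andbT.
apply: (@le_of_linear_error _ _ (A + 1)); first by rewrite addr_ge0.
move=> eta /andP[e0 e1]; rewrite add0r.
have eps0 : 0 < eta ^+ 2 by rewrite exprn_gt0.
have [S [_ hS]] := hJ.2 _ eps0.
apply: le_trans (Rintegral_mul_young measurableT sY sJ e0) _.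
rewrite mulrDr lerD2l mulr1 ler_pdivrMl// -expr2 -lee_fin -sqnorm_fin//.
apply: le_trans (hS 0 I0); rewrite le_eqVlt; apply/predU1P; left.
apply: eq_integral => w _; rewrite (_ : sp_integral _ _ _ _ = 0) ?sub0r ?sqrrN//.
rewrite /sp_integral big1// => i _.
by rewrite !min_r ?sp_time_nneg// subrr mulr0.
Qed.

Lemma strip_sqnorm_le (s t : R) H : s <= t ->
  measurable_fun (strip t) (on_strip H) ->
  (strip_sqnorm P s H <= strip_sqnorm P t H)%E.
Proof.
move=> st mH; apply: ge0_subset_integral => //.
- exact: measurable_strip.
- exact: measurable_strip.
- exact: measurable_sqr.
- by move=> z _; rewrite lee_fin sqr_ge0.
- exact: strip_sub.
Qed.

Lemma strip_sqint_sub (s t : R) H : s <= t ->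
  square_integrable (mu \x P)%E (strip t) (on_strip H) ->
  square_integrable (mu \x P)%E (strip s) (on_strip H).
Proof.
move=> st [mH fH]; split; last exact: le_lt_trans (strip_sqnorm_le st mH) fH.
exact: (measurable_funS (measurable_strip t) (strip_sub st) mH).
Qed.

(** Young's inequality with a parameter that tends to 0 keeps the constants of the
    bound for simple processes. *)
Lemma ito_limit_isometry n m (a b : R) H J H' J' t : n != m -> 0 <= t <= T ->
  square_integrable (mu \x P)%E (strip T) (on_strip H) ->
  square_integrable (mu \x P)%E (strip T) (on_strip H') ->
  ito_limit n H J -> ito_limit m H' J' ->
  (sqnorm P setT (fun w => a * J t w + b * J' t w)%R <=
   (a ^+ 2)%:E * strip_sqnorm P t H + (b ^+ 2)%:E * strip_sqnorm P t H')%E.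
Proof.
move=> nm tT sH sH' hJ hJ'; have /andP[t0 tT'] := tT.
have restr := fun K => @strip_sqint_sub t T K tT'.
have mt := measurable_strip (Omega := Omega) t.
have sJ := ito_limit_sqint hJ tT; have sJ' := ito_limit_sqint hJ' tT.
have sL : L2 (fun w => a * J t w + b * J' t w).
  by apply: sqintD => //; exact: sqintZ.
have fin K : square_integrable (mu \x P)%E (strip T) (on_strip K) ->
    exists2 h : R, 0 <= h & strip_sqnorm P t K = h%:E.
  move=> /restr sK; rewrite /strip_sqnorm (sqnorm_fin mt sK).
  by eexists; last reflexivity; exact: Rintegral_sqr_ge0.
have [h h0 hE] := fin H sH; have [h' h'0 hE'] := fin H' sH'.
rewrite hE hE' sqnorm_fin// -!EFinM -EFinD lee_fin.
have a0 := sqr_ge0 a; have b0 := sqr_ge0 b.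
apply: (@le_of_linear_error _ _
  (3 * (a ^+ 2 * h + b ^+ 2 * h') + 8 * (a ^+ 2 + b ^+ 2))).
  by apply: addr_ge0; apply: mulr_ge0 => //; apply: addr_ge0 => //; exact: mulr_ge0.
move=> eta /andP[e0 e1].
have eps0 : 0 < eta ^+ 2 by rewrite exprn_gt0.
have [S [SH SJ]] := hJ.2 _ eps0; have [S' [SH' SJ']] := hJ'.2 _ eps0.
have young0 : (1 + eta^-1) * eta ^+ 2 = eta ^+ 2 + eta by field; rewrite gt_eqF.
have c1 : (0 <= (1 + eta)%:E)%E by rewrite lee_fin addr_ge0// ltW.
have c2 : (0 <= (1 + eta^-1)%:E)%E by rewrite lee_fin addr_ge0// invr_ge0 ltW.
have energy K C k : square_integrable (mu \x P)%E (strip T) (on_strip K) ->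
    strip_sqnorm P t K = k%:E ->
    (strip_sqnorm P T (fun t w => sp_fun C t w - K t w)%R <= (eta ^+ 2)%:E)%E ->
    (\int[P]_w path_energy (C : simple_process F) t w <=
      ((1 + eta) * k + (eta ^+ 2 + eta))%:E)%E.
  move=> sK kE CK.
  have -> : (\int[P]_w path_energy C t w)%E = strip_sqnorm P t (sp_fun C).
    by rewrite strip_sqnorm_path//; exact: (measurable_sp_fun hF).
  have mKT : measurable_fun (strip T) (on_strip (fun t w => sp_fun C t w - K t w)).
    exact: (measurable_funB (@measurable_sp_fun _ _ _ F hF C (strip T)) (proj1 sK)).
  have mKt := measurable_funS (measurable_strip T) (strip_sub tT') mKT.
  have -> : strip_sqnorm P t (sp_fun C) = sqnorm (mu \x P)%E (strip t)
      (fun z => on_strip K z + on_strip (fun t w => sp_fun C t w - K t w) z).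
    by apply: eq_sqnorm => z _; rewrite /on_strip; ring.
  apply: le_trans (sqnormD_young _ mt (proj1 (restr _ sK)) mKt e0) _.
  have -> : ((1 + eta) * k + (eta ^+ 2 + eta))%:E =
      ((1 + eta)%:E * k%:E + (1 + eta^-1)%:E * (eta ^+ 2)%:E)%E.
    by rewrite -!EFinM -EFinD young0.
  rewrite -kE; apply: leeD => //.
  apply: lee_wpmul2l => //; apply: le_trans CK.
  exact: (strip_sqnorm_le (H := fun t w => sp_fun C t w - K t w) tT').
pose I w := a * sp_integral S (W n) t w + b * sp_integral S' (W m) t w.
pose E w := a * (J t w - sp_integral S (W n) t w) +
  b * (J' t w - sp_integral S' (W m) t w).
have sI : L2 I.
  by apply: sqintD => //; apply: sqintZ => //; exact: sp_integral_sqint.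
have s1 : L2 (fun w => J t w - sp_integral S (W n) t w).
  by apply: sqintB => //; exact: sp_integral_sqint.
have s2 : L2 (fun w => J' t w - sp_integral S' (W m) t w).
  by apply: sqintB => //; exact: sp_integral_sqint.
have sE : L2 E by apply: sqintD => //; exact: sqintZ.
have I_le : (sqnorm P setT I <= (a ^+ 2 * ((1 + eta) * h + (eta ^+ 2 + eta)) +
    b ^+ 2 * ((1 + eta) * h' + (eta ^+ 2 + eta)))%:E)%E.
  apply: le_trans (ito_isometry hF hW hWind a b S S' nm t0) _.
  rewrite EFinD [X in (_ <= X + _)%E]EFinM [X in (_ <= _ + X)%E]EFinM; apply: leeD; apply: lee_wpmul2l;
    rewrite ?lee_fin//.
  - exact: energy SH.
  - exact: energy SH'.
have E_le : (sqnorm P setT E <= (2 * (a ^+ 2 + b ^+ 2) * eta ^+ 2)%:E)%E.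
  apply: le_trans (sqnormD_le _ measurableT
    (proj1 (sqintZ measurableT a s1)) (proj1 (sqintZ measurableT b s2))) _.
  rewrite !sqnormZ//; try by case: s1; try by case: s2.
  have -> : (2 * (a ^+ 2 + b ^+ 2) * eta ^+ 2)%:E =
      (2%:E * ((a ^+ 2)%:E * (eta ^+ 2)%:E) + 2%:E * ((b ^+ 2)%:E * (eta ^+ 2)%:E))%E.
    by rewrite -!EFinM -EFinD; congr (_%:E); ring.
  apply: leeD; apply: lee_wpmul2l => //; apply: lee_wpmul2l; rewrite ?lee_fin//.
  - apply: le_trans (SJ t tT); rewrite -sqnormN le_eqVlt; apply/predU1P; left.
    by apply: eq_sqnorm => w _; rewrite opprB.
  - apply: le_trans (SJ' t tT); rewrite -sqnormN le_eqVlt; apply/predU1P; left.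
    by apply: eq_sqnorm => w _; rewrite opprB.
rewrite -lee_fin -sqnorm_fin//.
have -> : sqnorm P setT (fun w => a * J t w + b * J' t w) =
    sqnorm P setT (fun w => I w + E w).
  by apply: eq_sqnorm => w _; rewrite /I /E; ring.
apply: le_trans (sqnormD_young _ measurableT (proj1 sI) (proj1 sE) e0) _.
apply: le_trans (leeD (lee_wpmul2l c1 I_le) (lee_wpmul2l c2 E_le)) _.
rewrite -!EFinM -EFinD lee_fin.
rewrite [X in _ + X](_ : _ = 2 * (a ^+ 2 + b ^+ 2) * (eta ^+ 2 + eta)); last first.
  by rewrite -young0; ring.
have e2 : eta ^+ 2 <= eta by rewrite expr2 ler_piMr// ltW.
have e3 : eta ^+ 2 * eta <= eta.
  by apply: ler_piMl; [exact: ltW|exact: le_trans e2 e1].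
set x := a ^+ 2 in a0 *; set y := b ^+ 2 in b0 *.
have xh : 0 <= x * h by rewrite mulr_ge0.
have yh : 0 <= y * h' by rewrite mulr_ge0.
have bound1 z k : 0 <= z -> 0 <= k ->
   (1 + eta) * (z * ((1 + eta) * k + (eta ^+ 2 + eta))) <=
   z * k + eta * (3 * (z * k)) + 4 * (eta * z).
  move=> z0 k0; have zk : 0 <= z * k by rewrite mulr_ge0.
  rewrite -subr_ge0.
  have -> : z * k + eta * (3 * (z * k)) + 4 * (eta * z) -
    (1 + eta) * (z * ((1 + eta) * k + (eta ^+ 2 + eta))) =
    z * k * (eta - eta ^+ 2) + z * (2 * (eta - eta ^+ 2) + (eta - eta ^+ 2 * eta)).
    by ring.
  have d1 : 0 <= eta - eta ^+ 2 by rewrite subr_ge0.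
  have d2 : 0 <= eta - eta ^+ 2 * eta by rewrite subr_ge0.
  apply: addr_ge0; apply: mulr_ge0 => //; apply: addr_ge0 => //.
  exact: mulr_ge0.
have b1 := bound1 x h a0 h0; have b2 := bound1 y h' b0 h'0.
have b3 : 2 * (x + y) * (eta ^+ 2 + eta) <= 2 * (x + y) * (eta + eta).
  by rewrite ler_wpM2l ?mulr_ge0 ?addr_ge0// lerD2r.
apply: le_trans (lerD _ b3) _; first by rewrite mulrDr; exact: lerD b1 b2.
rewrite -subr_ge0 le_eqVlt; apply/predU1P; left; ring.
Qed.

End ito_limit_theory.

(** * The energy identity for one component *)

Section primitive_of_path.
Context {R : realType}.
Local Notation mu := (@lebesgue_measure R).

Definition primitive (z : R -> R) (r : R) : R := \int[mu]_(q in `[0, r]) z q.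

Variables (z : R -> R) (t : R).
Hypothesis cz : {within `[0, t], continuous z}.

Lemma path_integrable : mu.-integrable `[0, t] (EFin \o z).
Proof.
by apply: continuous_compact_integrable => //; exact: segment_compact.
Qed.

Lemma path_sqr_integrable : mu.-integrable `[0, t] (EFin \o (fun r => z r ^+ 2)).
Proof.
have -> : (fun r => z r ^+ 2) = (z * z)%R by apply/funext => r; rewrite fctE expr2.
apply: continuous_compact_integrable; first exact: segment_compact.
by move=> x; apply: continuousM; exact: cz.
Qed.

Lemma primitive_continuous : 0 < t -> {within `[0, t], continuous (primitive z)}.
Proof.
by move=> t0; apply: parameterized_integral_continuous; [exact: ltW|exact: path_integrable].
Qed.

(** Integration by parts: the primitive of a continuous path is differentiable in
    the open interval. *)
Lemma integral_primitive_mul : 0 < t ->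
  (\int[mu]_(r in `[0, t]) (primitive z r * z r)) *+ 2 = primitive z t ^+ 2.
Proof.
move=> t0; have [czo _ _] := (continuous_within_itvP z t0).1 cz.
have [_ I0 It] := (continuous_within_itvP (primitive z) t0).1 (primitive_continuous t0).
have D x : x \in `]0, t[ -> derivable (primitive z) x 1 /\ (primitive z)^`()%classic x = z x.
  move=> xt; have := xt; rewrite in_itv/= => /andP[x0 x1].
  by apply: (@continuous_FTC1_closed _ z 0 x t x1) => //;
    [exact: path_integrable|exact: czo].
have dI : derivable_oo_LRcontinuous (primitive z) 0 t.
  by split => // x xt; have [] := D x xt.
have D' : {in `]0, t[, (primitive z)^`()%classic =1 z} by move=> x /D[].
have := Rintegration_by_parts t0 cz dI D' cz dI D'.
have -> : primitive z 0 = 0 by rewrite /primitive set_itv1 Rintegral_set1.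
have -> : \int[mu]_(x in `[0, t]) (z * primitive z)%R x =
    \int[mu]_(r in `[0, t]) (primitive z r * z r).
  by apply: eq_Rintegral => x _; rewrite fctE mulrC.
have -> : \int[mu]_(x in `[0, t]) (primitive z * z)%R x =
    \int[mu]_(r in `[0, t]) (primitive z r * z r) by [].
set K := \int[mu]_(_ in _) _ => h.
by rewrite mulr2n {1}h; ring.
Qed.

(** Cauchy-Schwarz against the constant 1, from the positivity of the variance. *)
Lemma primitive_sqr_le : 0 < t ->
  primitive z t ^+ 2 <= t * \int[mu]_(r in `[0, t]) (z r ^+ 2).
Proof.
move=> t0; set m := primitive z t / t.
have mI : measurable (`[0, t]%classic : set (measurableTypeR R)) by [].
have i1 := path_integrable; have i2 := path_sqr_integrable.
have ic : mu.-integrable `[0, t] (EFin \o cst (m ^+ 2)).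
  by apply: continuous_compact_integrable;
    [exact: segment_compact|exact: continuous_subspaceT (fun _ => cvg_cst _)].
have i3 : mu.-integrable `[0, t] (EFin \o (fun r => (2 * m) * z r)).
  exact: (integrableZl mI (2 * m) i1).
have i4 : mu.-integrable `[0, t] (EFin \o (fun r => z r ^+ 2 - (2 * m) * z r)).
  exact: (integrableB mI i2 i3).
have : 0 <= \int[mu]_(r in `[0, t]) ((z r - m) ^+ 2).
  by apply: Rintegral_ge0 => r _; exact: sqr_ge0.
have -> : \int[mu]_(r in `[0, t]) ((z r - m) ^+ 2) =
    \int[mu]_(r in `[0, t]) ((z r ^+ 2 - (2 * m) * z r) + m ^+ 2).
  by apply: eq_Rintegral => r _; ring.
rewrite (RintegralD mI i4 ic) (RintegralB mI i2 i3) (RintegralZl _ mI i1).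
have -> : \int[mu]_(x in `[0, t]) cst (m ^+ 2) x = m ^+ 2 * t.
  rewrite (Rintegral_cst mu mI); congr (_ * _).
  by rewrite [X in fine X](lebesgue_measure_itv `[0, t]) /= lte_fin t0 -EFinB subr0.
rewrite -/(primitive z t); set q := \int[mu]_(r in _) (z r ^+ 2) => h.
have tn : t != 0 by rewrite gt_eqF.
have : 0 <= t * (q - 2 * m * primitive z t + m ^+ 2 * t).
  by rewrite mulr_ge0// ltW.
have -> : t * (q - 2 * m * primitive z t + m ^+ 2 * t) = t * q - primitive z t ^+ 2.
  by rewrite /m; field.
by rewrite subr_ge0.
Qed.

End primitive_of_path.

Section almost_sure_equality.
Context {d : measure_display} {T : measurableType d} {R : realType}.
Variable P : {measure set T -> \bar R}.
Implicit Types f g h : T -> R.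

Lemma Rintegral_ae f g : measurable_fun setT f -> measurable_fun setT g ->
  {ae P, forall x, f x = g x} -> \int[P]_x f x = \int[P]_x g x.
Proof.
move=> mf mg fg; congr fine; apply: ae_eq_integral => //; try exact/measurable_EFinP.
by apply: filterS fg => x ->.
Qed.

Lemma sqint_ae f g : measurable_fun setT f -> square_integrable P setT g ->
  {ae P, forall x, f x = g x} -> square_integrable P setT f.
Proof.
move=> mf [mg fg] h; split => //; apply: le_lt_trans fg.
rewrite le_eqVlt; apply/predU1P; left.
apply: ae_eq_integral => //; try exact: measurable_sqr.
by apply: filterS h => x ->.
Qed.

End almost_sure_equality.

Section energy_identity.
Context {R : realType} {d : measure_display} {Omega : measurableType d}.
Variable P : probability Omega R.
Variable T : R.
Hypothesis T0 : 0 < T.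
Local Notation L2 := (square_integrable P setT).
Local Notation mu := (@lebesgue_measure R).

Lemma strip_Rfubini (t : R) (f g : R -> Omega -> R) :
  square_integrable (mu \x P)%E (strip t) (on_strip f) ->
  square_integrable (mu \x P)%E (strip t) (on_strip g) ->
  (forall w, mu.-integrable `[0, t] (fun s => (f s w * g s w)%:E)) ->
  (forall s, 0 <= s <= t -> L2 (f s) /\ L2 (g s)) ->
  mu.-integrable `[0, t] (fun s => (\int[P]_w (f s w * g s w))%:E) /\
  \int[P]_w \int[mu]_(s in `[0, t]) (f s w * g s w) =
  \int[mu]_(s in `[0, t]) \int[P]_w (f s w * g s w).
Proof.
move=> sf sg iw is_.
have int := sqint_mul (measurable_strip t) sf sg.
have inner s : s \in (`[0, t]%classic : set R) ->
    (\int[P]_w (f s w * g s w)%:E = (\int[P]_w (f s w * g s w)%R)%:E)%E.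
  rewrite inE /= in_itv /= => /is_[h1 h2].
  by rewrite fineK// integrable_fin_num//; exact: sqint_mul.
split.
  by have := integrable_strip_time int; apply: eq_integrable.
have h1 := strip_fubini_path int; have h2 := strip_fubini_time int.
rewrite h1 in h2; rewrite {1}/Rintegral.
have -> : (\int[P]_w (\int[mu]_(s in `[0, t]) (f s w * g s w))%R%:E =
    \int[P]_w \int[mu]_(s in `[0%R, t]) (f s w * g s w)%:E)%E.
  by apply: eq_integral => w _; rewrite fineK// integrable_fin_num//; exact: iw.
rewrite [X in fine X]h2 /Rintegral; congr fine.
by apply: eq_integral => s st; exact: inner.
Qed.

Variable Z : R -> Omega -> R.
Hypothesis cZ : forall w, {within `[0, T], continuous (Z^~ w)}.
Hypothesis sZ : square_integrable (mu \x P)%E (strip T) (on_strip Z).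
Hypothesis mZ : forall t, 0 <= t <= T -> measurable_fun setT (Z t).

Let I r w := primitive (Z^~ w) r.
Let q w := \int[mu]_(s in `[0, T]) (Z s w ^+ 2).

Let cZt (t : R) w : 0 <= t <= T -> {within `[0, t], continuous (Z^~ w)}.
Proof.
move=> /andP[t0 tT].
have sub : `[0, t]%classic `<=` (`[0, T]%classic : set R).
  by move=> x /=; rewrite !in_itv /= => /andP[-> /le_trans]; apply.
exact: (continuous_subspaceW sub (@cZ w)).
Qed.

Let qE w : (\int[mu]_(s in `[0%R, T]) (Z s w ^+ 2)%:E = (q w)%:E)%E.
Proof.
by rewrite fineK// integrable_fin_num//; exact: path_sqr_integrable (@cZ w).
Qed.

Let q_ge0 w : 0 <= q w.
Proof. by apply: Rintegral_ge0 => s _; exact: sqr_ge0. Qed.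

Let I_sqr_le (r : R) w : 0 <= r <= T -> I r w ^+ 2 <= T * q w.
Proof.
move=> rT; have /andP[r0 r1] := rT.
have [->|rn] := eqVneq r 0.
  by rewrite /I /primitive set_itv1 Rintegral_set1 expr0n mulr_ge0// ltW.
have r0' : 0 < r by rewrite lt_neqAle eq_sym rn.
apply: le_trans (primitive_sqr_le (@cZt _ w rT) r0') _.
apply: ler_pM => //; first by apply: Rintegral_ge0 => s _; exact: sqr_ge0.
rewrite -lee_fin /q /Rintegral !fineK; last 2 first.
- by apply: integrable_fin_num => //; exact: path_sqr_integrable (@cZ w).
- by apply: integrable_fin_num => //; exact: path_sqr_integrable (@cZt _ w rT).
apply: ge0_subset_integral => //.
- have := path_sqr_integrable (@cZ w); exact: measurable_int.
- by move=> s _; rewrite lee_fin sqr_ge0.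
- by move=> x /=; rewrite !in_itv /= => /andP[-> /le_trans]; apply.
Qed.

(** The primitive integrates Z s w 1_(s <= r) over s, for (r, w) in the strip; this
    is a section integral of a function that is measurable in (r, w, s). *)
Lemma measurable_primitive :
  measurable_fun (strip T) (on_strip (fun r w => primitive (Z^~ w) r)).
Proof.
pose Zt := on_strip Z \_ (strip T).
have mZt : measurable_fun setT Zt.
  by apply/(measurable_restrictT _ (measurable_strip T)); case: sZ.
pose X := ((measurableTypeR R * Omega)%type : measurableType _).
pose g (x : X * measurableTypeR R) : \bar R :=
  (Zt (x.2, x.1.2) * (x.2 <= x.1.1)%R%:R)%:E.
have mg : measurable_fun setT g.
  apply/measurable_EFinP; apply: measurable_funM.
    apply: (measurableT_comp mZt); apply/measurable_fun_pair => //.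
    by apply: measurableT_comp.
  have -> : (fun x : X * measurableTypeR R => (x.2 <= x.1.1)%R%:R) =
      \1_[set x : X * measurableTypeR R | x.2 <= x.1.1] :> (_ -> R).
    by apply/funext => x; rewrite indicE mem_setE.
  apply: measurable_indic; rewrite -[X in measurable X]setTI.
  by apply: measurable_fun_le => //; apply: measurableT_comp.
have mG : measurable_fun setT (fun x => \int[mu]_r g (x, r))%E.
  have -> : (fun x => \int[mu]_r g (x, r))%E =
      (fun x => \int[mu]_r (g ^\+ (x, r)) - \int[mu]_r (g ^\- (x, r)))%E.
    apply/funext => x; rewrite [LHS]integralE.
    by congr (_ - _)%E; apply: eq_integral => r _; rewrite ?funeposE ?funenegE.
  apply: emeasurable_funB.
  - apply: (measurable_fun_fubini_tonelli_F (m2 := mu) (g ^\+)%E) => //.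
    exact: measurable_funepos.
  - apply: (measurable_fun_fubini_tonelli_F (m2 := mu) (g ^\-)%E) => //.
    exact: measurable_funeneg.
apply: (eq_measurable_fun (fun x => fine (\int[mu]_r g (x, r))%E)).
  move=> [r w] /set_mem[/= + _]; rewrite in_itv /= => /andP[r0 rT].
  rewrite /on_strip /primitive /Rintegral /= [in RHS]integral_mkcond.
  congr fine; apply: eq_integral => s _; rewrite /g patchE /Zt patchE /=.
  have [sr|sr] := boolP (s \in `[0, r]%classic).
    move: sr; rewrite inE /= in_itv /= => /andP[s0 sr].
    rewrite sr mulr1 mem_set//; split => //=.
    by rewrite in_itv /= s0 (le_trans sr).
  have [sr'|] := boolP (s <= r); last by rewrite mulr0.
  rewrite memNset ?mul0r// => -[/= + _]; rewrite in_itv /= => /andP[s0 _].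
  by move/negP: sr; apply; rewrite inE /= in_itv /= s0 sr'.
apply: measurable_funTS; exact: (measurableT_comp (fine_measurable measurableT) mG).
Qed.

Let sI : square_integrable (mu \x P)%E (strip T) (on_strip I).
Proof.
split; first exact: measurable_primitive.
have mI := measurable_primitive; have [mZ' fZ] := sZ.
have -> : sqnorm (mu \x P)%E (strip T) (on_strip I) =
    (\int[P]_w \int[mu]_(s in `[0%R, T]) (I s w ^+ 2)%:E)%E.
  exact: (strip_sqnorm_path P mI).
apply: (@le_lt_trans _ _ (\int[P]_w ((T * T)%:E *
    \int[mu]_(s in `[0%R, T]) (Z s w ^+ 2)%:E))%E).
  apply: ge0_le_integral => //.
  - by move=> w _; apply: integral_ge0 => s _; rewrite lee_fin sqr_ge0.
  - exact: (measurable_path_sqnorm mI).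
  - by apply: measurable_funeM; exact: (measurable_path_sqnorm mZ').
  move=> w _; rewrite qE -EFinM.
  have -> : T * T * q w = (T * q w) * T by ring.
  have -> : ((T * q w * T)%:E = \int[mu]_(s in `[0%R, T]) (T * q w)%:E)%E.
    rewrite integral_cst// [X in (_ * X)%E](lebesgue_measure_itv `[0, T]) /=.
    by rewrite lte_fin T0 -EFinB subr0 EFinM.
  apply: ge0_le_integral => //.
  - by move=> s _; rewrite lee_fin sqr_ge0.
  - apply/measurable_EFinP; apply: measurable_funX.
    exact: (measurable_path_section mI).
  - by move=> s /=; rewrite in_itv /= => sT; rewrite lee_fin I_sqr_le.
rewrite ge0_integralZl_EFin//.
- rewrite -(strip_sqnorm_path P mZ') lte_mul_pinfty//.
  by rewrite lee_fin mulr_ge0// ltW.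
- by move=> w _; apply: integral_ge0 => s _; rewrite lee_fin sqr_ge0.
- exact: (measurable_path_sqnorm mZ').
- by rewrite mulr_ge0// ltW.
Qed.

Let sIt t : 0 <= t <= T -> L2 (I t).
Proof.
move=> tT; have [mZ' fZ] := sZ; split.
  apply/measurable_EFinP.
  apply: (@measurable_strip_section2 _ _ _ T (EFin \o on_strip I) t tT).
  by apply/measurable_EFinP; exact: measurable_primitive.
apply: (@le_lt_trans _ _ (\int[P]_w (T%:E *
    \int[mu]_(s in `[0%R, T]) (Z s w ^+ 2)%:E))%E).
  apply: ge0_le_integral => //.
  - by move=> w _; rewrite lee_fin sqr_ge0.
  - apply: measurable_sqr; apply/measurable_EFinP.
    apply: (@measurable_strip_section2 _ _ _ T (EFin \o on_strip I) t tT).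
    by apply/measurable_EFinP; exact: measurable_primitive.
  - by apply: measurable_funeM; exact: (measurable_path_sqnorm mZ').
  - by move=> w _; rewrite qE -EFinM lee_fin I_sqr_le.
rewrite ge0_integralZl_EFin ?(ltW T0)//.
- by rewrite -(strip_sqnorm_path P mZ') lte_mul_pinfty// lee_fin ltW.
- by move=> w _; apply: integral_ge0 => s _; rewrite lee_fin sqr_ge0.
- exact: (measurable_path_sqnorm mZ').
Qed.

Variables (M : R -> Omega -> R) (c : R).
Hypothesis sM : forall t, 0 <= t <= T -> L2 (M t).
Hypothesis orthM : forall r t, 0 <= r -> r <= t -> t <= T -> L2 (Z r) ->
  \int[P]_w (Z r w * (M t w - M r w)) = 0.
Hypothesis orth0 : forall t, 0 <= t <= T -> \int[P]_w (Z 0 w * M t w) = 0.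
Hypothesis sZ0 : L2 (Z 0).
Hypothesis Zeq : forall t, 0 <= t <= T ->
  {ae P, forall w, Z t w = Z 0 w + M t w - c * primitive (Z^~ w) t}.

Let N t w := Z 0 w + M t w.

Let sN t : 0 <= t <= T -> L2 (N t).
Proof. by move=> tT; apply: sqintD => //; exact: sM. Qed.

Let sNI t : 0 <= t <= T -> L2 (fun w => N t w - c * I t w).
Proof.
by move=> tT; apply: sqintB => //; [exact: sN|apply: sqintZ => //; exact: sIt].
Qed.

Lemma component_sqint t : 0 <= t <= T -> L2 (Z t).
Proof.
by move=> tT; apply: sqint_ae (sNI tT) (Zeq tT); exact: mZ.
Qed.

Let Z_ae t (X : Omega -> R) : 0 <= t <= T -> L2 X ->
  \int[P]_w (X w * Z t w) =
  \int[P]_w (X w * N t w) - c * \int[P]_w (X w * I t w).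
Proof.
move=> tT sX; have [mX _] := sX; have [mNI _] := sNI tT.
transitivity (\int[P]_w (X w * (N t w + (- c) * I t w))).
  apply: Rintegral_ae.
  - by apply: measurable_funM => //; exact: mZ.
  - apply: measurable_funM => //; move: mNI; congr (measurable_fun _ _).
    by apply/funext => w; ring.
  - by apply: filterS (Zeq tT) => w ->; rewrite /N /I; ring.
rewrite Rintegral_mulDr//; last 2 first.
- exact: sN.
- by apply: sqintZ => //; exact: sIt.
by rewrite Rintegral_mulZr//; [rewrite mulNr|exact: sIt].
Qed.

(** The Ito formula for the square, integrated. Writing Z = N - c I with I the
    primitive of the path, the square expands into three terms; the cross term
    E[N_t I_t] is the integral over r of E[N_t Z_r] = E[N_r Z_r], by
    orthogonality of the martingale increments, and I_t^2 is twice the integral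
    of I_r Z_r. *)
Lemma energy_identity t : 0 < t -> t <= T ->
  \int[P]_w (Z t w ^+ 2) =
  \int[P]_w (Z 0 w ^+ 2) + \int[P]_w (M t w ^+ 2) -
  (2 * c) * \int[mu]_(r in `[0, t]) \int[P]_w (Z r w ^+ 2).
Proof.
move=> t0 tT; have tI : 0 <= t <= T by rewrite ltW.
have restr := fun K => @strip_sqint_sub _ _ _ P t T K tT.
have sZt := restr _ sZ; have sIt' := restr _ sI.
have subT r : 0 <= r <= t -> 0 <= r <= T.
  by move=> /andP[-> /le_trans]; apply.
have cI w : {within `[0, t], continuous (I^~ w)}.
  exact: primitive_continuous (@cZt _ w tI) t0.
have cont_int (f : R -> R) : {within `[0, t], continuous f} ->
    mu.-integrable `[0, t] (EFin \o f).
  by move=> cf; apply: continuous_compact_integrable => //; exact: segment_compact.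
have sqE (X : Omega -> R) : \int[P]_w (X w ^+ 2) = \int[P]_w (X w * X w).
  by apply: eq_Rintegral => w _; rewrite expr2.
have [iu _] := strip_Rfubini sZt sZt
  (fun w => cont_int _ (fun x => continuousM (@cZt _ w tI x) (@cZt _ w tI x)))
  (fun s hs => conj (component_sqint (subT s hs)) (component_sqint (subT s hs))).
have [ig gE] := strip_Rfubini sIt' sZt
  (fun w => cont_int _ (fun x => continuousM (@cI w x) (@cZt _ w tI x)))
  (fun s hs => conj (sIt (subT s hs)) (component_sqint (subT s hs))).
have sNs : square_integrable (mu \x P)%E (strip t) (on_strip (fun _ w => N t w)).
  have [mN fN] := sN tI.
  have mN' : measurable_fun (strip t) (on_strip (fun _ w => N t w)).
    by apply: measurable_funTS; exact: (measurableT_comp mN measurable_snd).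
  split => //; rewrite [X in (X < _)%E](strip_sqnorm_path P mN').
  have -> : (\int[P]_w \int[mu]_(s in `[0%R, t]) (N t w ^+ 2)%:E =
      \int[P]_w (t%:E * (N t w ^+ 2)%:E))%E.
    apply: eq_integral => w _.
    rewrite integral_cst// [X in (_ * X)%E](lebesgue_measure_itv `[0, t]) /=.
    by rewrite lte_fin t0 -EFinB subr0 muleC.
  rewrite ge0_integralZl_EFin ?(ltW t0)//.
  - by rewrite lte_mul_pinfty// lee_fin ltW.
  - by move=> w _; rewrite lee_fin sqr_ge0.
  - exact: measurable_sqr.
have [_ nE] := strip_Rfubini sNs sZt
  (fun w => cont_int _ (fun x => continuousM (cvg_cst (N t w)) (@cZt _ w tI x)))
  (fun s hs => conj (sN tI) (component_sqint (subT s hs))).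
set u := fun r => \int[P]_w (Z r w * Z r w) in iu.
set g := fun r => \int[P]_w (I r w * Z r w) in ig gE.
have NI : \int[P]_w (N t w * I t w) =
    \int[mu]_(r in `[0, t]) u r + c * \int[mu]_(r in `[0, t]) g r.
  transitivity (\int[P]_w \int[mu]_(s in `[0, t]) (N t w * Z s w)).
    apply: eq_Rintegral => w _; rewrite RintegralZl//.
    exact: cont_int (@cZt _ w tI).
  have mI : measurable (`[0, t]%classic : set (measurableTypeR R)) by [].
  have icg : mu.-integrable `[0, t] (EFin \o (fun r => c * g r)).
    exact: (integrableZl mI c ig).
  rewrite nE -(RintegralZl c mI ig) -(RintegralD mI iu icg).
  apply: eq_Rintegral => r; rewrite inE /= in_itv /= => rt.
  have rT := subT r rt; have /andP[r0 rt'] := rt.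
  have sZr := component_sqint rT.
  have : \int[P]_w (Z r w * (N t w + (-1) * N r w)) = 0.
    rewrite -(orthM r0 rt' tT sZr); apply: eq_Rintegral => w _.
    by rewrite /N; congr (_ * _); ring.
  rewrite Rintegral_mulDr//; last 2 first.
  - exact: sN.
  - by apply: sqintZ => //; exact: sN.
  rewrite Rintegral_mulZr//; last exact: sN.
  rewrite (Rintegral_mulC _ _ (N t)) mulN1r => /eqP; rewrite subr_eq0 => /eqP ->.
  have := Z_ae rT sZr; rewrite (Rintegral_mulC _ _ (Z r) (I r)).
  by rewrite /u /g => ->; ring.
have II : \int[P]_w (I t w ^+ 2) = 2 * \int[mu]_(r in `[0, t]) g r.
  rewrite -gE; have mfin : P.-integrable setT (fun w => (I t w ^+ 2)%:E).
    exact: sqint_sqr (sIt tI).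
  transitivity (2 * \int[P]_w (2^-1 * I t w ^+ 2)).
    by rewrite RintegralZl// mulrA mulfV ?mul1r.
  congr (2 * _); apply: eq_Rintegral => w _.
  rewrite /I -(integral_primitive_mul (@cZt _ w tI) t0) mulr2n.
  by field.
transitivity (\int[P]_w ((N t w + (- c) * I t w) ^+ 2)).
  apply: Rintegral_ae.
  - by apply: measurable_funX; exact: mZ.
  - apply: measurable_funX; have [+ _] := sNI tI; congr (measurable_fun _ _).
    by apply/funext => w; ring.
  - by apply: filterS (Zeq tI) => w ->; rewrite /N /I; ring.
have sNt := sN tI; have sIt0 := sIt tI.
rewrite Rintegral_sqrD//; last by apply: sqintZ.
rewrite Rintegral_mulZr// NI.
have -> : \int[P]_w ((- c * I t w) ^+ 2) = c ^+ 2 * \int[P]_w (I t w ^+ 2).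
  rewrite -RintegralZl//; last exact: sqint_sqr.
  by apply: eq_Rintegral => w _; rewrite exprMn sqrrN.
rewrite II /N Rintegral_sqrD//; last exact: sM.
rewrite orth0// mulr0 addr0.
have -> : \int[mu]_(r in `[0, t]) \int[P]_w (Z r w ^+ 2) =
    \int[mu]_(r in `[0, t]) u r.
  by apply: eq_Rintegral => r _; rewrite sqE.
ring.
Qed.

End energy_identity.

(** * Paths and weighted sequences *)

Section vanishing_path.
Context {R : realType}.
Local Notation mu := (@lebesgue_measure R).

(** A nonzero value would persist on an interval of positive length. *)
Lemma continuous_sqnorm0 (z : R -> R) (T : R) : 0 < T ->
  {within `[0, T], continuous z} ->
  (\int[mu]_(s in `[0%R, T]) (z s ^+ 2)%:E = 0)%E ->
  forall r, 0 <= r <= T -> z r = 0.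
Proof.
move=> T0 cz z0 r rT; apply/eqP; apply: contraT => zr.
have e0 : 0 < `|z r| / 2 by rewrite divr_gt0// normr_gt0.
have /subspace_continuousP := cz.
move=> /(_ r); rewrite /= in_itv /= => /(_ rT)/cvgrPdist_le/(_ _ e0).
rewrite near_withinE => -[/= del del0 hdel].
have /andP[r0 r1] := rT.
pose a := Num.max 0 (r - del / 2); pose b := Num.min T (r + del / 2).
have d2 : 0 < del / 2 by rewrite divr_gt0.
have dd : del / 2 < del by lra.
have ab : a < b.
  rewrite /a /b gt_max !lt_min T0 /=; apply/andP; split; first by lra.
  by apply/andP; split; lra.
have aI : `[a, b]%classic `<=` (`[0, T]%classic : set R).
  move=> x /=; rewrite !in_itv /= /a /b ge_max le_min.
  by move=> /andP[/andP[-> _] /andP[-> _]].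
have low x : a <= x <= b -> `|z r| / 2 <= `|z x|.
  move=> xab.
  have xT : 0 <= x <= T by have := aI x; rewrite /= !in_itv /=; apply.
  have : `|z r - z x| <= `|z r| / 2.
    apply: hdel; rewrite /= ?in_itv//=.
    move: xab; rewrite /a /b ge_max le_min => /andP[/andP[_ h1] /andP[_ h2]].
    rewrite ltr_norml; apply/andP; split; lra.
  have := ler_normD (z r - z x) (z x); rewrite subrK; lra.
have mz : measurable_fun (`[0, T]%classic : set (measurableTypeR R)) z.
  exact: subspace_continuous_measurable_fun.
have : (\int[mu]_(s in `[a, b]) ((`|z r| / 2) ^+ 2)%:E <=
    \int[mu]_(s in `[0%R, T]) (z s ^+ 2)%:E)%E.
  apply: (@le_trans _ _ (\int[mu]_(s in `[a, b]) (z s ^+ 2)%:E)%E).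
    apply: ge0_le_integral => //; try exact: measurable_itv.
    all: try exact: measurable_cst.
    all: try by move=> x _; rewrite lee_fin sqr_ge0.
    - apply/measurable_EFinP; apply: measurable_funX.
      exact: (measurable_funS (measurable_itv _) aI mz).
    - move=> x /=; rewrite in_itv /= => xab; rewrite lee_fin.
      rewrite -(real_normK (num_real (z x))); apply: lerXn2r.
      + by rewrite nnegrE ltW.
      + by rewrite nnegrE.
      + exact: low.
  apply: ge0_subset_integral => //; try exact: measurable_itv.
  - by apply/measurable_EFinP; exact: measurable_funX.
  - by move=> x _; rewrite lee_fin sqr_ge0.
rewrite z0 integral_cst; last exact: (measurable_itv `[a, b]).
rewrite [X in (_ * X)%E](lebesgue_measure_itv `[a, b]) /= lte_fin ab -EFinB.
by rewrite -EFinM lee_fin leNgt mulr_gt0// ?exprn_gt0// subr_gt0.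
Qed.

End vanishing_path.

Section weighted_sequences.
Context {R : realType}.

Section Hnorm.
Context {d : measure_display} {T : measurableType d}.
Variables (mu : {measure set T -> \bar R}) (D : set T).
Hypothesis mD : measurable D.
Variables (lambda s : R) (f : nat -> T -> R).
Hypothesis mf : forall n, (1 <= n)%N -> measurable_fun D (f n).

Let weight n := wavenumber lambda n `^ (2 * s).
Let term n x : \bar R := (weight n * f n x ^+ 2)%:E.

Let term_ge0 n x : (0 <= term n x)%E.
Proof. by rewrite lee_fin mulr_ge0 ?sqr_ge0// powR_ge0. Qed.

Let mterm n : (1 <= n)%N -> measurable_fun D (term n).
Proof.
move=> n1; apply/measurable_EFinP; apply: measurable_funM => //.
by apply: measurable_funX; exact: mf.
Qed.

Let mHnorm : measurable_fun D (fun x => Hnorm2 lambda s (f^~ x)).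
Proof.
apply: (emeasurable_fun_cvg (fun K x => (\sum_(1 <= n < K) term n x)%E)).
  move=> K; rewrite (_ : (fun x => _) = (fun x =>
      (\sum_(0 <= n < K.-1) term n.+1 x)%E)); last first.
    by apply/funext => x; case: K => [|K]; [rewrite !big_geq|rewrite big_add1].
  by apply: emeasurable_sum => n; exact: mterm.
move=> x _; apply: is_cvg_nneseries => n _ _; exact: term_ge0.
Qed.

(** All later estimates are uniform in the number of terms, so that the infinite
    sum never has to be exchanged with the integral. *)
Lemma weighted_sqnorm_le K :
  (\sum_(i < K) (weight i.+1)%:E * sqnorm mu D (f i.+1) <=
   \int[mu]_(x in D) Hnorm2 lambda s (f^~ x))%E.
Proof.
have -> : (\sum_(i < K) (weight i.+1)%:E * sqnorm mu D (f i.+1) =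
    \int[mu]_(x in D) \sum_(i < K) term i.+1 x)%E.
  rewrite ge0_integral_sum//; last by move=> i; exact: mterm.
  apply: eq_bigr => i _; rewrite -ge0_integralZl_EFin ?powR_ge0//.
  - by move=> x _; rewrite lee_fin sqr_ge0.
  - by apply: measurable_sqr; exact: mf.
apply: ge0_le_integral => //.
- by move=> x _; apply: sume_ge0 => i _; exact: term_ge0.
- by apply: emeasurable_sum => i; exact: mterm.
- move=> x _.
  have -> : (\sum_(i < K) term i.+1 x = \sum_(1 <= n < K.+1) term n x)%E.
    by rewrite big_add1 /= big_mkord.
  by apply: nneseries_lim_ge => n _ _; exact: term_ge0.
Qed.

Lemma weighted_sqnorm_term_le n : (1 <= n)%N ->
  ((weight n)%:E * sqnorm mu D (f n) <=
   \int[mu]_(x in D) Hnorm2 lambda s (f^~ x))%E.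
Proof.
case: n => // n _; apply: le_trans (weighted_sqnorm_le n.+1).
rewrite big_ord_recr /= leeDr//; apply: sume_ge0 => i _.
by rewrite mule_ge0 ?sqnorm_ge0// lee_fin powR_ge0.
Qed.

End Hnorm.

Lemma bounded_sums_small (b : nat -> R) (C : R) : (forall i, 0 <= b i) ->
  (forall K, \sum_(i < K) b i <= C) ->
  forall e, 0 < e -> forall N, exists2 n, (N <= n)%N & b n <= e.
Proof.
move=> b0 bC e e0 N; apply: contrapT => h.
have big n : (N <= n)%N -> e <= b n.
  by move=> Nn; rewrite leNgt; apply/negP => /ltW bn; apply: h; exists n.
have C0 : 0 <= C by have := bC 0%N; rewrite big_ord0.
pose m := (Num.trunc (C / e)).+1.
have : m%:R * e <= \sum_(i < N + m) b i.
  rewrite big_split_ord /=; apply: ler_wpDl; first exact: sumr_ge0.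
  have -> : m%:R * e = \sum_(i < m) e by rewrite sumr_const card_ord mulr_natl.
  by apply: ler_sum => i _; apply: big; rewrite leq_addr.
have /andP[_] := trunc_itv (divr_ge0 C0 (ltW e0)).
rewrite ltr_pdivrMr// => h1 h2.
by have := lt_le_trans h1 (le_trans h2 (bC _)); rewrite ltxx.
Qed.

(** With rho = lambda^-2, the terms are the exchanges of energy of a mode with its
    two neighbours, measured with the weights of H^-1. *)
Lemma telescoping_fluxes (b : nat -> R) (rho : R) K :
  \sum_(i < K.+1) ((if i == 0%N :> nat then 0 else rho * (b i.-1 - b i)) +
    (b i.+1 - b i)) = rho * (b 0%N - b K) + (b K.+1 - b 0%N).
Proof.
elim: K => [|K ih]; first by rewrite big_ord1 /=; ring.
by rewrite big_ord_recr ih /=; ring.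
Qed.

End weighted_sequences.

(** * The dyadic system in mean square *)

Section square_integrable_solutions.
Context {R : realType} {d : measure_display} {Omega : measurableType d}.
Variable P : probability Omega R.
Variable F : R -> set (set Omega).
Hypothesis hF : filtration F.
Variable W : nat -> R -> Omega -> R.
Hypothesis hW : forall n, brownian_motion P F (W n).
Hypothesis hWind : independent_processes P W.
Variable lambda : R.
Local Notation mu := (@lebesgue_measure R).
Local Notation k := (wavenumber lambda).

Definition inflow n : R := if n == 1%N then 0 else k n.-1.

(** The value at [1] is multiplied by [inflow 1 = 0]; it only has to differ
    from [1], so that the two noises acting on a mode are always independent. *)
Definition previous n : nat := if n == 1%N then 2%N else n.-1.

Definition damping n : R := 2^-1 * (inflow n ^+ 2 + k n ^+ 2).

Definition noise (U V : nat -> R -> Omega -> R) n t w : R :=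
  inflow n * U (previous n) t w - k n * V n t w.

(** The form in which the energy method uses a solution: all stochastic
    integrals are limits in [L^2], and the modes are summable in [l^2]. *)
Definition sqint_solution (sigma T : R) (Z : nat -> R -> Omega -> R) : Prop :=
  exists U V : nat -> R -> Omega -> R,
    [/\ forall n, (1 <= n)%N -> regular_integrand P F T (Z n),
        forall n, (1 <= n)%N -> ito_limit P F W T n (Z n) (U n),
        forall n, (1 <= n)%N -> ito_limit P F W T n (Z n.+1) (V n),
        exists C : R, forall K,
          (\sum_(i < K) strip_sqnorm P T (Z i.+1) <= C%:E)%E &
        forall n t, (1 <= n)%N -> 0 <= t <= T -> {ae P, forall w,
          Z n t w = Z n 0 w + (n == 1%N)%:R * (sigma * W 0%N t w)
            + noise U V n t w - damping n * primitive (Z n ^~ w) t}].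

Lemma regular_integrand_sub (s t : R) H : s <= t ->
  regular_integrand P F t H -> regular_integrand P F s H.
Proof.
move=> st [aH cH sH]; split => [r /andP[r0 rs]|w|].
- by apply: aH; rewrite r0 (le_trans rs).
- apply: continuous_subspaceW (@cH w) => x /=; rewrite !in_itv /=.
  by move=> /andP[-> h]; exact: le_trans h st.
- exact: strip_sqint_sub st sH.
Qed.

Lemma ito_limit_sub (s t : R) n H J : s <= t -> measurable_fun (strip t) (on_strip H) ->
  ito_limit P F W t n H J -> ito_limit P F W s n H J.
Proof.
move=> st mH [mJ hJ]; split => [r /andP[r0 rs]|e e0].
  by apply: mJ; rewrite r0 (le_trans rs).
have [S [SH SJ]] := hJ _ e0; exists S; split => [|r /andP[r0 rs]].
  apply: le_trans SH; apply: strip_sqnorm_le => //.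
  exact: (measurable_funB (@measurable_sp_fun _ _ _ F hF S (strip t)) mH).
by apply: SJ; rewrite r0 (le_trans rs).
Qed.

Lemma proper_sqint_solution (sigma T T' : R) A0 A : 0 < T -> T <= T' ->
  proper_solution P F W lambda sigma T' A0 A -> sqint_solution sigma T A.
Proof.
move=> T0 TT' [[_ aA cA _ [U [V [hU hV eq1 eqn]]]] [mA fA] _].
have T'0 := lt_le_trans T0 TT'.
have mA' n : (1 <= n)%N -> measurable_fun (strip T') (on_strip (A n)) := mA n.
have w1 n : k n `^ (2 * 0) = 1 by rewrite mulr0 powRr0.
have termA n : (1 <= n)%N -> (strip_sqnorm P T' (A n) <= L2_sqnorm P lambda T' 0 A)%E.
  move=> n1; have := weighted_sqnorm_term_le (mu \x P)%E (measurable_strip T') lambda 0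
    (f := fun n => on_strip (A n)) mA' n1.
  by rewrite /= w1 mul1e.
have regA n : (1 <= n)%N -> regular_integrand P F T' (A n).
  move=> n1; split=> [t tT|w|]; first exact: aA.
    exact: cA.
  by split; [exact: mA'|exact: le_lt_trans (termA n n1) fA].
exists U, V; split=> [n n1|n n1|n n1||n t n1 /andP[t0 tT]].
- exact: regular_integrand_sub TT' (regA n n1).
- apply: (ito_limit_sub TT' (mA' n n1)).
  exact: (ito_integral_limit hF hW hWind T'0 (regA n n1) (hU n n1)).
- apply: (ito_limit_sub TT' (mA' n.+1 isT)).
  exact: (ito_integral_limit hF hW hWind T'0 (regA n.+1 isT) (hV n n1)).
- exists (fine (L2_sqnorm P lambda T' 0 A)) => K.
  rewrite fineK; last first.
    by rewrite ge0_fin_numE// (le_trans _ (termA 1%N isT))// sqnorm_ge0.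
  apply: (le_trans _ (weighted_sqnorm_le (mu \x P)%E (measurable_strip T') lambda 0
    (f := fun n => on_strip (A n)) mA' K)).
  apply: lee_sum => i _; rewrite /= w1 mul1e.
  exact: strip_sqnorm_le TT' (mA' i.+1 isT).
- have tT' : 0 <= t <= T' by rewrite t0 (le_trans tT).
  rewrite /noise /inflow /previous /damping /inflow /primitive.
  have [->|n2] := eqVneq n 1%N.
    by have := eq1 t tT'; apply: filterS => w ->; rewrite /=; ring.
  have {}n2 : (2 <= n)%N by rewrite ltn_neqAle eq_sym n2.
  by have := eqn n t n2 tT'; apply: filterS => w ->; rewrite /=; ring.
Qed.

Lemma sqint_solutionB (sigma T : R) A B :
  sqint_solution sigma T A -> sqint_solution sigma T B ->
  sqint_solution 0 T (fun n t w => A n t w - B n t w).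
Proof.
move=> [U [V [rA hU hV [C hC] eA]]] [U' [V' [rB hU' hV' [C' hC'] eB]]].
have mA n : (1 <= n)%N -> measurable_fun (strip T) (on_strip (A n)).
  by move=> /rA [_ _ []].
have mB n : (1 <= n)%N -> measurable_fun (strip T) (on_strip (B n)).
  by move=> /rB [_ _ []].
exists (fun n t w => U n t w - U' n t w), (fun n t w => V n t w - V' n t w).
split=> [n n1|n n1|n n1||n t n1 tT].
- have [aA cA sA] := rA n n1; have [aB cB sB] := rB n n1.
  split=> [t tT|w|].
  + have /andP[t0 _] := tT.
    by apply: wrt_measurableB; [exact: filtration_sigma hF _ t0|exact: aA|exact: aB].
  + by move=> x; apply: cvgB; [exact: (@cA w)|exact: (@cB w)].
  + exact: (sqintB (measurable_strip T) sA sB).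
- exact: (ito_limitB hF hW (mA n n1) (mB n n1) (hU n n1) (hU' n n1)).
- exact: (ito_limitB hF hW (mA n.+1 isT) (mB n.+1 isT) (hV n n1) (hV' n n1)).
- exists (2 * C + 2 * C') => K.
  apply: (@le_trans _ _ (\sum_(i < K) (2%:E * strip_sqnorm P T (A i.+1) +
      2%:E * strip_sqnorm P T (B i.+1)))%E).
    apply: lee_sum => i _.
    exact: (sqnormB_le _ (measurable_strip T) (mA i.+1 isT) (mB i.+1 isT)).
  rewrite big_split /= -!ge0_sume_distrr; try by move=> *; exact: sqnorm_ge0.
  by rewrite (EFinD (2 * C)) !EFinM; apply: leeD; apply: lee_wpmul2l => //; [exact: hC|exact: hC'].
- have /andP[t0 tT1] := tT.
  have := eA n t n1 tT; apply: filterS2 (eB n t n1 tT) => w -> ->.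
  have int Z : {within `[0, T], continuous (Z : R -> R)} ->
      mu.-integrable `[0, t] (EFin \o Z).
    move=> cZ; apply: path_integrable; apply: continuous_subspaceW cZ => x /=.
    by rewrite !in_itv /= => /andP[-> h]; exact: le_trans h tT1.
  have -> : primitive (fun s => A n s w - B n s w) t =
      primitive (A n ^~ w) t - primitive (B n ^~ w) t.
    have [_ cA _] := rA n n1; have [_ cB _] := rB n n1.
    by rewrite /primitive RintegralB//; [exact: int (@cA w)|exact: int (@cB w)].
  by rewrite /noise; ring.
Qed.

End square_integrable_solutions.

Section weighted_energy.
Context {R : realType} {d : measure_display} {Omega : measurableType d}.
Variable P : probability Omega R.
Variable F : R -> set (set Omega).
Hypothesis hF : filtration F.
Variable W : nat -> R -> Omega -> R.
Hypothesis hW : forall n, brownian_motion P F (W n).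
Hypothesis hWind : independent_processes P W.
Variable lambda : R.
Hypothesis lambda1 : 1 < lambda.
Local Notation mu := (@lebesgue_measure R).
Local Notation k := (wavenumber lambda).
Variable T : R.
Hypothesis T0 : 0 < T.
Variable Z : nat -> R -> Omega -> R.
Hypothesis hZ : sqint_solution P F W lambda 0 T Z.
Hypothesis sZ0 : forall n, (1 <= n)%N -> square_integrable P setT (Z n 0).
Local Notation L2 := (square_integrable P setT).

Let regZ n : (1 <= n)%N -> regular_integrand P F T (Z n).
Proof. by case: hZ => [U [V [h _ _ _ _]]]; exact: h. Qed.

Let sZ n : (1 <= n)%N -> square_integrable (mu \x P)%E (strip T) (on_strip (Z n)).
Proof. by move=> /regZ []. Qed.

Let prefix_energy t n : R := fine (strip_sqnorm P t (Z n)).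

Let prefix_energyE t n : (1 <= n)%N -> 0 <= t <= T ->
  strip_sqnorm P t (Z n) = (prefix_energy t n)%:E.
Proof.
move=> n1 /andP[_ tT]; have [mZ fZ] := sZ n1.
rewrite fineK// ge0_fin_numE ?sqnorm_ge0//.
exact: le_lt_trans (strip_sqnorm_le P tT mZ) fZ.
Qed.

Let prefix_energy_ge0 t n : 0 <= prefix_energy t n.
Proof. by rewrite fine_ge0// sqnorm_ge0. Qed.

Let previous_ge1 n : (1 <= n)%N -> (1 <= previous n)%N.
Proof. by rewrite /previous; case: n => [|[|n]]. Qed.

Let previous_neq n : (1 <= n)%N -> previous n != n.
Proof. by rewrite /previous; case: n => [|[|n]]//= _; rewrite -(inj_eq succn_inj) ltn_eqF. Qed.

(** The energy identity, with the two noises of the mode bounded by the isometry: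
    they belong to different motions. *)
Lemma mode_energy n t : (1 <= n)%N -> 0 <= t <= T ->
  L2 (Z n t) /\ (0 < t ->
  \int[P]_w (Z n t w ^+ 2) <= \int[P]_w (Z n 0 w ^+ 2) +
    (inflow lambda n ^+ 2 * prefix_energy t (previous n) +
     k n ^+ 2 * prefix_energy t n.+1) -
    (inflow lambda n ^+ 2 + k n ^+ 2) * prefix_energy t n).
Proof.
move=> n1 tT; have [U [V [_ hU hV _ eqZ]]] := hZ.
have [aZ cZ _] := regZ n1.
have p1 := previous_ge1 n1.
pose M := noise lambda U V n.
have sU s : 0 <= s <= T -> L2 (U (previous n) s).
  exact: (ito_limit_sqint hF hW (hU _ p1)).
have sV s : 0 <= s <= T -> L2 (V n s) by exact: (ito_limit_sqint hF hW (hV n n1)).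
have sM s : 0 <= s <= T -> L2 (M s).
  by move=> sT; apply: sqintB => //; apply: sqintZ => //; [exact: sU|exact: sV].
have ZE s : 0 <= s <= T -> {ae P, forall w,
    Z n s w = Z n 0 w + M s w - damping lambda n * primitive (Z n ^~ w) s}.
  by move=> sT; have := eqZ n s n1 sT; apply: filterS => w ->; rewrite mul0r mulr0 addr0.
have mZ s : 0 <= s <= T -> measurable_fun setT (Z n s).
  move=> /[dup] /andP[s0 _] sT.
  exact: (filtration_measurable hF s0 (@aZ s sT)).
have sZt := component_sqint T0 cZ (sZ n1) mZ sM (sZ0 n1) ZE.
split=> [|t0]; first exact: sZt.
have orthM r s : 0 <= r -> r <= s -> s <= T -> L2 (Z n r) ->
    \int[P]_w (Z n r w * (M s w - M r w)) = 0.
  move=> r0 rs sT sZr.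
  have rT : 0 <= r <= T by rewrite r0 (le_trans rs).
  have sT' : 0 <= s <= T by rewrite sT (le_trans r0).
  have dU := sqintB measurableT (sU s sT') (sU r rT).
  have dV := sqintB measurableT (sV s sT') (sV r rT).
  transitivity (\int[P]_w (Z n r w *
      (inflow lambda n * (U (previous n) s w - U (previous n) r w) +
       - k n * (V n s w - V n r w)))).
    by apply: eq_Rintegral => w _; rewrite /M /noise; ring.
  rewrite Rintegral_mulDr//; try by apply: sqintZ.
  rewrite !Rintegral_mulZr//.
  rewrite (ito_limit_orthogonal hF hW r0 rs (@aZ r rT) sZr sT (hU _ p1)).
  by rewrite (ito_limit_orthogonal hF hW r0 rs (@aZ r rT) sZr sT (hV n n1)) !mulr0 addr0.
have orth0 s : 0 <= s <= T -> \int[P]_w (Z n 0 w * M s w) = 0.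
  move=> /andP[s0 sT].
  have T00 : 0 <= (0 : R) <= T by rewrite lexx ltW.
  have sT' : 0 <= s <= T by rewrite s0.
  have M0 : \int[P]_w (Z n 0 w * M 0 w) = 0.
    transitivity (\int[P]_w (Z n 0 w *
        (inflow lambda n * U (previous n) 0 w + - k n * V n 0 w))).
      by apply: eq_Rintegral => w _; rewrite /M /noise; ring.
    have sU0 := sU _ T00; have sV0 := sV _ T00; have sZ00 := sZ0 n1.
    rewrite Rintegral_mulDr//; try by apply: sqintZ.
    rewrite !Rintegral_mulZr//.
    by rewrite (ito_limit0 hF hW T0 (hU _ p1))// (ito_limit0 hF hW T0 (hV n n1))// !mulr0 addr0.
  have sMM := sqintB measurableT (sM s sT') (sM 0 T00).
  transitivity (\int[P]_w (Z n 0 w * ((M s w - M 0 w) + M 0 w))).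
    by apply: eq_Rintegral => w _; rewrite subrK.
  rewrite Rintegral_mulDr//; [|exact: sM|exact: sZ0].
  by rewrite M0 addr0; apply: orthM => //; exact: sZ0.
have /andP[_ tT1] := tT.
rewrite (energy_identity T0 cZ (sZ n1) mZ sM orthM orth0 (sZ0 n1) ZE t0 tT1).
have -> : \int[mu]_(r in `[0, t]) \int[P]_w (Z n r w ^+ 2) = prefix_energy t n.
  rewrite /prefix_energy /strip_sqnorm /sqnorm strip_tonelli_time.
  - congr fine; apply: eq_integral => r; rewrite inE /= in_itv /= => /andP[r0 rt].
    rewrite -sqnorm_fin//; apply: sZt.
    by rewrite r0 (le_trans rt).
  - apply: measurable_sqr; have [mZ' _] := sZ n1.
    exact: (measurable_funS (measurable_strip T) (strip_sub tT1) mZ').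
  - by move=> z; rewrite lee_fin sqr_ge0.
have -> : 2 * damping lambda n = inflow lambda n ^+ 2 + k n ^+ 2.
  by rewrite /damping; field.
rewrite lerD2r lerD2l -lee_fin -sqnorm_fin//; last exact: sM.
have := ito_limit_isometry hF hW hWind (inflow lambda n) (- k n) (previous_neq n1) tT
  (sZ p1) (sZ (isT : (1 <= n.+1)%N)) (hU _ p1) (hV n n1).
rewrite !prefix_energyE// -!EFinM -EFinD sqrrN.
by apply: le_trans; rewrite le_eqVlt; apply/predU1P; left; apply: eq_sqnorm => w _; rewrite /M /noise; ring.
Qed.

Variable eta : R.
Hypothesis initial_bound : forall K,
  \sum_(i < K) (k i.+1 ^+ 2)^-1 * \int[P]_w (Z i.+1 0 w ^+ 2) <= eta.

Lemma wavenumber_sqr_gt0 n : 0 < k n ^+ 2.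
Proof. by rewrite exprn_gt0// exprn_gt0// (lt_trans _ lambda1). Qed.

Let weighted_ge0 n (Y : Omega -> R) : 0 <= (k n ^+ 2)^-1 * \int[P]_w (Y w ^+ 2).
Proof.
by apply: mulr_ge0; [rewrite invr_ge0 ltW// wavenumber_sqr_gt0|exact: Rintegral_sqr_ge0].
Qed.

(** Among the boundary terms of the telescoping sum only the energy of the first
    mode left out has a positive sign, because lambda^-2 <= 1. *)
Let truncated_energy t K : 0 < t <= T ->
  \sum_(i < K.+1) (k i.+1 ^+ 2)^-1 * \int[P]_w (Z i.+1 t w ^+ 2) <=
  eta + prefix_energy t K.+2.
Proof.
move=> /andP[t0 tT]; have tT' : 0 <= t <= T by rewrite ltW.
pose b i := prefix_energy t i.+1; pose rho := (lambda ^+ 2)^-1.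
have l0 : 0 < lambda by rewrite (lt_trans _ lambda1).
have rho0 : 0 < rho by rewrite invr_gt0 exprn_gt0.
have rho1 : rho <= 1 by rewrite invf_le1 ?exprn_gt0// exprn_ege1// ltW.
apply: (@le_trans _ _ (\sum_(i < K.+1) ((k i.+1 ^+ 2)^-1 * \int[P]_w (Z i.+1 0 w ^+ 2) +
    ((if i == 0%N :> nat then 0 else rho * (b i.-1 - b i)) + (b i.+1 - b i))))).
  apply: ler_sum => -[i iK] _ /=; have kn := wavenumber_sqr_gt0 i.+1.
  have [_ /(_ t0) h] := mode_energy (isT : (1 <= i.+1)%N) tT'.
  apply: le_trans (ler_wpM2l _ h) _; first by rewrite invr_ge0 ltW.
  rewrite le_eqVlt; apply/predU1P; left.
  rewrite -addrA mulrDr; congr (_ + _); rewrite /b /inflow /previous.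
  case: i iK kn {h} => [|i] iK kn /=.
    by field; rewrite expf_neq0// gt_eqF// exprn_gt0.
  rewrite /rho /wavenumber !exprS; field.
  by rewrite !gt_eqF//= exprn_gt0.
rewrite big_split /= telescoping_fluxes; apply: lerD; first exact: initial_bound.
rewrite -subr_ge0.
have := prefix_energy_ge0 t K.+1; have := prefix_energy_ge0 t 1; rewrite /b.
by move=> h1 h2; nra.
Qed.

(** The energies of the modes are summable, hence arbitrarily small for suitable
    large modes, where the sum is cut off. *)
Lemma mode_bound n t : (1 <= n)%N -> 0 <= t <= T ->
  (k n ^+ 2)^-1 * \int[P]_w (Z n t w ^+ 2) <= eta.
Proof.
case: n => // n _ /andP[t0 tT].
pose v s (i : nat) := (k i.+1 ^+ 2)^-1 * \int[P]_w (Z i.+1 s w ^+ 2).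
have v0 s i : 0 <= v s i by exact: weighted_ge0.
have single s K : (n < K)%N -> v s n <= \sum_(i < K) v s i.
  by move=> nK; rewrite (bigD1 (Ordinal nK))//= lerDl sumr_ge0.
have [<-|tn] := eqVneq 0 t.
  by apply: le_trans (single 0 n.+1 (leqnn _)) _; exact: initial_bound.
have tT' : 0 < t <= T by rewrite lt_neqAle tn t0.
have [U [V [_ _ _ [C hC] _]]] := hZ.
have bC K : \sum_(i < K) prefix_energy t i.+1 <= C.
  rewrite -lee_fin; apply: le_trans (hC K); rewrite -sumEFin.
  apply: lee_sum => i _; rewrite -prefix_energyE ?t0//.
  by apply: strip_sqnorm_le => //; have [] := sZ (isT : (1 <= i.+1)%N).
apply/ler_addgt0Pr => e e0.
have [m nm bm] := bounded_sums_small (fun i => prefix_energy_ge0 t i.+1) bC e0 n.+2.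
case: m nm bm => // m nm bm.
apply: le_trans (single t m.+1 _) _; first by rewrite (leq_trans _ nm).
by apply: le_trans (truncated_energy m tT') _; rewrite lerD2l.
Qed.

(** Integrating the bound in time costs a factor depending on the mode, which
    is harmless since the modes are treated one at a time. *)
Lemma mode_stability n : (1 <= n)%N ->
  (strip_sqnorm P T (Z n) <= (T * k n ^+ 2 * eta)%:E)%E.
Proof.
move=> n1; have [mZ _] := sZ n1.
have mZ2 := measurable_sqr mZ.
have Z0 z : (0 <= (on_strip (Z n) z ^+ 2)%:E)%E by rewrite lee_fin sqr_ge0.
rewrite /strip_sqnorm /sqnorm strip_tonelli_time//.
apply: (@le_trans _ _ (\int[mu]_(s in `[0%R, T]) (k n ^+ 2 * eta)%:E)%E); last first.
  rewrite integral_cst; last exact: (measurable_itv `[0, T]).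
  rewrite [X in (_ * X)%E](lebesgue_measure_itv `[0, T]) /= lte_fin T0 -EFinB -EFinM.
  by rewrite lee_fin le_eqVlt; apply/predU1P; left; ring.
apply: ge0_le_integral.
- exact: (measurable_itv `[0, T]).
- by move=> s _; apply: integral_ge0 => w _; exact: Z0.
- exact: (measurable_strip_time P mZ2 Z0).
- exact: measurable_cst.
- move=> s; rewrite /= in_itv /= => sT.
  have [sZs _] := mode_energy n1 sT.
  have := sqnorm_fin measurableT sZs; rewrite /sqnorm /on_strip /= => ->.
  by rewrite lee_fin -ler_pdivrMl ?wavenumber_sqr_gt0// mode_bound.
Qed.

End weighted_energy.

(** * Uniqueness of moderate solutions *)

Section stability.
Context {R : realType} {d : measure_display} {Omega : measurableType d}.
Variable P : probability Omega R.
Variable F : R -> set (set Omega).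
Hypothesis hF : filtration F.
Variable W : nat -> R -> Omega -> R.
Hypothesis hW : forall n, brownian_motion P F (W n).
Hypothesis hWind : independent_processes P W.
Variable lambda sigma : R.
Hypothesis lambda1 : 1 < lambda.
Local Notation mu := (@lebesgue_measure R).
Local Notation k := (wavenumber lambda).

Lemma weight_negative_one n : k n `^ (2 * -1) = (k n ^+ 2)^-1.
Proof.
rewrite mulrN1 powRN -[2]/(2%:R) powR_mulrn//.
by rewrite exprn_ge0// ltW// (lt_trans _ lambda1).
Qed.

Lemma initial_sqint Y n : (1 <= n)%N -> in_L2_Omega P lambda (-1) Y ->
  square_integrable P setT (Y n).
Proof.
move=> n1 [mY fY]; split; first exact: mY.
have := le_lt_trans (weighted_sqnorm_term_le P measurableT lambda (-1) mY n1) fY.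
rewrite /= weight_negative_one => h.
rewrite ltey; apply/eqP => Yoo; move: h.
by rewrite Yoo gt0_muley// lte_fin invr_gt0 wavenumber_sqr_gt0.
Qed.

Lemma proper_stability (T TA TB eta : R) A0 B0 A B n :
  0 < T -> T <= TA -> T <= TB ->
  proper_solution P F W lambda sigma TA A0 A ->
  proper_solution P F W lambda sigma TB B0 B ->
  in_L2_Omega P lambda (-1) A0 -> in_L2_Omega P lambda (-1) B0 ->
  (forall K, (\sum_(i < K) ((k i.+1 ^+ 2)^-1)%:E *
    sqnorm P setT (fun w => (A0 i.+1 w - B0 i.+1 w)%R) <= eta%:E)%E) ->
  (1 <= n)%N ->
  (strip_sqnorm P T (fun t w => (A n t w - B n t w)%R) <= (T * k n ^+ 2 * eta)%:E)%E.
Proof.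
move=> T0 TA0 TB0 pA pB hA0 hB0 heta n1.
have [[_ aA _ iA _] _ _] := pA; have [[_ aB _ iB _] _ _] := pB.
have sZ := sqint_solutionB hF hW
  (proper_sqint_solution hF hW hWind T0 TA0 pA)
  (proper_sqint_solution hF hW hWind T0 TB0 pB).
pose Z n t w := A n t w - B n t w; pose Z0 n w := A0 n w - B0 n w.
have sZ0 m : (1 <= m)%N -> square_integrable P setT (Z0 m).
  by move=> m1; apply: sqintB => //; exact: initial_sqint.
have mZ m : (1 <= m)%N -> measurable_fun setT (Z m 0).
  move=> m1; apply: measurable_funB.
  - apply: (filtration_measurable hF (lexx 0)); apply: aA => //.
    by rewrite lexx (le_trans _ TA0)// ltW.
  - apply: (filtration_measurable hF (lexx 0)); apply: aB => //.
    by rewrite lexx (le_trans _ TB0)// ltW.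
have Z0E m : (1 <= m)%N -> {ae P, forall w, Z m 0 w = Z0 m w}.
  by move=> m1; have := iA m m1; apply: filterS2 (iB m m1) => w; rewrite /Z /Z0 => -> ->.
apply: (mode_stability hF hW hWind lambda1 T0 sZ _ _ n1) => [m m1|K].
  exact: sqint_ae (mZ m m1) (sZ0 m m1) (Z0E m m1).
rewrite -lee_fin; apply: le_trans (heta K).
have mZ0 m : (1 <= m)%N -> measurable_fun setT (Z0 m) by move=> /sZ0[].
rewrite -sumEFin; apply: lee_sum => i _.
rewrite [X in (_ <= _ * X)%E](sqnorm_fin measurableT (sZ0 i.+1 isT)).
rewrite -EFinM lee_fin le_eqVlt; apply/predU1P; left; congr (_ * _).
apply: Rintegral_ae.
- by apply: measurable_funX; exact: (mZ i.+1).
- by apply: measurable_funX; exact: (mZ0 i.+1).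
- by have := Z0E i.+1 isT; apply: filterS => w; rewrite /Z => ->.
Qed.

Lemma mode_le_sqnorm T Y n : (1 <= n)%N ->
  (forall n, (1 <= n)%N -> measurable_fun (strip T) (on_strip (Y n))) ->
  (strip_sqnorm P T (Y n) <= (k n ^+ 2)%:E * L2_sqnorm P lambda T (-1) Y)%E.
Proof.
move=> n1 mY.
have := weighted_sqnorm_term_le (mu \x P)%E (measurable_strip T) lambda (-1)
  (f := fun n => on_strip (Y n)) mY n1.
rewrite /= weight_negative_one => h.
by rewrite -lee_pdivrMl ?wavenumber_sqr_gt0//; exact: h.
Qed.

(** With X_N and Y_N proper solutions near X and X', the difference X - X' is
    (X_N - Y_N) - (X_N - X) + (Y_N - X'). The first term is controlled by the
    initial data of X_N and Y_N, which tend to the same limit. *)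
Lemma moderate_sqdist0 (T T' : R) X0 X X' n : 0 < T -> T <= T' ->
  moderate_solution P F W lambda sigma T X0 X ->
  moderate_solution P F W lambda sigma T' X0 X' -> (1 <= n)%N ->
  strip_sqnorm P T (fun t w => (X n t w - X' n t w)%R) = 0%E.
Proof.
move=> T0 TT' [_ [mX0 _] [mX _] [XN [X0N [pX cX iX cX0]]]].
move=> [_ _ [mX' _] [YN [Y0N [pY cY iY cY0]]]] n1.
apply/eqP; rewrite eq_le sqnorm_ge0 andbT; apply/lee_addgt0Pr => e e0; rewrite add0e.
(* In the final sum, 16 T k_n^2 comes from the initial data, 4 k_n^2 and 2 k_n^2
   from the approximations of X and of X'. *)
pose C := 6 * k n ^+ 2 + 16 * T * k n ^+ 2.
have kn := wavenumber_sqr_gt0 lambda1 n.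
have C0 : 0 < C by apply: addr_gt0; rewrite pmulr_lgt0// mulr_gt0.
pose del := e / C; have del0 : 0 < del by rewrite divr_gt0.
near \oo => N.
have d1 : (L2_sqnorm P lambda T (-1) (fun n t w => (XN N n t w - X n t w)%R) <= del%:E)%E.
  by near: N; exact: cvge0_le.
have d2 : (L2_sqnorm P lambda T' (-1) (fun n t w => (YN N n t w - X' n t w)%R) <= del%:E)%E.
  by near: N; exact: cvge0_le.
have d3 : (L2_Omega_sqnorm P lambda (-1) (fun n w => (X0N N n w - X0 n w)%R) <= del%:E)%E.
  by near: N; exact: cvge0_le.
have d4 : (L2_Omega_sqnorm P lambda (-1) (fun n w => (Y0N N n w - X0 n w)%R) <= del%:E)%E.
  by near: N; exact: cvge0_le.
have sub (H : R -> Omega -> R) : measurable_fun (strip T') (on_strip H) ->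
    measurable_fun (strip T) (on_strip H).
  exact: (measurable_funS (measurable_strip T') (strip_sub TT')).
have mXN m : (1 <= m)%N -> measurable_fun (strip T) (on_strip (XN N m)).
  by have [_ [h _] _] := pX N; exact: h.
have mYN m : (1 <= m)%N -> measurable_fun (strip T') (on_strip (YN N m)).
  by have [_ [h _] _] := pY N; exact: h.
have s1 : (strip_sqnorm P T (fun t w => (XN N n t w - X n t w)%R) <= (k n ^+ 2 * del)%:E)%E.
  apply: le_trans (mode_le_sqnorm (Y := fun n t w => XN N n t w - X n t w) n1 _) _.
    by move=> m m1; exact: (measurable_funB (mXN m m1) (mX m m1)).
  rewrite (EFinM (k n ^+ 2) del); apply: lee_wpmul2l; first exact: ltW.
  exact: d1.
have s3 : (strip_sqnorm P T (fun t w => (YN N n t w - X' n t w)%R) <= (k n ^+ 2 * del)%:E)%E.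
  have mD m : (1 <= m)%N ->
      measurable_fun (strip T') (on_strip (fun t w => (YN N m t w - X' m t w)%R)).
    by move=> m1; exact: (measurable_funB (mYN m m1) (mX' m m1)).
  apply: le_trans (strip_sqnorm_le P TT' (mD n n1)) _.
  apply: le_trans (mode_le_sqnorm (Y := fun n t w => YN N n t w - X' n t w) n1 mD) _.
  rewrite (EFinM (k n ^+ 2) del); apply: lee_wpmul2l; first exact: ltW.
  exact: d2.
have s2 : (strip_sqnorm P T (fun t w => (XN N n t w - YN N n t w)%R) <=
    (T * k n ^+ 2 * (4 * del))%:E)%E.
  apply: (proper_stability T0 (lexx T) TT' (pX N) (pY N) (iX N) (iY N) _ n1).
  move=> K; have mD (Y : nat -> Omega -> R) : (forall m, (1 <= m)%N -> measurable_fun setT (Y m)) ->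
      forall m, (1 <= m)%N -> measurable_fun setT (fun w => Y m w - X0 m w).
    by move=> mY m m1; apply: measurable_funB; [exact: mY|exact: mX0].
  have [mX0N _] := iX N; have [mY0N _] := iY N.
  have w0 i : (0 <= ((k i.+1 ^+ 2)^-1)%:E :> \bar R)%E.
    by rewrite lee_fin invr_ge0 ltW// wavenumber_sqr_gt0.
  have bound (Y : nat -> Omega -> R) : (forall m, (1 <= m)%N -> measurable_fun setT (Y m)) ->
      (L2_Omega_sqnorm P lambda (-1) (fun n w => (Y n w - X0 n w)%R) <= del%:E)%E ->
      (\sum_(i < K) ((k i.+1 ^+ 2)^-1)%:E *
        sqnorm P setT (fun w => (Y i.+1 w - X0 i.+1 w)%R) <= del%:E)%E.
    move=> mY; apply: le_trans.
    apply: le_trans (weighted_sqnorm_le P measurableT lambda (-1) (@mD _ mY) K).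
    by apply: lee_sum => i _; rewrite /= weight_negative_one.
  have distr (x a b : \bar R) : (0 <= a -> 0 <= b ->
      x * (2%:E * a + 2%:E * b) = 2%:E * (x * a) + 2%:E * (x * b))%E.
    by move=> a0 b0; rewrite ge0_muleDr ?mule_ge0//; congr (_ + _)%E; exact: muleCA.
  apply: (@le_trans _ _ (\sum_(i < K) (2%:E * (((k i.+1 ^+ 2)^-1)%:E *
        sqnorm P setT (fun w => (X0N N i.+1 w - X0 i.+1 w)%R)) +
      2%:E * (((k i.+1 ^+ 2)^-1)%:E *
        sqnorm P setT (fun w => (Y0N N i.+1 w - X0 i.+1 w)%R))))%E).
    apply: lee_sum => i _.
    rewrite -distr ?sqnorm_ge0//; apply: lee_wpmul2l => //.
    apply: le_trans (sqnormB_le P measurableT (@mD _ mX0N i.+1 isT) (@mD _ mY0N i.+1 isT)).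
    by rewrite le_eqVlt; apply/predU1P; left; apply: eq_sqnorm => w _; ring.
  rewrite big_split /= -!ge0_sume_distrr; try by move=> *; rewrite mule_ge0// sqnorm_ge0.
  have -> : 4 * del = 2 * del + 2 * del by ring.
  rewrite (EFinD (2 * del)) EFinM; apply: leeD; apply: lee_wpmul2l => //; exact: bound.
have mA := measurable_funB (mXN n n1) (sub _ (mYN n n1)).
have mB := measurable_funB (mXN n n1) (mX n n1).
have mD := measurable_funB (sub _ (mYN n n1)) (sub _ (mX' n n1)).
have -> : strip_sqnorm P T (fun t w => (X n t w - X' n t w)%R) =
    sqnorm (mu \x P)%E (strip T) (fun z =>
      ((on_strip (XN N n) z - on_strip (YN N n) z) -
       (on_strip (XN N n) z - on_strip (X n) z)) +
      (on_strip (YN N n) z - on_strip (X' n) z)).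
  by apply: eq_sqnorm => z _; rewrite /on_strip; ring.
apply: le_trans (sqnormD_le _ (measurable_strip T) (measurable_funB mA mB) mD) _.
apply: le_trans (leeD (lee_wpmul2l _ (sqnormB_le _ (measurable_strip T) mA mB)) (lexx _)) _ => //.
apply: (@le_trans _ _ (2%:E * (2%:E * (T * k n ^+ 2 * (4 * del))%:E +
    2%:E * (k n ^+ 2 * del)%:E) + 2%:E * (k n ^+ 2 * del)%:E)%E).
  apply: leeD; apply: lee_wpmul2l => //.
  by apply: leeD; apply: lee_wpmul2l.
rewrite -!(EFinM, EFinD) lee_fin le_eqVlt; apply/predU1P; left.
have -> : e = del * C by rewrite /del divfK// gt_eqF.
by rewrite /C; ring.
Unshelve. all: by end_near.
Qed.

End stability.

Theorem theorem11 (R : realType) (d : measure_display)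
    (Omega : measurableType d) (P : probability Omega R)
    (F : R -> set (set Omega)) (W : nat -> R -> Omega -> R)
    (lambda sigma T T' : R)
    (X0 : nat -> Omega -> R) (X X' : nat -> R -> Omega -> R)
    (hF : filtration F)
    (hW : forall n, brownian_motion P F (W n))
    (hWind : independent_processes P W)
    (hlambda : 1 < lambda) (hsigma : 0 <= sigma)
    (hT : 0 < T) (hTT' : T <= T')
    (hX0 : in_L2_Omega P lambda (-1) X0)
    (hX : moderate_solution P F W lambda sigma T X0 X)
    (hX' : moderate_solution P F W lambda sigma T' X0 X') :
  {ae P, forall w, forall n t, (1 <= n)%N -> 0 <= t <= T -> X n t w = X' n t w}.
Proof.
have T0' := lt_le_trans hT hTT'.
pose D n t w := X n t w - X' n t w.
have [[_ _ cX _ _] _ [mX _] _] := hX; have [[_ _ cX' _ _] _ [mX' _] _] := hX'.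
have mD n : (1 <= n)%N -> measurable_fun (strip T) (on_strip (D n)).
  move=> n1; apply: measurable_funB; first exact: mX.
  exact: (measurable_funS (measurable_strip T') (strip_sub hTT') (mX' n n1)).
have cD n w : (1 <= n)%N -> {within `[0, T], continuous (D n ^~ w)}.
  move=> n1 x; apply: cvgB; first exact: (@cX n w n1).
  apply: continuous_subspaceW (@cX' n w n1) x => s /=; rewrite !in_itv /=.
  by move=> /andP[-> h]; exact: le_trans h hTT'.
have path0 n : (1 <= n)%N ->
    {ae P, forall w, (\int[lebesgue_measure]_(s in `[0%R, T]) (D n s w ^+ 2)%:E = 0)%E}.
  move=> n1; have := moderate_sqdist0 hF hW hWind hlambda hT hTT' hX hX' n1.
  rewrite (strip_sqnorm_path P (mD n n1)) => D0.
  have := (ae_eq_integral_abs P measurableT (measurable_path_sqnorm (mD n n1))).1.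
  move=> H; have : ae_eq P setT (fun w =>
      (\int[lebesgue_measure]_(s in `[0%R, T]) (D n s w ^+ 2)%:E)%E) (cst 0%E).
    apply: H; rewrite -[RHS]D0; apply: eq_integral => w _.
    by rewrite gee0_abs//; apply: integral_ge0 => s _; rewrite lee_fin sqr_ge0.
  by apply: filterS => w; apply.
have : {ae P, forall w, forall n, (1 <= n)%N ->
    (\int[lebesgue_measure]_(s in `[0%R, T]) (D n s w ^+ 2)%:E = 0)%E}.
  apply/ae_foralln => n; have [n1|n1] := boolP (1 <= n)%N.
    by have := path0 n n1; apply: filterS.
  by apply: nearW => w.
apply: filterS => w D0 n t n1 tT; apply/eqP; rewrite -subr_eq0; apply/eqP.
exact: (continuous_sqnorm0 hT (@cD n w n1) (D0 n n1) tT).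
Qed.
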